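(* Assume that there exist constants $0<c_1<c_2<\infty$ and a function $\gamma:\mathbb{R}^d\to\mathbb{R}$ such that $(\gamma,\ldots,\gamma)^\top\in\mathcal{W}_{[-b,b]^d}$ for some fixed $0<b<\infty$ and, on $\mathbb{R}^d$, $$c_1\gamma^2 I_p\le \mathbf{F}^{(0)}\le c_2\gamma^2 I_p,\qquad c_1\gamma^2 I_p\le \mathbf{F}^{(1)}\le c_2\gamma^2 I_p .$$ Assume that there exists a matrix-valued function $\mathbf{B}$ on $(\mathbb{R}^d)^2$ such that for $\lambda,\mu\in\mathbb{R}^d$, $\mathbf{B}(\lambda,\mu)=[b_{ij}(\lambda,\mu)]_{i,j=1}^p$ is a $p\times p$ complex matrix, with $\mathbf{B}(\lambda,\mu)=\overline{\mathbf{B}(\mu,\lambda)}^\top$ for all $\lambda,\mu\in\mathbb{R}^d$, such that for $i,j=1,\ldots,p$ $$\int_{\mathbb{R}^d}\int_{\mathbb{R}^d}|b_{ij}(\lambda,\mu)|^2\,\|\mathbf{F}^{(0)}(\lambda)\|\,\|\mathbf{F}^{(0)}(\mu)\|\,d\lambda\,d\mu<+\infty,$$ and such that for all $t,s\in D$, with $h=t-s$, $$\mathbf{R}^{(1)}(h)-\mathbf{R}^{(0)}(h)=\int_{\mathbb{R}^d}\int_{\mathbb{R}^d}e^{-\mathrm{i}\lambda^\top t+\mathrm{i}\mu^\top s}\,\mathbf{F}^{(0)}(\lambda)\mathbf{B}(\lambda,\mu)\mathbf{F}^{(0)}(\mu)\,d\lambda\,d\mu .$$ Then $P(\mathbf{R}^{(0)})\equiv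 P(\mathbf{R}^{(1)})$ on the paths of $\mathbf{Z}$.
   Context: Let $d,p$ be positive integers and $D\subset\mathbb{R}^d$ a fixed bounded set with non-empty interior. For $a=0,1$, $\mathbf{R}^{(a)}=[R^{(a)}_{ij}]_{i,j=1}^p:\mathbb{R}^d\to\mathbb{R}^{p\times p}$ is a stationary matrix covariance function (positive definite: $\sum_{\ell,k=1}^n a_\ell^\top\mathbf{R}^{(a)}(s_\ell-s_k)a_k\ge0$ for all $n$, points $s_1,\dots,s_n$ and vectors $a_1,\dots,a_n\in\mathbb{R}^p$) whose entries are continuous and summable on $\mathbb{R}^d$. It has matrix spectral density $\mathbf{F}^{(a)}=[F^{(a)}_{ij}]_{i,j=1}^p$, i.e. $R^{(a)}_{ij}(h)=\int_{\mathbb{R}^d}F^{(a)}_{ij}(\lambda)e^{\mathrm{i}h^\top\lambda}d\lambda$; the $F^{(a)}_{jj}$ are real-valued, strictly positive and summable on $\mathbb{R}^d$, and for $i\ne j$ the complex-valued $F^{(a)}_{ij}$ has $|F^{(a)}_{ij}|$ summable. The matrices $\mathbf{F}^{(a)}(\lambda)$ are Hermitian non-negative definite. Notation: $\mathrm{i}^2=-1$; $\|\mathbf{N}\|$ is the largest singular value of a square complex matrix; for Hermitian matrices, $\mathbf{M}\ge\mathbf{N}$ means $\bar v^\top\mathbf{M}v\ge\bar v^\top\mathbf{N}v$ for all $v\in\mathbb{C}^p$; $I_p$ is the identity matrix. For a function $g$, the Fourier transform is $\mathcal{F}(g)(\lambda)=(2\pi)^{-d}\int_{\mathbb{R}^d}g(t)e^{-\mathrm{i}\lambda^\top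 t}dt$. For a bounded set $S\subset\mathbb{R}^d$ with non-empty interior, $\mathcal{W}_S$ is the set of functions $(f_1,\ldots,f_p)^\top:\mathbb{R}^d\to\mathbb{C}^p$ with $f_i=\mathcal{F}(g_i)$ for some $g_i\in L^2(\mathbb{R}^d)$ that is zero outside $S$. $\mathbf{Z}=\{\mathbf{Z}(s)=(Z_1(s),\ldots,Z_p(s))^\top,\ s\in D\}$ is a $p$-variate random field on a measurable space $(\Omega,\mathcal{A})$. $P(\mathbf{R}^{(a)})$ denotes a probability measure on it under which $\mathbf{Z}$ is Gaussian with zero mean and $\mathrm{Cov}(Z_i(t),Z_j(s))=R^{(a)}_{ij}(t-s)$ for $t,s\in D$. Two measures $P^{(0)},P^{(1)}$ are equivalent on the paths of $\mathbf{Z}$, written $P^{(0)}\equiv P^{(1)}$, if for every $A$ in the $\sigma$-algebra generated by $\mathbf{Z}$, $P^{(1)}(A)=1$ if and only if $P^{(0)}(A)=1$. *)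

(* Defs.v *)
From HB Require Import structures.
From mathcomp Require Import all_boot all_order all_algebra.
From mathcomp Require Import all_classical all_reals all_analysis.
From mathcomp Require Import complex.

Set Implicit Arguments.
Unset Strict Implicit.
Unset Printing Implicit Defensive.

Import Order.TTheory GRing.Theory Num.Theory.
Import numFieldNormedType.Exports.

Local Open Scope classical_set_scope.
Local Open Scope ring_scope.
Local Open Scope complex_scope.
Local Open Scope sesquilinear_scope.

Definition rV_display : measure_display. Proof. exact: default_measure_display. Qed.

Section measurable_rV.
Context (R : realType) (n : nat).

Let coors : 'I_n -> 'rV[R]_n -> R := fun i x => x 0 i.

Let rV_set0 : g_sigma_preimage coors set0.
Proof. exact: sigma_algebra0. Qed.

Let rV_setC A : g_sigma_preimage coors A -> g_sigma_preimage coors (~` A).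
Proof. exact: sigma_algebraC. Qed.

Let rV_bigcup (F : (set 'rV[R]_n)^nat) : (forall i, g_sigma_preimage coors (F i)) ->
  g_sigma_preimage coors (\bigcup_i (F i)).
Proof. exact: sigma_algebra_bigcup. Qed.

(* Since R is second countable, this is the Borel sigma-algebra of R^n. *)
HB.instance Definition _ := @isMeasurable.Build rV_display
  'rV[R]_n (g_sigma_preimage coors) rV_set0 rV_setC rV_bigcup.

End measurable_rV.

Section rV_cons.
Context (R : realType).

Lemma measurable_coord n (i : 'I_n) :
  measurable_fun [set: 'rV[R]_n] (fun x : 'rV[R]_n => x 0 i).
Proof.
move=> _ Y mY; rewrite setTI; apply: sub_sigma_algebra => /=.
rewrite -bigcup_seq/=; exists i => /=; first by rewrite mem_index_enum.
by exists Y => //; rewrite setTI.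
Qed.

Lemma measurable_rVP d (T : measurableType d) n (f : T -> 'rV[R]_n) :
  (forall i, measurable_fun [set: T] (fun x => f x 0 i)) ->
  measurable_fun [set: T] f.
Proof.
move=> mf _ A mA; rewrite setTI.
have : (fun B => measurable (f @^-1` B)) A; last by [].
move: A mA; apply: smallest_sub.
  split; first by rewrite preimage_set0.
  - by move=> A mA; rewrite setTD preimage_setC; exact: measurableC.
  - by move=> F mF; rewrite preimage_bigcup; exact: bigcupT_measurable.
rewrite -bigcup_seq/= => _ [i _ [B mB <-]] /=.
by rewrite setTI -comp_preimage -[X in measurable X]setTI; exact: mf.
Qed.

Definition rV_cons n (x : measurableTypeR R * 'rV[R]_n) : 'rV[R]_n.+1 :=
  row_mx x.1%:M x.2 : 'rV[R]_(1 + n).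

Definition rV_uncons n (v : 'rV[R]_n.+1) : measurableTypeR R * 'rV[R]_n :=
  ((v : 'rV[R]_(1 + n)) 0 (lshift n 0), rsubmx (v : 'rV[R]_(1 + n))).

Lemma rV_consK n : cancel (@rV_cons n) (@rV_uncons n).
Proof.
move=> [x v]; rewrite /rV_uncons /rV_cons /=; congr pair.
  by rewrite (@row_mxEl _ 1 1 n) mxE eqxx mulr1n.
by rewrite row_mxKr.
Qed.

Lemma rV_unconsK n : cancel (@rV_uncons n) (@rV_cons n).
Proof.
move=> v; apply/rowP => i; rewrite /rV_uncons /rV_cons /=.
case: (@split_ordP 1 n i) => j ->.
  by rewrite (@row_mxEl _ 1 1 n) mxE ord1 eqxx mulr1n.
by rewrite (@row_mxEr _ 1 1 n) mxE.
Qed.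

Lemma measurable_rV_cons n : measurable_fun setT (@rV_cons n).
Proof.
apply: measurable_rVP => i; case: (@split_ordP 1 n i) => j ->.
  under eq_fun do rewrite /rV_cons (@row_mxEl _ 1 1 n) mxE ord1 eqxx mulr1n.
  exact: measurable_fst.
under eq_fun do rewrite /rV_cons (@row_mxEr _ 1 1 n).
exact: (measurableT_comp (measurable_coord j) measurable_snd).
Qed.

Lemma measurable_rV_uncons n : measurable_fun setT (@rV_uncons n).
Proof.
apply: measurable_fun_pair => /=; first exact: measurable_coord.
apply: measurable_rVP => i.
under eq_fun do rewrite mxE.
exact: measurable_coord.
Qed.

End rV_cons.

Section lebesgue_rV_cons.
Context (R : realType) (n : nat).
Variable m : {sigma_finite_measure set 'rV[R]_n -> \bar R}.

Definition lebesgue_rV_cons : set 'rV[R]_n.+1 -> \bar R :=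
  pushforward (@lebesgue_measure R \x m)%E (@rV_cons R n).

Let cons0 : lebesgue_rV_cons set0 = 0%E.
Proof. by rewrite /lebesgue_rV_cons /pushforward preimage_set0 measure0. Qed.

Let cons_ge0 A : (0 <= lebesgue_rV_cons A)%E.
Proof. exact: (measure_ge0 (@lebesgue_measure R \x m)%E). Qed.

Let cons_sigma_additive : semi_sigma_additive lebesgue_rV_cons.
Proof.
move=> F mF tF mUF; rewrite /lebesgue_rV_cons /pushforward preimage_bigcup.
have mcons A : measurable A -> measurable (@rV_cons R n @^-1` A).
  by move=> mA; rewrite -[X in measurable X]setTI; exact: measurable_rV_cons.
apply: measure_semi_sigma_additive.
- by move=> k; exact: mcons.
- apply/trivIsetP => /= i j _ _ ij; rewrite -preimage_setI.
  by move/trivIsetP : tF => /(_ _ _ _ _ ij) ->//; rewrite preimage_set0.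
- by rewrite -preimage_bigcup; exact: mcons.
Qed.

HB.instance Definition _ := isMeasure.Build _ _ _ lebesgue_rV_cons
  cons0 cons_ge0 cons_sigma_additive.

Let cons_sigma_finite : sigma_finite setT lebesgue_rV_cons.
Proof.
have /sigma_finiteP[F [TF ndF Foo]] := sigma_finiteT (@lebesgue_measure R).
have /sigma_finiteP[G [TG ndG Goo]] := sigma_finiteT m.
exists (fun k => @rV_uncons R n @^-1` (F k `*` G k)).
  rewrite -preimage_bigcup [X in _ @^-1` X](_ : _ = setT) ?preimage_setT//.
  apply/seteqP; split => // -[x y] _.
  have : setT x by []. have : setT y by [].
  rewrite TF TG => -[k _ Gky] [l _ Flx]; exists (maxn k l) => //; split => /=.
    by move: x Flx; exact/subsetPset/ndF/leq_maxr.
  by move: y Gky; exact/subsetPset/ndG/leq_maxl.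
move=> k; have [mFk Fkoo] := Foo k; have [mGk Gkoo] := Goo k; split.
  rewrite -[X in measurable X]setTI; apply: measurable_rV_uncons => //.
  exact: measurableX.
rewrite /lebesgue_rV_cons /pushforward -comp_preimage.
rewrite (_ : (@rV_uncons R n \o @rV_cons R n) = id); last first.
  by apply/funext => x /=; rewrite rV_consK.
by rewrite preimage_id product_measure1E// lte_mul_pinfty// ge0_fin_numE.
Qed.

HB.instance Definition _ := Measure_isSigmaFinite.Build _ _ _ lebesgue_rV_cons
  cons_sigma_finite.

End lebesgue_rV_cons.

(* Lebesgue measure on R^n, see lebesgue_rV_box. *)
Fixpoint lebesgue_rV (R : realType) (n : nat) :
    {sigma_finite_measure set 'rV[R]_n -> \bar R} :=
  match n return {sigma_finite_measure set 'rV[R]_n -> \bar R} with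
  | 0 => \d_(0 : 'rV[R]_0)
  | k.+1 => lebesgue_rV_cons (lebesgue_rV R k)
  end.

Lemma lebesgue_rV_box (R : realType) n (a b : 'rV[R]_n) :
  (forall i, a 0 i <= b 0 i) ->
  lebesgue_rV R n [set x | forall i, x 0 i \in `[a 0 i, b 0 i]] =
  (\prod_i (b 0 i - a 0 i))%:E.
Proof.
elim: n a b => [|n IHn] a b ab.
  rewrite big_ord0 /= diracE mem_set//=; by case.
have mbox k (u v : 'rV[R]_k) :
    measurable [set x : 'rV[R]_k | forall i, x 0 i \in `[u 0 i, v 0 i]].
  rewrite (_ : mkset _ = \bigcap_(i in [set: 'I_k])
      ((fun x : 'rV[R]_k => x 0 i) @^-1` `[u 0 i, v 0 i])).
    apply: fin_bigcap_measurable => // i _.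
    rewrite -[X in measurable X]setTI; apply: measurable_coord => //.
  apply/seteqP; split => x /= h i; first by move=> _; exact: h.
  exact: h.
pose a' := (rV_uncons a).2; pose b' := (rV_uncons b).2.
rewrite /= /lebesgue_rV_cons /pushforward.
rewrite (_ : _ @^-1` _ = `[a 0 ord0, b 0 ord0] `*`
   [set x : 'rV[R]_n | forall i, x 0 i \in `[a' 0 i, b' 0 i]]); last first.
  have l0 : @lshift 1 n 0 = ord0 by exact/val_inj.
  have ra (c : 'rV[R]_n.+1) i : (rV_uncons c).2 0 i = c 0 (@rshift 1 n i).
    by rewrite mxE.
  apply/seteqP; split => -[x v] /=.
    move=> h; split.
      by have := h (@lshift 1 n 0); rewrite /rV_cons (@row_mxEl _ 1 1 n) mxE eqxx mulr1n l0.
    by move=> i; have := h (@rshift 1 n i); rewrite /rV_cons (@row_mxEr _ 1 1 n) !ra.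
  move=> [h1 h2] i; case: (@split_ordP 1 n i) => j ->.
    by rewrite /rV_cons (@row_mxEl _ 1 1 n) mxE ord1 eqxx mulr1n l0.
  by rewrite /rV_cons (@row_mxEr _ 1 1 n) -!ra; exact: h2.
rewrite product_measure1E//; last exact: mbox.
rewrite IHn; last first.
  by move=> i; rewrite /a' /b' /rV_uncons /= !mxE; exact: ab.
rewrite (_ : _ `[_, _]%classic = (b 0 ord0 - a 0 ord0)%:E); last first.
  rewrite [LHS]lebesgue_measure_itv/= lte_fin.
  have := ab ord0; rewrite le_eqVlt => /predU1P[->|->//].
  by rewrite ltxx subrr.
rewrite big_ord_recl EFinM; congr (_ * _%:E)%E.
apply: eq_bigr => i _; rewrite /a' /b' /rV_uncons /= !mxE.
by rewrite (_ : @rshift 1 n i = lift ord0 i)//; exact/val_inj.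
Qed.

Section complex_integral.
Context d (T : measurableType d) (R : realType).
Variable mu : {measure set T -> \bar R}.

Definition cmeasurable (f : T -> R[i]) : Prop :=
  measurable_fun setT (fun x => complex.Re (f x)) /\
  measurable_fun setT (fun x => complex.Im (f x)).

Definition cintegrable (f : T -> R[i]) : Prop :=
  mu.-integrable setT (fun x => (complex.Re (f x))%:E) /\
  mu.-integrable setT (fun x => (complex.Im (f x))%:E).

Definition cintegral (f : T -> R[i]) : R[i] :=
  (\int[mu]_x complex.Re (f x)) +i* (\int[mu]_x complex.Im (f x)).

Definition mxintegral m n (f : T -> 'M[R[i]]_(m, n)) : 'M[R[i]]_(m, n) :=
  \matrix_(i, j) cintegral (fun x => f x i j).

End complex_integral.

Section complex_tools.
Context (R : realType).

Definition cabs (z : R[i]) : R := ComplexField.Normc.normc z.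

Definition cis (x : R) : R[i] := cos x +i* sin x.

Definition dotv d (x y : 'rV[R]_d) : R := (x *m y^T) 0 0.

Definition singular_value p (N : 'M[R[i]]_p) : set R :=
  [set s | 0 <= s /\ eigenvalue (N^t* *m N) (s ^+ 2)%:C].

(* The set of singular values is finite, and non-empty when 0 < p, so that
   the supremum is a maximum. *)
Definition opnorm p (N : 'M[R[i]]_p) : R := sup (singular_value N).

Definition loewner_le p (N M : 'M[R[i]]_p) : Prop :=
  forall v : 'cV[R[i]]_p, (v^t* *m N *m v) 0 0 <= (v^t* *m M *m v) 0 0.

End complex_tools.

Section fourier.
Context (R : realType) (d : nat).

Definition fourier (g : 'rV[R]_d -> R[i]) (l : 'rV[R]_d) : R[i] :=
  (((2 * pi) ^- d)%:C *
   cintegral (lebesgue_rV R d) (fun t => g t * cis (- dotv l t)))%R.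

Definition square_integrable (g : 'rV[R]_d -> R[i]) : Prop :=
  cmeasurable g /\
  (\int[lebesgue_rV R d]_t (cabs (g t) ^+ 2)%:E < +oo)%E.

Definition bandlimited p (S : set 'rV[R]_d) (f : 'rV[R]_d -> 'cV[R[i]]_p) : Prop :=
  forall i, exists g : 'rV[R]_d -> R[i],
    [/\ square_integrable g,
        forall t, ~ S t -> g t = 0 &
        forall l, f l i 0 = fourier g l].

Definition cube (b : R) : set 'rV[R]_d :=
  [set t | forall j, t 0 j \in `[- b, b]].

End fourier.

Section covariance_functions.
Context (R : realType) (d p : nat).

Definition positive_definite_fun (K : 'rV[R]_d -> 'M[R]_p) : Prop :=
  forall n (s : 'I_n -> 'rV[R]_d) (a : 'I_n -> 'cV[R]_p),
    0 <= \sum_l \sum_k ((a l)^T *m K (s l - s k) *m a k) 0 0.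

Definition covariance_function (K : 'rV[R]_d -> 'M[R]_p) : Prop :=
  [/\ positive_definite_fun K,
      forall i j, continuous (fun h => K h i j) &
      forall i j, (lebesgue_rV R d).-integrable setT (fun h => (K h i j)%:E)].

Definition spectral_density (K : 'rV[R]_d -> 'M[R]_p)
    (F : 'rV[R]_d -> 'M[R[i]]_p) : Prop :=
  [/\ forall i j, cintegrable (lebesgue_rV R d) (fun l => F l i j),
      (* in R[i], 0 < z means that z is real and positive *)
      forall j l, 0 < F l j j,
      forall l, F l \is hermsymmx,
      forall l, loewner_le 0 (F l) &
      forall h i j, (K h i j)%:C =
        cintegral (lebesgue_rV R d) (fun l => F l i j * cis (dotv h l))].

End covariance_functions.

(* normal_prob m s is not the point mass when s = 0, hence the case split. *)
Definition gaussian_law (R : realType) (m s : R) : set R -> \bar R :=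
  if s == 0 then \d_m else normal_prob m s.

Section random_field.
Context (R : realType) (d p : nat) (D : set 'rV[R]_d).
Context (dO : measure_display) (Omega : measurableType dO).
Implicit Types (P : probability Omega R) (Z : D -> 'I_p -> {mfun Omega >-> R}).

Definition gaussian_field P Z : Prop :=
  forall n (s : 'I_n -> D) (i : 'I_n -> 'I_p) (a : 'I_n -> R),
    exists m sigma : R, forall B : set R, measurable B ->
      P ((fun w => \sum_k a k * Z (s k) (i k) w) @^-1` B) =
      gaussian_law m sigma B.

Definition centered_gaussian_field P Z (K : 'rV[R]_d -> 'M[R]_p) : Prop :=
  [/\ gaussian_field P Z,
      forall t i, ('E_P[Z t i] = 0)%E &
      forall t s i j,
        covariance P (Z t i) (Z s j) = (K (val t - val s) i j)%:E].

Definition field_sigma_algebra Z : set (set Omega) :=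
  <<s [set A | exists t i (B : set R), measurable B /\ A = Z t i @^-1` B] >>.

Definition equivalent_on_paths (P0 P1 : probability Omega R) Z : Prop :=
  forall A, field_sigma_algebra Z A -> (P1 A = 1%E <-> P0 A = 1%E).

End random_field.

(* Main.v *)
(* Both laws are compared on finite-dimensional marginals, uniformly in the
   marginal. The vector X of observed values has covariances K0 and K1 under P0
   and P1. Some Y = A X, with X = C Y almost surely under both measures, has
   covariances 1 and diag(q_k). The bounds F0 ~ F1 ~ gamma^2 give
   c1 / c2 <= q_k <= c2 / c1, and q_k - 1 is the integral of the sesquilinear form
   F0 B F0 between two copies of the k-th feature function. The features are
   orthonormal for K0, so that Cauchy-Schwarz bounds sum_k (q_k - 1)^2 by a
   constant S depending on B and F0 only.
   For product Gaussian densities f0, f1 and small e > 0, f1 (f1 / f0)^e is again a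
   Gaussian density up to a factor bounded in terms of S, whence by Markov's
   inequality P1 E <= exp(L) P0 E + K exp(- e L) for all L and all cylinders E, and
   conversely. This inequality is stable under monotone limits, so it holds on the
   sigma-algebra generated by the field. If P0 E = 0, letting L tend to infinity
   gives P1 E = 0. *)

Require Import Defs.
From HB Require Import structures.
From mathcomp Require Import all_boot all_order all_algebra.
From mathcomp Require Import all_classical all_reals all_analysis.
From mathcomp Require Import complex measurable_realfun.
From mathcomp Require Import ring lra.

Set Implicit Arguments.
Unset Strict Implicit.
Unset Printing Implicit Defensive.

Import Order.TTheory GRing.Theory Num.Theory.
Import numFieldNormedType.Exports.

Local Open Scope classical_set_scope.
Local Open Scope ring_scope.

(** * Gaussian integrals and Fourier uniqueness *)

(** Equivalence of all finite-dimensional marginals does not imply equivalence on the generated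
    sigma-algebra; an estimate whose constants ignore the sample size does. This uniformity rests on
    a Bessel inequality. Since trace F0 is comparable to gamma^2, features orthonormal for K0 form a
    Bessel system in L2(trace F0) with constant p c2 / c1 for every sample, so the diagonal
    coefficients of a Hilbert-Schmidt kernel against them are square summable. Square summability
    suffices because the terms of first order in q_k - 1 cancel in the normalizing constant of the
    tilted density; the exponent e = c1 / (2 c2) keeps every tilted variance finite. Two obstacles
    shape the finite-dimensional part. Gaussianity is given through one-dimensional linear
    combinations only, so joint laws are recovered from expectations of cosines, one coordinate at a
    time. Covariance matrices may be singular, for instance when a sample point is repeated; the
    reduction then has to use the same A and C under both measures, which is possible because K0 and
    K1 have the same null vectors. *)

Section Rintegral_finite_sums.
Context d (T : measurableType d) (R : realType) (mu : {measure set T -> \bar R}).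

Lemma integrableMl_cst (f : T -> R) (c : R) : mu.-integrable setT (EFin \o f) ->
  mu.-integrable setT (EFin \o (fun x => c * f x)).
Proof.
move=> fi; have := @integrableZl _ _ _ mu setT measurableT c _ fi.
by apply: eq_integrable => // w _ /=; rewrite EFinM.
Qed.

Lemma integrable_Rsum (I : Type) (r : seq I) (f : I -> T -> R) :
  (forall i, mu.-integrable setT (EFin \o f i)) ->
  mu.-integrable setT (EFin \o (fun w => \sum_(i <- r) f i w)).
Proof.
move=> fi; elim: r => [|i r IH].
  rewrite (_ : _ \o _ = cst 0%E); first exact: integrable0.
  by apply/funext => w /=; rewrite big_nil.
have := integrableD measurableT (fi i) IH.
by apply: eq_integrable => // w _ /=; rewrite big_cons EFinD.
Qed.

Lemma Rintegral_sum (I : Type) (r : seq I) (f : I -> T -> R) :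
  (forall i, mu.-integrable setT (EFin \o f i)) ->
  \int[mu]_w (\sum_(i <- r) f i w) = \sum_(i <- r) \int[mu]_w f i w.
Proof.
move=> fi; elim: r => [|i r IH].
  by rewrite big_nil /Rintegral integral0_eq// => w _; rewrite big_nil.
rewrite big_cons -IH -RintegralD//; last exact: integrable_Rsum.
by apply: eq_Rintegral => w _; rewrite big_cons.
Qed.

End Rintegral_finite_sums.

Section gaussian_fourier.
Context {R : realType}.
Notation mu := (@lebesgue_measure R).
Implicit Types (x t : R).

(** Integration by parts over the whole line: the fundamental theorem of calculus on growing
    intervals leaves boundary terms that vanish, and dominated convergence with majorant [|h|] gives
    the limit. *)
Lemma Rintegral_derive_vanish (H h : R -> R) :
  (forall x, is_derive x 1 H (h x)) -> continuous h ->
  mu.-integrable setT (EFin \o h) ->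
  H n%:R @[n --> \oo] --> 0 -> H (- n%:R) @[n --> \oo] --> 0 ->
  \int[mu]_x h x = 0.
Proof.
move=> dH ch ih Hy HNy.
have cH : continuous H.
  by move=> x; apply: differentiable_continuous; apply/derivable1_diffP; case: (dH x).
(* [n.+1] rather than [n] keeps the two endpoints distinct, as the fundamental theorem of calculus
   asks for. *)
pose I n : set R := `[- n.+1%:R, n.+1%:R]%classic.
have mI n : measurable (I n) by exact: measurable_itv.
have key n : (\int[mu]_x ((EFin \o h) \_ (I n)) x = (H n.+1%:R - H (- n.+1%:R))%:E)%E.
  rewrite -integral_mkcond EFinB; apply: continuous_FTC2.
  - by rewrite -subr_gt0 opprK -natrD ltr0n.
  - by apply: continuous_subspaceT.
  - split.
    + by move=> x _; case: (dH x).
    + by apply: cvg_at_right_filter; exact: cH.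
    + by apply: cvg_at_left_filter; exact: cH.
  - by move=> x _; rewrite derive1E; case: (dH x).
have mh : measurable_fun setT h by have /integrableP[/measurable_EFinP] := ih.
have [] := @dominated_convergence _ _ _ mu setT measurableT
   (fun n => (EFin \o h) \_ (I n)) (EFin \o h) (fun x => `|h x|%:E).
- move=> n; apply/(measurable_restrictT _ (mI n)).
  by apply: measurable_funTS; exact/measurable_EFinP.
- exact/measurable_EFinP.
- apply/aeW => x _; apply: cvg_near_cst.
  have [N HN] : exists N, `|x| <= N%:R.
    exists (Num.bound `|x|); exact/ltW/archi_boundP/normr_ge0.
  exists N => // n /= Nn; rewrite /patch mem_set//= /I /= in_itv/= -ler_norml.
  by rewrite (le_trans HN)// ler_nat ltnW.
- exact: integrable_norm.
- apply/aeW => x n _ /=; rewrite /patch; case: ifP => // _.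
  by rewrite (_ : abse point = 0%E) ?lee_fin// /abse/= normr0.
move=> _ _ /=.
under eq_fun do rewrite key.
have Hl : (H n.+1%:R - H (- n.+1%:R))%:E @[n --> \oo] --> (0 - 0 : R)%:E.
  apply: cvg_EFin; first by near=> n.
  apply: cvgB.
    by rewrite (cvg_shiftS (fun n => H n%:R)).
  by rewrite (cvg_shiftS (fun n => H (- n%:R))).
move=> /(cvg_unique _ Hl) => e.
by rewrite /Rintegral -[X in fine X]e// subr0.
Unshelve. all: end_near.
Qed.

Variable s : R.
Hypothesis s0 : s != 0.

Let s2_gt0 : 0 < s ^+ 2. Proof. by rewrite exprn_even_gt0. Qed.

Let gaussf x := expR (- (x ^+ 2 / (2 * s ^+ 2))).

Let normal_pdf0E x : normal_pdf 0 s x = normal_peak s * gaussf x.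
Proof.
by rewrite normal_pdfE// /normal_fun /gaussf subr0 mulNr mulr_natl.
Qed.

Lemma is_derive_gaussf x : is_derive x 1 gaussf (- (x / s ^+ 2) * gaussf x).
Proof.
have h : is_derive x 1 (fun y : R => - (y ^+ 2 / (2 * s ^+ 2))) (- (x / s ^+ 2)).
  apply: is_derive_eq.
  rewrite /GRing.scale/=.
  by field.
have := @is_derive1_comp _ expR (fun y : R => - (y ^+ 2 / (2 * s ^+ 2))) x _ _ _ h.
by move=> /(_ _ (is_derive_expR _)) h'; apply: is_derive_eq h' _; exact: mulrC.
Qed.

Lemma continuous_gaussf : continuous gaussf.
Proof.
move=> x; apply: differentiable_continuous; apply/derivable1_diffP.
by case: (is_derive_gaussf x).
Qed.

Lemma gaussf_ge0 x : 0 <= gaussf x. Proof. exact: expR_ge0. Qed.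

(** Half of the exponent pays for the factor [|x|] through [1 + v <= expR v]; the other half remains
    as an integrable majorant. This is what permits differentiation under the integral below. *)
Lemma gaussf_absM x : `|x| * gaussf x <= (1 + s ^+ 2) * expR (- (x ^+ 2 / (4 * s ^+ 2))).
Proof.
pose q := s ^+ 2; have q0 : 0 < q by [].
rewrite /gaussf -/q (_ : expR _ = expR (- (x ^+ 2 / (4 * q))) * expR (- (x ^+ 2 / (4 * q)))); last first.
  by rewrite -expRD; congr expR; field; rewrite gt_eqF.
rewrite mulrA ler_wpM2r ?expR_ge0//.
rewrite expRN ler_pdivrMr ?expR_gt0//.
apply: (@le_trans _ _ ((1 + q) * (1 + (x ^+ 2 / (4 * q))))); last first.
  by apply: ler_wpM2l; [rewrite addr_ge0// ltW|exact: expR_ge1Dx].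
rewrite -(real_normK (num_real x)); move: `|x| => y.
have -> : (1 + q) * (1 + y ^+ 2 / (4 * q)) = 1 + q + y ^+ 2 / (4 * q) + y ^+ 2 / 4.
  by field; rewrite gt_eqF.
have h : 0 <= y ^+ 2 / (4 * q) by rewrite divr_ge0 ?sqr_ge0// mulr_ge0// ltW.
have := sqr_ge0 (y / 2 - 1); lra.
Qed.

Lemma integrable_gaussf (a : R) : 0 < a ->
  mu.-integrable setT (EFin \o (fun x => expR (- (a * x ^+ 2)))).
Proof.
move=> a0.
pose s' := (Num.sqrt (a *+ 2))^-1.
have s'0 : s' != 0 by rewrite invr_neq0// gt_eqF// sqrtr_gt0 pmulrn_lgt0.
have := @integrableZl _ _ _ mu setT measurableT (normal_peak s')^-1 _ (@integrable_normal_pdf R 0 s').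
apply: eq_integrable => // x _ /=.
rewrite normal_pdfE// -EFinM mulrA mulVf ?gt_eqF ?normal_peak_gt0// mul1r /normal_fun subr0.
congr (expR _)%:E; rewrite mulNr; congr (- _).
rewrite /s' exprVn sqr_sqrtr ?mulrn_wge0 ?ltW//.
by rewrite !mulr2n; field; rewrite gt_eqF// addr_gt0.
Qed.

Lemma integrable_gaussf1 : mu.-integrable setT (EFin \o gaussf).
Proof.
have := @integrable_gaussf ((2 * s ^+ 2)^-1); rewrite invr_gt0 mulr_gt0// => /(_ isT).
by apply: eq_integrable => // x _ /=; rewrite /gaussf mulrC.
Qed.

Lemma bounded_gaussf (f : R -> R) (M : R) : measurable_fun setT f ->
  (forall x, `|f x| <= M) -> mu.-integrable setT (EFin \o (fun x => f x * gaussf x)).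
Proof.
move=> mf fM.
have mg : measurable_fun setT gaussf by apply: continuous_measurable_fun; exact: continuous_gaussf.
apply: (@le_integrable _ _ _ mu _ measurableT _ (EFin \o (fun x => M * gaussf x))) => //.
- by apply/measurable_EFinP; exact: measurable_funM.
- move=> x _ /=; rewrite lee_fin normrM (ger0_norm (gaussf_ge0 x)).
  rewrite [leRHS]ger0_norm; first exact: ler_wpM2r (gaussf_ge0 x) _ _ (fM x).
  by rewrite mulr_ge0 ?gaussf_ge0// (le_trans _ (fM x)).
- rewrite (_ : _ \o _ = (fun x => M%:E * (EFin \o gaussf) x)%E); last by apply/funext => x /=; rewrite EFinM.
  by apply: integrableZl => //; exact: integrable_gaussf1.
Qed.

Lemma bounded_gaussfM (f : R -> R) : measurable_fun setT f ->
  (forall x, `|f x| <= 1) -> mu.-integrable setT (EFin \o (fun x => x * f x * gaussf x)).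
Proof.
move=> mf fM.
have mg : measurable_fun setT gaussf by apply: continuous_measurable_fun; exact: continuous_gaussf.
apply: (@le_integrable _ _ _ mu _ measurableT _ (EFin \o (fun x => (1 + s ^+ 2) * expR (- ((4 * s ^+ 2)^-1 * x ^+ 2))))) => //.
- by apply/measurable_EFinP; apply: measurable_funM => //; exact: measurable_funM.
- move=> x _ /=; rewrite lee_fin !normrM (ger0_norm (gaussf_ge0 x)) (ger0_norm (expR_ge0 _)).
  rewrite (@ger0_norm _ (1 + s ^+ 2)) ?addr_ge0 ?sqr_ge0//.
  rewrite mulrAC (mulrC (4 * _)^-1); apply: le_trans (gaussf_absM x).
  by rewrite ler_piMr// mulr_ge0// gaussf_ge0.
- rewrite (_ : _ \o _ = (fun x => (1 + s ^+ 2)%:E * (EFin \o (fun x => expR (- ((4 * s ^+ 2)^-1 * x ^+ 2)))) x)%E); last by apply/funext => x /=; rewrite EFinM.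
  by apply: integrableZl => //; apply: integrable_gaussf; rewrite invr_gt0 mulr_gt0.
Qed.


Variable c : R.

Let bounded_cos (t x : R) : `|cos (t * x + c)| <= 1.
Proof. by rewrite ler_norml cos_geN1 cos_le1. Qed.

Let bounded_sin (t x : R) : `|sin (t * x + c)| <= 1.
Proof. by rewrite ler_norml sin_geN1 sin_le1. Qed.

Let meas_cos (t : R) : measurable_fun setT (fun x => cos (t * x + c)).
Proof.
apply: (measurableT_comp (f := cos)).
  by apply: continuous_measurable_fun; exact: continuous_cos.
by apply: measurable_funD => //; exact: measurable_funM.
Qed.

Let meas_sin (t : R) : measurable_fun setT (fun x => sin (t * x + c)).
Proof.
apply: (measurableT_comp (f := sin)).
  by apply: continuous_measurable_fun; exact: continuous_sin.
by apply: measurable_funD => //; exact: measurable_funM.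
Qed.

Lemma cvg_bounded_gaussf (f : R^nat) : (forall n, `|f n| <= 1) -> f n * gaussf n%:R @[n --> \oo] --> 0.
Proof.
move=> fb; apply/cvgr0Pnorm_le => e e0.
pose q := s ^+ 2; have q0 : 0 < q by [].
have [N HN] : exists N : nat, 2 * q / e <= N%:R.
  by exists (Num.bound (2 * q / e)); apply/ltW/archi_boundP/divr_ge0; [apply/mulr_ge0; rewrite ?sqr_ge0|exact/ltW].
exists N.+1 => // n /= Nn.
rewrite normrM (@le_trans _ _ (gaussf n%:R))//.
  by rewrite (ger0_norm (gaussf_ge0 _)) ler_piMl ?gaussf_ge0.
rewrite /gaussf expRN -(invrK e) lef_pV2 ?posrE ?expR_gt0 ?invr_gt0//.
apply: le_trans (expR_ge1Dx _).
have n1 : (1 : R) <= n%:R by rewrite ler1n (leq_trans _ Nn).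
have : N%:R <= n%:R :> R by rewrite ler_nat ltnW.
move=> /(le_trans HN) h2.
have h3 : n%:R <= n%:R ^+ 2 :> R by rewrite expr2 ler_peMl// (le_trans _ n1).
rewrite -/q ler_wpDl// ler_pdivlMr ?(mulr_gt0 _ q0)//.
by rewrite mulrC (le_trans h2).
Qed.

Let F t := \int[mu]_x (cos (t * x + c) * gaussf x).

(** The derivative of [s ^+ 2 * sin (t * x + c) * gaussf x] is
    [s ^+ 2 * t * cos (t * x + c) * gaussf x] minus the integrand on the left, and it has integral
    0. *)
Lemma gaussf_fourier_ibp t :
  \int[mu]_x (x * sin (t * x + c) * gaussf x) = s ^+ 2 * t * F t.
Proof.
pose H x := s ^+ 2 * sin (t * x + c) * gaussf x.
pose h x := s ^+ 2 * t * (cos (t * x + c) * gaussf x) - x * sin (t * x + c) * gaussf x.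
have i1 : mu.-integrable setT (EFin \o (fun x => cos (t * x + c) * gaussf x)).
  exact: (@bounded_gaussf _ 1).
have i1' : mu.-integrable setT (EFin \o (fun x => s ^+ 2 * t * (cos (t * x + c) * gaussf x))).
  have := @integrableZl _ _ _ mu setT measurableT (s ^+ 2 * t) _ i1.
  by apply: eq_integrable => // x _ /=; rewrite EFinM.
have i2 : mu.-integrable setT (EFin \o (fun x => x * sin (t * x + c) * gaussf x)).
  exact: bounded_gaussfM.
have ih : mu.-integrable setT (EFin \o h).
  have := integrableB measurableT i1' i2.
  by apply: eq_integrable => // x _ /=; rewrite EFinB.
have : \int[mu]_x h x = 0.
  apply: (@Rintegral_derive_vanish H) => //.
  - move=> x; rewrite /H /h.
    have hg := is_derive_gaussf x.
    have hs : is_derive x 1 (fun x => sin (t * x + c)) (t * cos (t * x + c)).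
      have hl : is_derive x 1 (fun x => t * x + c) t.
        by apply: is_derive_eq; rewrite /GRing.scale/=; ring.
      have := @is_derive1_comp _ sin (fun x => t * x + c) x _ _ _ hl.
      by move=> /(_ _ (is_derive_sin _)); rewrite mulrC.
    apply: is_derive_eq.
    by rewrite /GRing.scale/=; field.
  - move=> x; apply: cvgB; apply: cvgM; [exact: cvg_cst| |apply: cvgM => //|].
    + apply: cvgM; last exact: continuous_gaussf.
      apply: (@cvg_comp _ _ _ (fun x => t * x + c) cos); last exact: continuous_cos.
      by apply: cvgD; [apply: cvgM; [exact: cvg_cst|exact: cvg_id]|exact: cvg_cst].
    + apply: (@cvg_comp _ _ _ (fun x => t * x + c) sin); last exact: continuous_sin.
      by apply: cvgD; [apply: cvgM; [exact: cvg_cst|exact: cvg_id]|exact: cvg_cst].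
    + exact: continuous_gaussf.
  - rewrite /H -(mulr0 (s ^+ 2)); under eq_fun do rewrite -mulrA.
    by apply: cvgM; [exact: cvg_cst|exact: cvg_bounded_gaussf].
  - have := @cvg_bounded_gaussf (fun n => sin (t * (- n%:R) + c)).
    move=> /(_ (fun n => bounded_sin _ _)) h0.
    rewrite /H -(mulr0 (s ^+ 2)); under eq_fun do rewrite -mulrA /gaussf sqrrN.
    by apply: cvgM; [exact: cvg_cst|exact: h0].
rewrite RintegralB// RintegralZl//.
by move/eqP; rewrite subr_eq0 => /eqP <-.
Unshelve. all: end_near.
Qed.

Lemma is_derive_gaussf_fourier t : is_derive t 1 F (- (s ^+ 2 * t * F t)).
Proof.
pose f (t x : R) := cos (t * x + c) * gaussf x.
have df (u y : R) : is_derive u 1 (f^~ y) (- (y * sin (u * y + c) * gaussf y)).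
  have hs : is_derive u 1 (fun u => cos (u * y + c)) (- sin (u * y + c) * y).
    have hl : is_derive u 1 (fun u => u * y + c) y.
      by apply: is_derive_eq; rewrite /GRing.scale/=; ring.
    have := @is_derive1_comp _ cos (fun u => u * y + c) u _ _ _ hl.
    by move=> /(_ _ (is_derive_cos _)).
  rewrite /f; apply: is_derive_eq.
  rewrite /GRing.scale/=; ring.
have I : (`]t - 1, t + 1[%classic : set R) t.
  by rewrite /= in_itv/=; apply/andP; split; lra.
pose G := fun x => `|x * 1 * gaussf x|.
have A1 : forall x : R, `]t - 1, t + 1[%classic x -> mu.-integrable setT (EFin \o f x).
  by move=> x _; exact: (@bounded_gaussf _ 1).
have A2 : forall x y : R, `]t - 1, t + 1[%classic x -> setT y -> derivable (f^~ y) x 1.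
  by move=> x y _ _; case: (df x y).
have A3 : mu.-integrable setT (EFin \o G).
  apply: integrable_norm.
  apply: (@bounded_gaussfM (cst 1)) => // x; by rewrite normr1.
have A4 : forall x y : R, `]t - 1, t + 1[%classic x -> setT y ->
   `|partial1of2 f x y| <= G y.
  move=> x y _ _; rewrite partial1of2E.
  have [_ ->] := df x y; rewrite normrN /G !normrM normr1 mulr1.
  by rewrite ler_wpM2r// ler_piMr.
have A5 : forall y, 0 <= G y by move=> y; rewrite /G normr_ge0.
split; first exact: (derivable_under_integral measurableT I A1 A2 A5 A3 A4).
rewrite -derive1E (differentiation_under_integral measurableT I A1 A2 A5 A3 A4).
rewrite -gaussf_fourier_ibp.
transitivity (\int[mu]_x (-1 * (x * sin (t * x + c) * gaussf x))).
  by apply: eq_Rintegral => x _; rewrite partial1of2E; have [_ ->] := df t x; rewrite mulN1r.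
by rewrite RintegralZl ?mulN1r//; exact: bounded_gaussfM.
Qed.

(** The transform solves [F' = - s ^+ 2 * t * F], so its product with [expR ((s * t) ^+ 2 / 2)] is
    constant. The phase [c] lets one family of real cosines carry both parts of the characteristic
    function. *)
Lemma normal_fourier t :
  \int[mu]_x (cos (t * x + c) * normal_pdf 0 s x) =
  cos c * expR (- ((s * t) ^+ 2 / 2)).
Proof.
pose E (t : R) := expR ((s * t) ^+ 2 / 2).
have dE (u : R) : is_derive u 1 E (s ^+ 2 * u * E u).
  have h : is_derive u 1 (fun y : R => (s * y) ^+ 2 / 2) (s ^+ 2 * u).
    apply: is_derive_eq; rewrite /GRing.scale/=; by field.
  have := @is_derive1_comp _ expR (fun y : R => (s * y) ^+ 2 / 2) u _ _ _ h.
  by move=> /(_ _ (is_derive_expR _)) h'; apply: is_derive_eq h' _; exact: mulrC.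
have dFE (u : R) : is_derive u 1 (fun u => F u * E u) 0.
  have := is_derive_gaussf_fourier u => dF.
  apply: is_derive_eq; rewrite /GRing.scale/=; ring.
have cF : F t * E t = F 0 * E 0.
  exact: (is_derive_0_is_cst t 0 dFE).
have ig (u : R) : mu.-integrable setT (EFin \o (fun x => cos (u * x + c) * gaussf x)).
  exact: (@bounded_gaussf _ 1).
have Ft : \int[mu]_x (cos (t * x + c) * normal_pdf 0 s x) = normal_peak s * F t.
  rewrite /F -RintegralZl//.
  by apply: eq_Rintegral => x _; rewrite normal_pdf0E mulrCA.
have F0 : normal_peak s * F 0 = cos c.
  rewrite /F -RintegralZl//.
  transitivity (\int[mu]_x (cos c * normal_pdf 0 s x)).
    by apply: eq_Rintegral => x _; rewrite normal_pdf0E mul0r add0r mulrCA.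
  rewrite RintegralZl//; last exact: integrable_normal_pdf.
  by rewrite /Rintegral integral_normal_pdf mulr1.
rewrite Ft -F0 -(mulr1 (F 0)) -[X in _ * (F 0 * X)]expR0 -[X in expR X](_ : (s * 0) ^+ 2 / 2 = 0); last first.
  by rewrite mulr0 expr0n mul0r.
by rewrite -/(E 0) -cF /E -!mulrA -expRD subrr expR0 mulr1.
Qed.

End gaussian_fourier.

Section dominated_fubini.
Context d1 d2 (T1 : measurableType d1) (T2 : measurableType d2) (R : realType).
Variables (m1 : {finite_measure set T1 -> \bar R})
  (m2 : {sigma_finite_measure set T2 -> \bar R}).

(** The bound [C] gives integrability on the product. The bound [C'] makes the section at every [y],
    not just almost every one, integrable over the finite measure [m1], so that [fine] can be
    removed pointwise. *)
Lemma Rfubini (f : T1 * T2 -> R) (C : R) (C' : T2 -> R) :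
  measurable_fun setT f ->
  (forall x, \int[m2]_y `|f (x, y)|%:E <= C%:E)%E ->
  (forall x y, `|f (x, y)| <= C' y) ->
  \int[m1]_x \int[m2]_y f (x, y) = \int[m2]_y \int[m1]_x f (x, y).
Proof.
move=> mf fC fC'.
have mfx x : measurable_fun setT (fun y => f (x, y)) by exact: measurableT_comp.
have mfy y : measurable_fun setT (fun x => f (x, y)) by exact: measurableT_comp.
have ix x : m2.-integrable setT (EFin \o (fun y => f (x, y))).
  apply/integrableP; split; first exact/measurable_EFinP.
  by rewrite (le_lt_trans (fC x))// ltry.
have iy y : m1.-integrable setT (EFin \o (fun x => f (x, y))).
  apply: (le_integrable measurableT _ _ (finite_measure_integrable_cst m1 (C' y) measurableT)).
    exact/measurable_EFinP.
  by move=> x _ /=; rewrite lee_fin (le_trans (fC' x y))// ler_norm.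
have if_ : (m1 \x m2)%E.-integrable setT (EFin \o f).
  apply/integrable12ltyP; first exact/measurable_EFinP.
  apply: (@le_lt_trans _ _ (\int[m1]_x C%:E)%E).
    apply: ge0_le_integral => //=.
    - by move=> x _; apply: integral_ge0 => y _.
    - apply: (@measurable_fun_fubini_tonelli_F _ _ _ _ _ m2 (fun z => `|(f z)%:E|%E)) => //.
      by apply: measurableT_comp => //; exact/measurable_EFinP.
  by rewrite integral_cst// ltey_eq fin_numM// fin_num_measure.
have := Fubini if_.
move=> E; rewrite /Rintegral.
congr fine; transitivity (\int[m1]_x \int[m2]_y (f (x, y))%:E)%E.
  by apply: eq_integral => x _; rewrite fineK//; exact: (integrable_fin_num measurableT (ix x)).
rewrite [LHS]E; apply: eq_integral => y _.
by rewrite fineK//; exact: (integrable_fin_num measurableT (iy y)).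
Qed.

Lemma bounded_integrable (f : T1 -> R) (C : R) : measurable_fun setT f ->
  (forall x, `|f x| <= C) -> m1.-integrable setT (EFin \o f).
Proof.
move=> mf fC.
apply: (le_integrable measurableT _ _ (finite_measure_integrable_cst m1 C measurableT)).
  exact/measurable_EFinP.
by move=> x _ /=; rewrite lee_fin (le_trans (fC x))// ler_norm.
Qed.

End dominated_fubini.

Section normal_tail.
Context {R : realType}.

Lemma measurable_normal_pdf2 d (T : measurableType d) (f g : T -> R) (s : R) : s != 0 ->
  measurable_fun setT f -> measurable_fun setT g ->
  measurable_fun setT (fun x => normal_pdf (f x) s (g x)).
Proof.
move=> s0 mf mg; under eq_fun do rewrite (normal_pdfE _ s0).
apply: measurable_funM => //; rewrite /normal_fun.
apply: measurableT_comp => //=; apply: measurable_funM => //=.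
apply: measurableT_comp => //=; apply: measurable_funX => //=.
by apply: measurable_funB.
Qed.

(** On [V] one half of the exponent is at least [e ^+ 2 / (4 * s ^+ 2)]; the other half belongs to
    the normal density of deviation [Num.sqrt 2 * s], of total mass 1. The factor [Num.sqrt 2] is
    the ratio of the peaks. *)
Lemma normal_tail (x s e : R) (V : set R) : s != 0 -> 0 <= e -> measurable V ->
  (forall y, V y -> e <= `|y - x|) ->
  (normal_prob x s V <= (Num.sqrt 2 * expR (- (e ^+ 2 / (4 * s ^+ 2))))%:E)%E.
Proof.
move=> s0 e0 mV Ve; rewrite /normal_prob.
have s2 : 0 < s ^+ 2 by rewrite exprn_even_gt0.
pose s' := Num.sqrt 2 * s.
have sqrt2_gt0 : 0 < Num.sqrt 2 :> R by rewrite sqrtr_gt0.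
have s'0 : s' != 0 by rewrite mulf_neq0// gt_eqF.
have s'2 : s' ^+ 2 = 2 * s ^+ 2 by rewrite exprMn sqr_sqrtr.
pose K := Num.sqrt 2 * expR (- (e ^+ 2 / (4 * s ^+ 2))).
have K0 : 0 <= K by rewrite mulr_ge0 ?expR_ge0// ltW.
have H y : V y -> normal_pdf x s y <= K * normal_pdf x s' y.
  move=> Vy; rewrite !normal_pdfE//.
  have pk : normal_peak s = Num.sqrt 2 * normal_peak s'.
    rewrite /normal_peak s'2 (_ : 2 * s ^+ 2 * pi *+ 2 = 2 * (s ^+ 2 * pi *+ 2)); last by ring.
    by rewrite [in RHS]sqrtrM// invfM mulrA divff ?mul1r// gt_eqF.
  rewrite pk /K (_ : _ * expR _ * _ = (Num.sqrt 2 * normal_peak s') * (expR (- (e ^+ 2 / (4 * s ^+ 2))) * normal_fun x s' y)); last by ring.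
  rewrite ler_wpM2l ?mulr_ge0 ?normal_peak_ge0 ?(ltW sqrt2_gt0)//.
  rewrite /normal_fun s'2 -expRD ler_expR.
  have : e ^+ 2 <= (y - x) ^+ 2.
    by rewrite -[leRHS]real_normK ?num_real// lerXn2r ?nnegrE ?Ve.
  move=> h.
  have -> : - (y - x) ^+ 2 / (s ^+ 2 *+ 2) = - ((y - x) ^+ 2 / (4 * s ^+ 2)) + - (y - x) ^+ 2 / (2 * s ^+ 2 *+ 2).
    by field.
  rewrite lerD2r lerN2 ler_pM2r// invr_gt0 mulr_gt0//.
apply: (@le_trans _ _ (\int[lebesgue_measure]_(y in V) (K * normal_pdf x s' y)%:E)%E).
  apply: ge0_le_integral => //.
  - by move=> y _; rewrite lee_fin normal_pdf_ge0.
  - by apply: measurable_funTS; apply/measurable_EFinP; exact: measurable_normal_pdf.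
  - apply: measurable_funTS; apply/measurable_EFinP; apply: measurable_funM => //; exact: measurable_normal_pdf.
under eq_integral do rewrite EFinM.
rewrite ge0_integralZl//.
- rewrite -[leRHS]mule1 lee_wpmul2l ?lee_fin//.
  exact: (probability_le1 (normal_prob x s')).
- by apply: measurable_funTS; apply/measurable_EFinP; exact: measurable_normal_pdf.
- by move=> y _; rewrite lee_fin normal_pdf_ge0.
Qed.

End normal_tail.

(** * Fourier uniqueness for a real random variable with a bounded signed weight *)

Section fourier_uniqueness.
Context d (T : measurableType d) (R : realType) (P : probability T R).
Variables (Y W : T -> R) (M : R).
Hypotheses (mY : measurable_fun setT Y) (mW : measurable_fun setT W)
  (WM : forall w, `|W w| <= M)
  (YW0 : forall t c, \int[P]_w (W w * cos (t * Y w + c)) = 0).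

Let M0 : 0 <= M. Proof. exact: le_trans (WM point). Qed.

Let Rintegral0_eq d' (T' : measurableType d') (mu : {measure set T' -> \bar R}) (f : T' -> R) :
  (forall x, f x = 0) -> \int[mu]_x f x = 0.
Proof. by move=> f0; rewrite /Rintegral integral0_eq// => x _; rewrite f0. Qed.

Let mcos (f : T -> R) : measurable_fun setT f -> measurable_fun setT (fun w => cos (f w)).
Proof.
by move=> mf; apply: measurableT_comp => //; apply: continuous_measurable_fun; exact: continuous_cos.
Qed.

(** By [normal_fourier] the normal density is, up to its peak, a superposition of cosines with
    Gaussian weights; Fubini reduces the claim to [YW0]. *)
Let smooth_pdf s y : s != 0 -> \int[P]_w (W w * normal_pdf (Y w) s y) = 0.
Proof.
move=> s0.
have cos1 (x : R) : `|cos x| <= 1 by rewrite ler_norml cos_geN1 cos_le1.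
have pk0 : 0 <= normal_peak s by exact: normal_peak_ge0.
have one0 : (1 : R) != 0 by exact: oner_neq0.
pose f (z : T * R) := W z.1 * normal_peak s *
  (cos ((Y z.1 - y) / s * z.2 + 0) * normal_pdf 0 1 z.2).
have mpdf := @measurable_normal_pdf R 0 1.
have mf : measurable_fun setT f.
  apply: measurable_funM.
    by apply: measurable_funM => //; exact: (measurableT_comp mW measurable_fst).
  apply: measurable_funM; last exact: (measurableT_comp mpdf measurable_snd).
  apply: measurableT_comp; first by apply: continuous_measurable_fun; exact: continuous_cos.
  apply: measurable_funD => //; apply: measurable_funM; last exact: measurable_snd.
  apply: measurable_funM => //; apply: measurable_funB => //.
  exact: (measurableT_comp mY measurable_fst).
have fb w t : `|f (w, t)| <= M * normal_peak s * normal_pdf 0 1 t.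
  rewrite /f /= !normrM (ger0_norm (normal_pdf_ge0 _ _ _)) (ger0_norm pk0).
  apply: ler_pM => //; first by rewrite mulr_ge0// normr_ge0.
  - by rewrite mulr_ge0 ?normal_pdf_ge0.
  - by rewrite ler_wpM2r.
  - by rewrite ler_piMl ?normal_pdf_ge0.
have ipdf (K : R) : lebesgue_measure.-integrable setT (EFin \o (fun t => K * normal_pdf 0 1 t)).
  rewrite (_ : _ \o _ = (fun x => K%:E * (normal_pdf 0 1 x)%:E)%E); last by apply/funext => x /=; rewrite EFinM.
  by apply: integrableZl => //; exact: integrable_normal_pdf.
have ic (t : R) : lebesgue_measure.-integrable setT (EFin \o (fun x => cos (t * x + 0) * normal_pdf 0 1 x)).
  apply: (le_integrable measurableT _ _ (ipdf 1)).
    apply/measurable_EFinP; apply: measurable_funM => //.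
    apply: measurableT_comp; first by apply: continuous_measurable_fun; exact: continuous_cos.
    by apply: measurable_funD => //; apply: measurable_funM.
  move=> x _ /=; rewrite lee_fin !normrM normr1 ler_wpM2r// cos1.
have k w : W w * normal_pdf (Y w) s y = \int[lebesgue_measure]_t f (w, t).
  rewrite /f /= RintegralZl// normal_fourier// cos0 !mul1r -mulrA; congr (_ * _).
  rewrite normal_pdfE//; congr (_ * _); rewrite /normal_fun; congr expR.
  by field.
under eq_Rintegral do rewrite k.
rewrite (@Rfubini _ _ _ _ _ P lebesgue_measure f (M * normal_peak s) (fun t => M * normal_peak s * normal_pdf 0 1 t))//.
- apply: Rintegral0_eq => t.
  transitivity (\int[P]_w (normal_peak s * normal_pdf 0 1 t * (W w * cos (t / s * Y w + (- (y * t / s)))))).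
    apply: eq_Rintegral => w _; rewrite /f /=.
    have -> : (Y w - y) / s * t + 0 = t / s * Y w - y * t / s by field.
    by ring.
  rewrite RintegralZl// ?YW0 ?mulr0//.
  apply: (@bounded_integrable _ _ _ P _ M).
    by apply: measurable_funM => //; apply: mcos; apply: measurable_funD => //; exact: measurable_funM.
  by move=> w; rewrite normrM -[leRHS]mulr1 ler_pM.
- move=> w.
  apply: (@le_trans _ _ (\int[lebesgue_measure]_t ((M * normal_peak s)%:E * (normal_pdf 0 1 t)%:E))%E).
    apply: ge0_le_integral => //.
    - apply/measurable_EFinP; apply: measurableT_comp => //; exact: measurableT_comp.
    - by apply/measurable_EFinP; apply: measurable_funM.
    - by move=> t _; rewrite lee_fin.
  rewrite integralZl//; last exact: integrable_normal_pdf.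
  by rewrite integral_normal_pdf mule1.
Qed.

Let smooth_prob s (V : set R) : s != 0 -> measurable V ->
  \int[P]_w (W w * fine (normal_prob (Y w) s V)) = 0.
Proof.
move=> s0 mV.
pose f (z : T * R) := W z.1 * (normal_pdf (Y z.1) s z.2 * \1_V z.2).
have ind1 (A : set R) (x : R) : 0 <= (\1_A x : R) <= 1.
  by rewrite indicE; case: (_ \in _); rewrite ?lexx ?ler01.
have mf : measurable_fun setT f.
  apply: measurable_funM; first exact: (measurableT_comp mW measurable_fst).
  apply: measurable_funM; last exact: (measurableT_comp (measurable_indic _) measurable_snd).
  apply: measurable_normal_pdf2 => //; exact: (measurableT_comp mY measurable_fst).
have mpdf x : measurable_fun setT (normal_pdf x s) by exact: measurable_normal_pdf.
have mi : measurable_fun [set: measurableTypeR R] (\1_V : R -> R).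
  exact: measurable_indic.
have ip w : lebesgue_measure.-integrable setT (EFin \o (fun y => normal_pdf (Y w) s y * \1_V y)).
  apply: (le_integrable measurableT _ _ (integrable_normal_pdf (Y w) s)).
    by apply/measurable_EFinP; exact: measurable_funM (mpdf _) mi.
  move=> x _ /=; rewrite lee_fin normrM ler_piMr// ger0_norm; by have /andP[] := ind1 V x.
have fE w : W w * fine (normal_prob (Y w) s V) = \int[lebesgue_measure]_y f (w, y).
  rewrite /f /= RintegralZl//; congr (_ * _).
  by rewrite -[LHS]/(Rintegral _ _ _) Rintegral_mkcond patch_indic.
under eq_Rintegral do rewrite fE.
rewrite (@Rfubini _ _ _ _ _ P lebesgue_measure f M (fun=> M * normal_peak s))//.
- apply: Rintegral0_eq => y.
  transitivity (\int[P]_w (\1_V y * (W w * normal_pdf (Y w) s y))).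
    by apply: eq_Rintegral => w _; rewrite /f /=; ring.
  rewrite RintegralZl// ?smooth_pdf ?mulr0//.
  apply: (@bounded_integrable _ _ _ P _ (M * normal_peak s)).
    apply: measurable_funM => //; exact: measurable_normal_pdf2.
  by move=> w; rewrite normrM ler_pM// ger0_norm ?normal_pdf_ge0// normal_pdf_ub.
- move=> w.
  apply: (@le_trans _ _ (\int[lebesgue_measure]_t (M%:E * (normal_pdf (Y w) s t)%:E))%E).
    apply: ge0_le_integral => //.
    - apply/measurable_EFinP; apply: measurableT_comp => //; exact: measurableT_comp.
    - by apply/measurable_EFinP; apply: measurable_funM => //; exact: mpdf.
    - move=> t _; rewrite lee_fin /f /= normrM ler_pM// normrM.
      rewrite (ger0_norm (normal_pdf_ge0 _ _ _)) ler_piMr ?normal_pdf_ge0// ger0_norm; by have /andP[] := ind1 V t.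
  rewrite integralZl//; last exact: integrable_normal_pdf.
  by rewrite integral_normal_pdf mule1.
- move=> w y; rewrite /f /= normrM ler_pM// normrM.
  rewrite (ger0_norm (normal_pdf_ge0 _ _ _)) -[leRHS]mulr1 ler_pM ?normal_pdf_ge0 ?normal_pdf_ub//.
  by rewrite ger0_norm; have /andP[] := ind1 V y.
Qed.

Let measurable_smooth s (V : set R) : s != 0 -> measurable V ->
  measurable_fun setT (fun w => fine (normal_prob (Y w) s V)).
Proof.
move=> s0 mV; apply: (@measurableT_comp _ _ _ _ _ _ fine); first exact: fine_measurable.
pose f (z : T * measurableTypeR R) := (normal_pdf (Y z.1) s z.2 * \1_V z.2)%:E.
have mf : measurable_fun setT f.
  apply/measurable_EFinP; apply: measurable_funM.
    apply: measurable_normal_pdf2 => //; exact: (measurableT_comp mY measurable_fst).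
  by apply: measurableT_comp => //; exact: measurable_indic.
have f0 z : (0 <= f z)%E.
  by rewrite lee_fin mulr_ge0 ?normal_pdf_ge0// indicE; case: (_ \in _).
have := @measurable_fun_fubini_tonelli_F _ _ _ _ R (@lebesgue_measure R) f mf f0.
rewrite (_ : fubini_F _ _ = (fun w => normal_prob (Y w) s V))//.
apply/funext => w; rewrite /fubini_F /normal_prob [in RHS]integral_mkcond.
apply: eq_integral => y _; rewrite /f /= /patch indicE.
by case: (y \in V); rewrite ?mulr1 ?mulr0.
Qed.

(** The indicator of the ray is a bounded pointwise limit of Gaussian smoothings, whose integrals
    against [W] vanish by [smooth_prob]. *)
Lemma fourier_uniq_ray a : \int[P]_w (W w * \1_(`]a, +oo[) (Y w)) = 0.
Proof.
(* The endpoint is shifted by [1 / n.+1], which is [n.+1] times the deviation [s n]. Hence the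
   smoothed mass tends to 0 at [a] itself and to its left, and to 1 strictly to its right. *)
pose s n : R := (n.+1%:R ^- 2).
pose V n : set R := `]a + n.+1%:R^-1, +oo[%classic.
have n0 n : 0 < n.+1%:R :> R by rewrite ltr0n.
have s0 n : s n != 0 by rewrite invr_neq0// expf_neq0// gt_eqF.
have mV n : measurable (V n) by exact: measurable_itv.
have sn2 n : s n ^+ 2 = n.+1%:R ^- 4 by rewrite exprVn -exprM.
pose g n w := W w * fine (normal_prob (Y w) (s n) (V n)).
have pf n x A : measurable A -> normal_prob x (s n) A \is a fin_num.
  by move=> mA; exact: fin_num_measure.
have tail0 : Num.sqrt 2 * expR (- (n.+1%:R / 4)) @[n --> \oo] --> (0 : R).
  have h : Num.sqrt 2 * 4 * n.+1%:R^-1 @[n --> \oo] --> (Num.sqrt 2 * 4 * 0 : R).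
    by apply: cvgM; [exact: cvg_cst|exact: cvg_harmonic].
  rewrite mulr0 in h; apply: (squeeze_cvgr _ (cvg_cst 0) h).
  near=> n; rewrite mulr_ge0 ?sqrtr_ge0 ?expR_ge0//= -mulrA ler_wpM2l ?sqrtr_ge0//.
  rewrite expRN [4 / _](_ : _ = (n.+1%:R / 4)^-1); last by rewrite invf_div.
  rewrite lef_pV2 ?posrE ?expR_gt0 ?divr_gt0//.
  by apply: le_trans (expR_ge1Dx _); rewrite lerDr.
have tail n (x : R) (A : set (measurableTypeR R)) : measurable A -> (forall y, A y -> n.+1%:R^-1 <= `|y - x|) ->
    0 <= fine (normal_prob x (s n) A) <= Num.sqrt 2 * expR (- (n.+1%:R / 4)).
  move=> mA Ay; rewrite fine_ge0//=.
  rewrite -lee_fin fineK ?pf//.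
  apply: le_trans (normal_tail (s0 n) _ mA Ay) _; first by rewrite invr_ge0 ltW.
  rewrite lee_fin ler_wpM2l// ?sqrtr_ge0// ler_expR lerN2 sn2.
  have -> : n.+1%:R^-1 ^+ 2 / (4 * n.+1%:R ^- 4) = n.+1%:R ^+ 2 / 4 :> R.
    by field; rewrite gt_eqF.
  by rewrite ler_pM2r// expr2 ler_peMl ?ler1n// ltW.
have limP x : fine (normal_prob x (s n) (V n)) @[n --> \oo] --> (\1_(`]a, +oo[) x : R).
  have [xa|ax] := leP x a.
    rewrite indicE memNset; last by rewrite /= in_itv/= andbT; apply/negP; rewrite -leNgt.
    apply: (squeeze_cvgr _ (cvg_cst 0) tail0).
    near=> n; apply: tail; first exact: mV.
    move=> y; rewrite /V/= in_itv/= andbT => ay.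
    rewrite ler_normr; apply/orP; left; rewrite lerBrDl ltW// (le_lt_trans _ ay)//.
    by rewrite lerD2r.
  have -> : \1_(`]a, +oo[) x = 1 :> R by rewrite indicE mem_set//= in_itv/= andbT.
  have tail1 : 1 - Num.sqrt 2 * expR (- (n.+1%:R / 4)) @[n --> \oo] --> (1 : R).
    by rewrite -[X in _ --> X]subr0; apply: cvgB => //; exact: cvg_cst.
  apply: (squeeze_cvgr _ tail1 (cvg_cst (1 : R))).
  near=> n.
  have -> : fine (normal_prob x (s n) (V n)) = 1 - fine (normal_prob x (s n) (~` V n)).
    have := probability_setC (normal_prob x (s n)) (mV n).
    move=> ->.
    by rewrite (fineB _ (pf n x _ (mV n)))//= opprB addrCA subrr addr0.
  have : 0 <= fine (normal_prob x (s n) (~` V n)) <= Num.sqrt 2 * expR (- (n.+1%:R / 4)).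
    apply: (tail n x (~` V n) (measurableC (mV n))).
    move=> y; rewrite /V/= in_itv/= andbT => /negP; rewrite -leNgt => ya.
    rewrite distrC ler_normr; apply/orP; left; rewrite lerBrDl.
    apply: (@le_trans _ _ (a + n.+1%:R^-1 + n.+1%:R^-1)); first by rewrite lerD2r.
    have : n.+1%:R^-1 + n.+1%:R^-1 <= x - a.
      near: n; exists (Num.bound (2 / (x - a))) => // n /= nb.
      rewrite (_ : _ + _ = 2 / n.+1%:R); last by field; rewrite gt_eqF.
      rewrite ler_pdivrMr// mulrC -ler_pdivrMr ?subr_gt0//.
      apply: (@le_trans _ _ (Num.bound (2 / (x - a)))%:R).
        by apply/ltW/archi_boundP; rewrite divr_ge0// subr_ge0 ltW.
      by rewrite ler_nat (leq_trans nb).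
    by rewrite lerBrDl addrA.
  by move=> /andP[h1 h2]; rewrite lerD2l lerN2 h2 gerBl h1.
have mg n : measurable_fun setT (g n).
  by apply: measurable_funM => //; exact: measurable_smooth.
have gM n w : `|g n w| <= M.
  rewrite /g normrM -[leRHS]mulr1 ler_pM//.
  rewrite ger0_norm ?fine_ge0// -lee_fin fineK ?(pf _ _ _ (mV n))//.
  exact: (probability_le1 (normal_prob (Y w) (s n)) (mV n)).
have [] := @dominated_convergence _ _ _ P setT measurableT
   (fun n => EFin \o g n) (EFin \o (fun w => W w * \1_(`]a, +oo[) (Y w))) (EFin \o cst M).
- by move=> n; apply/measurable_EFinP; exact: mg.
- apply/measurable_EFinP/measurable_funM => //.
  by apply: measurableT_comp => //; exact: measurable_indic.
- apply/aeW => w _; apply: cvg_EFin; first by near=> n.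
  by apply: cvgM; [exact: cvg_cst|exact: limP].
- exact: finite_measure_integrable_cst.
- by apply/aeW => w n _; rewrite /= lee_fin gM.
move=> iW _ /=.
have g0 n : (\int[P]_w (g n w)%:E = 0)%E.
  rewrite -[RHS]/(0%:E) -(smooth_prob (s0 n) (mV n)) /Rintegral fineK//.
  apply: integrable_fin_num => //.
  exact: (@bounded_integrable _ _ _ P (g n) M (mg n) (gM n)).
under eq_fun do rewrite g0.
move=> /(cvg_unique _ (cvg_cst _)) => e.
by rewrite /Rintegral -[X in fine X]e.
Unshelve. all: end_near.
Qed.

(** [W] is signed; adding its bound [M] produces a genuine measure, to which uniqueness of measures
    applies. *)
Definition pos_meas (B : set (R)) : \bar R :=
  (\int[P]_(w in Y @^-1` B) (W w + M)%:E)%E.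

Let WM0 w : 0 <= W w + M.
Proof. by have := WM w; rewrite ler_norml => /andP[? _]; rewrite -lerBlDr sub0r. Qed.

Let mYpre (B : set (R)) : measurable B -> measurable (Y @^-1` B).
Proof. by move=> mB; rewrite -[X in measurable X]setTI; exact: mY. Qed.

Let pos_meas0 : pos_meas set0 = 0%E.
Proof. by rewrite /pos_meas preimage_set0 integral_set0. Qed.

Let pos_meas_ge0 B : (0 <= pos_meas B)%E.
Proof. by apply: integral_ge0 => w _; rewrite lee_fin. Qed.

Let pos_meas_sigma_additive : semi_sigma_additive pos_meas.
Proof.
move=> F mF tF mUF; rewrite /pos_meas preimage_bigcup.
rewrite ge0_integral_bigcup//.
- apply: is_cvg_ereal_nneg_natsum_cond => n _ _; exact: pos_meas_ge0.
- by move=> k; exact: mYpre.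
- apply: measurable_funTS; apply/measurable_EFinP; exact: measurable_funD.
- by move=> w _; rewrite lee_fin.
- apply/trivIsetP => i j _ _ ij; rewrite -preimage_setI.
  by move/trivIsetP : tF => /(_ _ _ _ _ ij) ->//; rewrite preimage_set0.
Qed.

HB.instance Definition _ := isMeasure.Build _ _ _ pos_meas
  pos_meas0 pos_meas_ge0 pos_meas_sigma_additive.

HB.instance Definition _ := isMeasurableFun.Build _ _ T R Y mY.

(** The claim amounts to [pos_meas] being [M] times the law of [Y]; the two agree on open rays,
    which are stable under intersection and generate. In probabilistic terms, [W] has conditional
    mean 0 given [Y]. *)
Lemma fourier_uniq (B : set (R)) : measurable B -> \int[P]_w (W w * \1_B (Y w)) = 0.
Proof.
move=> mB.
have iW : P.-integrable setT (EFin \o W) by exact: (@bounded_integrable _ _ _ P _ M).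
have eqi (A : set (R)) : \int[P]_w (W w * \1_A (Y w)) = \int[P]_(w in Y @^-1` A) W w.
  rewrite [RHS]Rintegral_mkcond; apply: eq_Rintegral => w _.
  rewrite /patch indicE (_ : (w \in Y @^-1` A) = (Y w \in A)).
    by case: (_ \in _); rewrite ?mulr1 ?mulr0.
  by apply/idP/idP; rewrite !inE.
have dec (A : set (R)) : measurable A ->
    (pos_meas A = (\int[P]_w (W w * \1_A (Y w))%R)%:E + M%:E * P (Y @^-1` A))%E.
  move=> mA; have mYA := mYpre mA; rewrite /pos_meas; under eq_integral do rewrite EFinD.
  have iWA : P.-integrable (Y @^-1` A) (EFin \o W) by exact: integrableS iW.
  rewrite integralD//; last exact: finite_measure_integrable_cst.
  rewrite integral_cst// eqi /Rintegral fineK//; exact: integrable_fin_num.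
pose mu2 : {measure set (R) -> \bar R} := mscale (NngNum M0) (distribution P Y).
pose mu1 : {measure set (R) -> \bar R} := pos_meas.
suff : (mu1 B = mu2 B)%E.
  rewrite -[mu1 B]/(pos_meas B) dec// -[mu2 B]/(M%:E * P (Y @^-1` B))%E => /(congr1 fine).
  have fM : (M%:E * P (Y @^-1` B))%E \is a fin_num by rewrite fin_numM// fin_num_measure//; exact: mYpre.
  rewrite fineD//= => h; apply: (addIr (fine (M%:E * P (Y @^-1` B))%E)).
  by rewrite add0r.
have := @measure_unique _ R (R) (@RGenOInfty.G R) (fun k => `](- k%:R), +oo[%classic) (RGenOInfty.measurableE R).
move=> /(_ _ _ _ mu1 mu2 _ _ B mB); apply => //.
- move=> A1 A2 [a1 ->] [a2 ->]; exists (Num.max a1 a2).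
  by apply/seteqP; split => x /=; rewrite !in_itv/= !andbT ?gt_max => /andP.
- by move=> k; exists (- k%:R).
- rewrite -subTset => x _; exists (Num.bound `|x|) => //=; rewrite in_itv/= andbT.
  rewrite ltrNl (le_lt_trans (ler_norm _))// normrN.
  by apply: archi_boundP.
- move=> A [a ->]; have mA : measurable (`]a, +oo[%classic : set (R)) by exact: measurable_itv.
  by rewrite -[mu1 _]/(pos_meas _) dec// fourier_uniq_ray add0e.
- move=> k; rewrite -[mu1 _]/(pos_meas _) dec ?fourier_uniq_ray ?add0e; last exact: measurable_itv.
  rewrite ltey_eq fin_numM// fin_num_measure//; apply: mYpre; exact: measurable_itv.
Qed.

End fourier_uniqueness.

(** * Integrals against the normal law, and its moments *)

Section normal_transfer.
Context {R : realType}.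
Notation mu := (@lebesgue_measure R).

Lemma ge0_integral_normal_prob (m s : R) (f : R -> \bar R) :
  measurable_fun setT f -> (forall x, 0 <= f x)%E ->
  (\int[normal_prob m s]_x f x = \int[mu]_x (f x * (normal_pdf m s x)%:E))%E.
Proof.
move=> mf f0.
have dom := normal_prob_dominates m s.
rewrite -(Radon_Nikodym_SigmaFinite.change_of_variables dom)//.
apply: ae_eq_integral => //.
- apply: emeasurable_funM => //; apply: (measurable_int mu).
  exact: Radon_Nikodym_SigmaFinite.f_integrable.
- apply: emeasurable_funM => //; apply/measurable_EFinP; exact: measurable_normal_pdf.
- apply: ae_eqe_mul2l => /=.
  apply: integral_ae_eq => //=.
  + exact: Radon_Nikodym_SigmaFinite.f_integrable.
  + apply/measurable_EFinP; exact: measurable_normal_pdf.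
  + by move=> E _ mE; rewrite -Radon_Nikodym_SigmaFinite.f_integral.
Qed.

Lemma normal_pdf_shift (m s x : R) : s != 0 -> normal_pdf m s (x + m) = normal_pdf 0 s x.
Proof. by move=> s0; rewrite !normal_pdfE// /normal_fun subr0 addrK. Qed.

Lemma ge0_integral_normal_shift (m s : R) (f : R -> R) : s != 0 ->
  continuous f -> (forall x, 0 <= f x) ->
  (\int[mu]_x ((f x)%:E * (normal_pdf m s x)%:E) =
   \int[mu]_x ((f (x + m))%:E * (normal_pdf 0 s x)%:E))%E.
Proof.
move=> s0 cf f0.
have dF : forall x : R, is_derive x 1 (fun x : R => x + m) 1.
  by move=> x; apply: is_derive_eq; rewrite addr0.
have dE : ((fun x : R => x + m)^`() = cst 1)%classic.
  by apply/funext => x; rewrite derive1E; case: (dF x).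
under eq_integral do rewrite -EFinM.
rewrite (@increasing_ge0_integration_by_substitutionT _ (fun x : R => x + m)).
- by apply: eq_integral => x _; rewrite -(normal_pdf_shift m x s0) -EFinM !fctE dE /= mulr1.
- by move=> x y; rewrite ltrD2r.
- by rewrite dE => x; exact: cvg_cst.
- by rewrite dE; exact: is_cvg_cst.
- by rewrite dE; exact: is_cvg_cst.
- by move=> x; case: (dF x).
- exact: cvg_addrr_Ny.
- exact: cvg_addrr.
- by move=> x; apply: cvgM; [exact: cf|exact: continuous_normal_pdf].
- by move=> x; rewrite mulr_ge0// normal_pdf_ge0.
Qed.


Section moments.
Variable s : R.
Hypothesis s0 : s != 0.

Let s2_gt0 : 0 < s ^+ 2. Proof. by rewrite exprn_even_gt0. Qed.

Let g x := normal_pdf 0 s x.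

Let gE x : g x = normal_peak s * expR (- (x ^+ 2 / (2 * s ^+ 2))).
Proof. by rewrite /g normal_pdfE// /normal_fun subr0 mulNr mulr_natl. Qed.

Let g_ge0 x : 0 <= g x. Proof. exact: normal_pdf_ge0. Qed.

Let is_derive_g (x : R) : is_derive x 1 g (- (x / s ^+ 2) * g x).
Proof.
have h := is_derive_gaussf s0 x.
rewrite (_ : g = (fun x => normal_peak s * expR (- (x ^+ 2 / (2 * s ^+ 2))))); last exact/funext.
by apply: is_derive_eq; rewrite /GRing.scale/=; ring.
Qed.

Let s' := 2 * s.

Let s'0 : s' != 0. Proof. by rewrite mulf_neq0. Qed.

Let g' x := normal_pdf 0 s' x.

Let s'2 : s' ^+ 2 = 4 * s ^+ 2.
Proof. by rewrite /s'; ring. Qed.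

Let peak' : normal_peak s = 2 * normal_peak s'.
Proof.
rewrite /normal_peak s'2 (_ : 4 * s ^+ 2 * pi *+ 2 = 2 ^+ 2 * (s ^+ 2 * pi *+ 2)); last by ring.
by rewrite [in RHS]sqrtrM ?sqr_ge0// sqrtr_sqr ger0_norm// invfM mulrA divff ?mul1r.
Qed.

Let g'E x : g' x = normal_peak s' * expR (- (x ^+ 2 / (8 * s ^+ 2))).
Proof.
rewrite /g' normal_pdfE// /normal_fun subr0 mulNr s'2; congr (_ * expR (- (_ / _))); ring.
Qed.

(** Put [v = x ^+ 2 / (8 * s ^+ 2)]. Doubling the deviation leaves a factor [expR (- (3 * v))] to
    absorb [x ^+ 2 = 8 * s ^+ 2 * v]. *)
Let x2g x : x ^+ 2 * g x <= 8 * s ^+ 2 * g' x.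
Proof.
rewrite gE g'E peak'.
have -> : x ^+ 2 / (2 * s ^+ 2) = x ^+ 2 / (8 * s ^+ 2) + 3 * (x ^+ 2 / (8 * s ^+ 2)) by field.
rewrite opprD expRD.
set v := x ^+ 2 / (8 * s ^+ 2).
have v0 : 0 <= v by rewrite divr_ge0 ?sqr_ge0// mulr_ge0// ltW.
have xv : x ^+ 2 = 8 * s ^+ 2 * v by rewrite /v; field.
rewrite xv.
have h : 2 * v * expR (- (3 * v)) <= 1.
  rewrite expRN ler_pdivrMr ?expR_gt0// mul1r (le_trans _ (expR_ge1Dx _))//; lra.
have -> : 8 * s ^+ 2 * v * (2 * normal_peak s' * (expR (- v) * expR (- (3 * v)))) =
  8 * s ^+ 2 * (normal_peak s' * expR (- v)) * (2 * v * expR (- (3 * v))) by ring.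
rewrite -mulrA ler_pM2l ?(mulr_gt0 _ s2_gt0)//.
by rewrite ler_piMr// mulr_ge0 ?normal_peak_ge0 ?expR_ge0.
Qed.

Let mg : measurable_fun setT g. Proof. exact: measurable_normal_pdf. Qed.

Let integrableMl (h : R -> R) (a : R) : mu.-integrable setT (EFin \o h) ->
  mu.-integrable setT (EFin \o (fun x => a * h x)).
Proof.
move=> fi; have := @integrableZl _ _ _ mu setT measurableT a _ fi.
by apply: eq_integrable => // w _ /=; rewrite EFinM.
Qed.

Lemma integrable_x2_normal : mu.-integrable setT (EFin \o (fun x => x ^+ 2 * normal_pdf 0 s x)).
Proof.
apply: (le_integrable measurableT _ _ (integrableMl (8 * s ^+ 2) (integrable_normal_pdf 0 s'))).
  by apply/measurable_EFinP; apply: measurable_funM => //; exact: measurable_funX.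
move=> x _; rewrite /= lee_fin ger0_norm; last exact: mulr_ge0 (sqr_ge0 x) (g_ge0 x).
exact: le_trans (x2g x) (ler_norm _).
Qed.

Let x1g x : `|x * g x| <= (1 + x ^+ 2) * g x.
Proof.
rewrite normrM (ger0_norm (g_ge0 x)) ler_wpM2r//.
rewrite -(real_normK (num_real x)); have := sqr_ge0 (`|x| - 2^-1); lra.
Qed.

Lemma integrable_x1_normal : mu.-integrable setT (EFin \o (fun x => x * normal_pdf 0 s x)).
Proof.
apply: (le_integrable measurableT _ _ (integrableD measurableT (integrable_normal_pdf 0 s) integrable_x2_normal)).
  by apply/measurable_EFinP; apply: measurable_funM.
move=> x _ /=; rewrite lee_fin (le_trans (x1g x))// mulrDl mul1r ler_norm//.
Qed.

Let gg' (x : R) : g x <= 2 * g' x.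
Proof.
rewrite gE g'E peak' -mulrA ler_pM2l// ler_wpM2l ?normal_peak_ge0// ler_expR lerN2.
apply: (ler_wpM2l (sqr_ge0 x)); rewrite lef_pV2 ?posrE ?(mulr_gt0 _ s2_gt0)// ler_pM2r// ler_nat//.

Qed.

Let bound_cvg (f : R^nat) (C : R) : (forall n, `|f n| <= C * g' n%:R) -> f n @[n --> \oo] --> 0.
Proof.
move=> fC.
have h : C * g' n%:R @[n --> \oo] --> (C * (normal_peak s' * 0) : R).
  apply: cvgM; first exact: cvg_cst.
  have e n : g' n%:R = normal_peak s' * (cst 1 n * expR (- (n%:R ^+ 2 / (2 * s' ^+ 2)))).
    by rewrite /g' normal_pdfE// /normal_fun subr0 mulNr mul1r mulr_natl.
  under eq_fun do rewrite e.
  apply: cvgM; first exact: cvg_cst.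
  by apply: (@cvg_bounded_gaussf R s' s'0 (cst 1)) => n; rewrite normr1.
rewrite mulr0 mulr0 in h.
have hN : - (C * g' n%:R) @[n --> \oo] --> (0 : R) by rewrite -oppr0; exact: cvgN.
apply: (squeeze_cvgr _ hN h).
by near=> n; rewrite -ler_norml.
Unshelve. all: end_near.
Qed.

Let gN (x : R) : g (- x) = g x. Proof. by rewrite !gE sqrrN. Qed.
Lemma normal_first_moment : \int[mu]_x (x * normal_pdf 0 s x) = 0.
Proof.
have b (x : R) : `|- s ^+ 2 * g x| <= 2 * s ^+ 2 * g' x.
  rewrite mulNr normrN normrM !ger0_norm ?sqr_ge0//.
  by rewrite (_ : 2 * s ^+ 2 * g' x = s ^+ 2 * (2 * g' x)) ?ler_pM2l ?gg'//; ring.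
apply: (@Rintegral_derive_vanish R (fun x => - s ^+ 2 * g x) (fun x => x * g x)).
- by move=> x; have := is_derive_g x => dg; apply: is_derive_eq; rewrite /GRing.scale/=; field.
- by move=> x; apply: cvgM; [exact: cvg_id|exact: continuous_normal_pdf].
- exact: integrable_x1_normal.
- by apply: bound_cvg => n; exact: b.
- by apply: bound_cvg => n; rewrite gN; exact: b.
Qed.

(** [s ^+ 2 * g x - x ^+ 2 * g x] is the derivative of [s ^+ 2 * (x * g x)], so its integral is
    0. *)
Lemma normal_second_moment : \int[mu]_x (x ^+ 2 * normal_pdf 0 s x) = s ^+ 2.
Proof.
have i1 := integrableMl (s ^+ 2) (integrable_normal_pdf 0 s).
have b (x : R) : `|s ^+ 2 * (x * g x)| <= s ^+ 2 * (2 + 8 * s ^+ 2) * g' x.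
  rewrite normrM ger0_norm ?sqr_ge0// -mulrA ler_pM2l// (le_trans (x1g x))//.
  by rewrite (mulrDl 1) mul1r (mulrDl 2); exact: lerD (gg' x) (x2g x).
have : \int[mu]_x (s ^+ 2 * g x - x ^+ 2 * g x) = 0.
  apply: (@Rintegral_derive_vanish R (fun x => s ^+ 2 * (x * g x)) (fun x => s ^+ 2 * g x - x ^+ 2 * g x)).
  - by move=> x; have := is_derive_g x => dg; apply: is_derive_eq; rewrite /GRing.scale/=; field.
  - move=> x; apply: cvgB; (apply: cvgM; last exact: continuous_normal_pdf); first exact: cvg_cst.
    exact: exprn_continuous.
  - have := integrableB measurableT i1 integrable_x2_normal.
    by apply: eq_integrable => // x _ /=; rewrite EFinB.
  - by apply: bound_cvg => n; exact: b.
  - apply: bound_cvg => n; rewrite gN mulNr mulrN normrN; exact: b.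
rewrite RintegralB//; last exact: integrable_x2_normal.
rewrite RintegralZl//; last exact: integrable_normal_pdf.
rewrite /Rintegral integral_normal_pdf mulr1 => /eqP.
by rewrite subr_eq0 eq_sym => /eqP.
Qed.

Lemma normal_centered_second_moment m c :
  (\int[mu]_x (((x - c) ^+ 2)%:E * (normal_pdf m s x)%:E) = (s ^+ 2 + (m - c) ^+ 2)%:E)%E.
Proof.
rewrite (@ge0_integral_normal_shift _ _ (fun x => (x - c) ^+ 2))//; last 2 first.
- move=> x; apply: (@continuous_comp _ _ _ (fun x => x - c) (fun x => x ^+ 2)); last exact: exprn_continuous.
  by apply: cvgB; [exact: cvg_id|exact: cvg_cst].
- by move=> x; rewrite sqr_ge0.
have i2 := integrable_x2_normal.
have i1 := integrableMl (2 * (m - c)) integrable_x1_normal.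
have i0 := integrableMl ((m - c) ^+ 2) (integrable_normal_pdf 0 s).
have i21 : mu.-integrable setT (EFin \o (fun x => x ^+ 2 * g x + 2 * (m - c) * (x * g x))).
  by have := integrableD measurableT i2 i1; apply: eq_integrable => // x _ /=; rewrite EFinD.
transitivity (\int[mu]_x ((x ^+ 2 * g x + 2 * (m - c) * (x * g x)) + (m - c) ^+ 2 * g x))%:E.
  rewrite /Rintegral fineK; last first.
    apply: integrable_fin_num => //.
    by have := integrableD measurableT i21 i0; apply: eq_integrable => // x _ /=; rewrite EFinD.
  by apply: eq_integral => x _; rewrite -EFinM; congr EFin; rewrite /g; ring.
rewrite RintegralD// RintegralD// (RintegralZl _ measurableT integrable_x1_normal).
rewrite (RintegralZl _ measurableT (integrable_normal_pdf 0 s)) normal_first_moment normal_second_moment.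
by rewrite /Rintegral integral_normal_pdf mulr0 mulr1 addr0.
Qed.

End moments.

End normal_transfer.

(** * Gaussian families *)

Section independence.
Context d (T : measurableType d) (R : realType) (P : probability T R) (n : nat).
Variables (Y : 'I_n -> T -> R) (sig : 'I_n -> R) (B : 'I_n -> set R).
Hypotheses (mY : forall k, measurable_fun setT (Y k))
  (Ycos : forall (u : 'I_n -> R) th,
     \int[P]_w cos (\sum_k u k * Y k w + th) =
     cos th * expR (- (\sum_k (sig k * u k) ^+ 2 / 2)))
  (Ylaw : forall k A, measurable A -> P (Y k @^-1` A) = normal_prob 0 (sig k) A)
  (mB : forall k, measurable (B k)).

Let p k := fine (normal_prob 0 (sig k) (B k)).

Let ind (m : nat) (w : T) : R := \prod_(k < n | (k < m)%N) \1_(B k) (Y k w).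

Let ind_itv m w : 0 <= ind m w <= 1.
Proof.
rewrite /ind; elim/big_ind : _ => [|x y /andP[x0 x1] /andP[y0 y1]|k _].
- by rewrite ler01 lexx.
- by rewrite mulr_ge0//= mulr_ile1.
- by rewrite indicE; case: (_ \in _); rewrite ?ler01 ?lexx.
Qed.

Let measurable_indY k : measurable_fun setT (fun w => \1_(B k) (Y k w) : R).
Proof. by apply: measurableT_comp => //; exact: measurable_indic. Qed.

Let measurable_ind m : measurable_fun setT (ind m).
Proof.
have -> : ind m = (fun w => \prod_(k <- enum 'I_n) (if (k < m)%N then \1_(B k) (Y k w) else 1)).
  by apply/funext => w; rewrite /ind big_mkcond big_enum.
by apply: measurable_prod => k _; case: (k < m)%N.
Qed.

Let lin (u : 'I_n -> R) th (w : T) := \sum_k u k * Y k w + th.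

Let measurable_cos_lin u th : measurable_fun setT (fun w => cos (lin u th w)).
Proof.
apply: (measurableT_comp (f := cos)).
  by apply: continuous_measurable_fun; exact: continuous_cos.
apply: measurable_funD => //.
by apply: measurable_sum => k; exact: measurable_funM.
Qed.

Let cos1 (x : R) : `|cos x| <= 1.
Proof. by rewrite ler_norml cos_geN1 cos_le1. Qed.

Let bint (f : T -> R) (C : R) : measurable_fun setT f -> (forall x, `|f x| <= C) ->
  P.-integrable setT (EFin \o f).
Proof. exact: (@bounded_integrable _ _ _ P f C). Qed.

(** Induction moves coordinates one by one from the cosine into the indicators: [m = 0] is [Ycos],
    while [m = n] with [u = 0] is independence. Each step is the weighted uniqueness theorem for the
    coordinate [Y i0] being moved. *)
Let key m (u : 'I_n -> R) th : (m <= n)%N -> (forall k : 'I_n, (k < m)%N -> u k = 0) ->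
  \int[P]_w (ind m w * cos (lin u th w)) =
  (\prod_(k < n | (k < m)%N) p k) * (cos th * expR (- (\sum_k (sig k * u k) ^+ 2 / 2))).
Proof.
elim: m u th => [|m IH] u th mn u0.
  rewrite big_pred0// mul1r -Ycos; apply: eq_Rintegral => w _.
  by rewrite /ind big_pred0// mul1r.
pose i0 := Ordinal mn.
have indS w : ind m.+1 w = ind m w * \1_(B i0) (Y i0 w).
  rewrite /ind (bigD1 i0)//= mulrC; congr (_ * _); apply: eq_bigl => k.
  by rewrite ltnS -val_eqE/= andbC ltn_neqAle.
have pS : \prod_(k < n | (k < m.+1)%N) p k = (\prod_(k < n | (k < m)%N) p k) * p i0.
  rewrite (bigD1 i0)//= mulrC; congr (_ * _); apply: eq_bigl => k.
  by rewrite ltnS -val_eqE/= andbC ltn_neqAle.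
set c := (\prod_(k < n | (k < m)%N) p k) * (cos th * expR (- (\sum_k (sig k * u k) ^+ 2 / 2))).
have mid w : `|ind m w| <= 1.
  by have /andP[a b] := ind_itv m w; rewrite ger0_norm.
(* [c] is the mean of the first term by the induction hypothesis. That [Y i0] can be factored out
   means that [W] has conditional mean 0 given [Y i0]. *)
pose W w := ind m w * cos (lin u th w) - c.
have mW : measurable_fun setT W.
  by apply: measurable_funB => //; apply: measurable_funM; [exact: measurable_ind|exact: measurable_cos_lin].
have WM w : `|W w| <= 1 + `|c|.
  rewrite (le_trans (ler_normB _ _))// lerD2r normrM -[leRHS]mulr1 ler_pM//.
have iic m' u' th' : P.-integrable setT (EFin \o (fun w => ind m' w * cos (lin u' th' w))).
  apply: (bint (C := 1)).
    by apply: measurable_funM; [exact: measurable_ind|exact: measurable_cos_lin].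
  move=> w; rewrite normrM -[leRHS]mulr1 ler_pM//.
  by have /andP[a b] := ind_itv m' w; rewrite ger0_norm.
pose upd t k := u k + (if k == i0 then t else 0).
have upd_lin t th' w : lin (upd t) th' w = lin u 0 w + (t * Y i0 w + th').
  rewrite /lin addr0 addrA; congr (_ + _).
  rewrite (eq_bigr (fun k => u k * Y k w + (if k == i0 then t * Y k w else 0))).
    by rewrite big_split/= -big_mkcond/= big_pred1_eq.
  by move=> k _; rewrite /upd mulrDl; case: eqP => // _; rewrite mul0r.
have ui0 : u i0 = 0 by apply: u0 => /=.
have upd_sq t : \sum_k (sig k * upd t k) ^+ 2 / 2 =
    \sum_k (sig k * u k) ^+ 2 / 2 + (sig i0 * t) ^+ 2 / 2.
  rewrite (eq_bigr (fun k => (sig k * u k) ^+ 2 / 2 + (if k == i0 then (sig k * t) ^+ 2 / 2 else 0))).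
    by rewrite big_split/= -big_mkcond/= big_pred1_eq.
  move=> k _; rewrite /upd; case: eqP => [->|_]; last by rewrite !addr0.
  by rewrite ui0 add0r mulr0 expr0n mul0r add0r.
have upd0 t (k : 'I_n) : (k < m)%N -> upd t k = 0.
  move=> km; rewrite /upd u0 ?ltnS ?(ltnW km)//.
  by case: eqP km => [->|_ _]; rewrite ?ltnn// addr0.
have IHu t th' := IH (upd t) th' (ltnW mn) (upd0 t).
have Ycos1 t c' : \int[P]_w cos (t * Y i0 w + c') = cos c' * expR (- ((sig i0 * t) ^+ 2 / 2)).
  have := Ycos (fun k => if k == i0 then t else 0) c'.
  under eq_Rintegral => w _.
    rewrite (eq_bigr (fun k => if k == i0 then t * Y k w else 0)); last first.
      by move=> k _; case: eqP => // _; rewrite mul0r.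
    rewrite -big_mkcond big_pred1_eq; over.
  move=> ->; congr (_ * expR (- _)).
  rewrite (eq_bigr (fun k => if k == i0 then (sig k * t) ^+ 2 / 2 else 0)); last first.
    by move=> k _; case: eqP => // _; rewrite mulr0 expr0n mul0r.
  by rewrite -big_mkcond big_pred1_eq.
have YW0 t c' : \int[P]_w (W w * cos (t * Y i0 w + c')) = 0.
  (* The product of two cosines becomes half the sum of the cosines of the sum and of the
     difference. Both arguments are linear forms with coefficient [t] or [- t] at [i0], within reach
     of the induction hypothesis. *)
  transitivity (\int[P]_w (2^-1 * (ind m w * cos (lin (upd t) (th + c') w)) +
      2^-1 * (ind m w * cos (lin (upd (- t)) (th - c') w)) - c * cos (t * Y i0 w + c'))).
    apply: eq_Rintegral => w _; rewrite /W !upd_lin.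
    have -> : lin u 0 w + (t * Y i0 w + (th + c')) = lin u th w + (t * Y i0 w + c').
      by rewrite /lin; ring.
    have -> : lin u 0 w + (- t * Y i0 w + (th - c')) = lin u th w - (t * Y i0 w + c').
      by rewrite /lin; ring.
    by move: (t * Y i0 w + c') (lin u th w) => y l; rewrite cosD cosB; field.
  have mc : measurable_fun setT (fun w => cos (t * Y i0 w + c')).
    apply: (measurableT_comp (f := cos)).
      by apply: continuous_measurable_fun; exact: continuous_cos.
    by apply: measurable_funD => //; exact: measurable_funM.
  have ic : P.-integrable setT (EFin \o (fun w => cos (t * Y i0 w + c'))).
    exact: (bint (C := 1)).
  have iZ (f : T -> R) (a : R) : P.-integrable setT (EFin \o f) -> P.-integrable setT (EFin \o (fun w => a * f w)).
    move=> fi; have := @integrableZl _ _ _ P setT measurableT a _ fi.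
    by apply: eq_integrable => // w _ /=; rewrite EFinM.
  have i1 := iZ _ 2^-1 (iic m (upd t) (th + c')).
  have i2 := iZ _ 2^-1 (iic m (upd (- t)) (th - c')).
  have i3 := iZ _ c ic.
  have i12 : P.-integrable setT (EFin \o (fun w => 2^-1 * (ind m w * cos (lin (upd t) (th + c') w)) +
      2^-1 * (ind m w * cos (lin (upd (- t)) (th - c') w)))).
    have := integrableD measurableT i1 i2.
    by apply: eq_integrable => // w _ /=; rewrite EFinD.
  rewrite RintegralB// RintegralD// (RintegralZl _ measurableT (iic _ _ _)) (RintegralZl _ measurableT (iic _ _ _)) (RintegralZl _ measurableT ic).
  rewrite !IHu Ycos1 !upd_sq mulrN sqrrN /c cosD cosB opprD expRD.
  by field.
have H := @fourier_uniq _ T R P (Y i0) W _ (mY i0) mW WM YW0 (B i0) (mB i0).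
transitivity (\int[P]_w (W w * \1_(B i0) (Y i0 w) + c * \1_(B i0) (Y i0 w))).
  apply: eq_Rintegral => w _; rewrite /W indS; ring.
rewrite RintegralD//; last 2 first.
- apply: (bint (C := 1 + `|c|)).
    by apply: measurable_funM => //; exact: measurable_indY.
  move=> w; rewrite normrM -[leRHS]mulr1 ler_pM//.
  by rewrite indicE; case: (_ \in _); rewrite ?normr1 ?normr0.
- apply: (bint (C := `|c|)).
    by apply: measurable_funM => //; exact: measurable_indY.
  move=> w; rewrite normrM -[leRHS]mulr1 ler_pM//.
  by rewrite indicE; case: (_ \in _); rewrite ?normr1 ?normr0.
rewrite H add0r RintegralZl//; last first.
  apply: (bint (C := 1)); first exact: measurable_indY.
  by move=> w; rewrite indicE; case: (_ \in _); rewrite ?normr1 ?normr0.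
have -> : \int[P]_w \1_(B i0) (Y i0 w) = p i0.
  rewrite /p -Ylaw// /Rintegral.
  have mYB : measurable (Y i0 @^-1` B i0) by rewrite -[X in measurable X]setTI; exact: mY.
  by have := integral_indic P measurableT mYB; rewrite setIT => <-.
by rewrite pS /c; ring.
Qed.

Lemma gaussian_independent :
  P (\bigcap_(k in [set: 'I_n]) (Y k @^-1` B k)) = (\prod_(k < n) p k)%:E.
Proof.
have := @key n (fun=> 0) 0 (leqnn n) (fun _ _ => erefl).
have lin0 w : lin (fun=> 0) 0 w = 0.
  by rewrite /lin addr0 big1// => k _; rewrite mul0r.
under eq_Rintegral do rewrite lin0 cos0 mulr1.
have -> : \sum_k (sig k * 0) ^+ 2 / 2 = 0.
  by apply: big1 => k _; rewrite mulr0 expr0n mul0r.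
rewrite cos0 mul1r oppr0 expR0 mulr1.
rewrite (eq_bigl xpredT); last by move=> k; rewrite ltn_ord.
move=> <-.
set A := \bigcap_(k in _) _.
have mA : measurable A.
  apply: fin_bigcap_measurable => // k _.
  by rewrite -[X in measurable X]setTI; exact: mY.
have -> : (\int[P]_w ind n w)%:E = (\int[P]_w (\1_A w)%:E)%E.
  rewrite /Rintegral fineK; last first.
    apply: integrable_fin_num => //; apply: (bint (C := 1)) => // w.
    by have /andP[a b] := ind_itv n w; rewrite ger0_norm.
  apply: eq_integral => w _; congr EFin; rewrite /ind indicE.
  have [wA|wA] := boolP (w \in A).
    rewrite big1// => k _; rewrite indicE mem_set//.
    by move: wA; rewrite inE => /(_ k); exact.
  move: wA => /negP; rewrite inE => /existsNP[k /not_implyP[_ Yk]].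
  rewrite (bigD1 k) ?ltn_ord//= indicE memNset ?mul0r//.
by rewrite integral_indic// setIT.
Qed.

End independence.

Section gaussian_law_integral.
Context d (T : measurableType d) (R : realType) (P : probability T R).

Lemma ge0_integral_gaussian_law (S : T -> R) (m s : R) (f : R -> R) :
  measurable_fun setT S ->
  (forall B, measurable B -> P (S @^-1` B) = gaussian_law m s B) ->
  measurable_fun setT f -> (forall x, 0 <= f x) ->
  (\int[P]_w (f (S w))%:E =
   if (s == 0)%R then (f m)%:E
   else \int[lebesgue_measure]_x ((f x)%:E * (normal_pdf m s x)%:E))%E.
Proof.
move=> mS law mf f0.
have mS' : measurable_fun setT (S : T -> measurableTypeR R) by [].
have mEf : measurable_fun [set: measurableTypeR R] (EFin \o f) by exact/measurable_EFinP.
have f0' : {in [set: measurableTypeR R], forall y, (0 <= (EFin \o f) y)%E}.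
  by move=> y _; rewrite lee_fin.
have := ge0_integral_pushforward mS' P measurableT mEf f0'.
rewrite preimage_setT => <-.
move: law; rewrite /gaussian_law; case: eqP => [s0|/eqP s0] law.
  rewrite (@eq_measure_integral _ _ _ _ (\d_(m : measurableTypeR R))); last by move=> A mA _; exact: law.
  by rewrite integral_dirac// diracT mul1e.
rewrite (@eq_measure_integral _ _ _ _ (normal_prob m s)); last by move=> A mA _; exact: law.
by apply: ge0_integral_normal_prob => // x; rewrite lee_fin.
Qed.

(** The free centre [c] allows both parameters to be recovered from second moments alone, also in
    the degenerate case. *)
Lemma gaussian_law_second_moment (S : T -> R) (m s c : R) :
  measurable_fun setT S ->
  (forall B, measurable B -> P (S @^-1` B) = gaussian_law m s B) ->
  (\int[P]_w ((S w - c) ^+ 2)%:E = (s ^+ 2 + (m - c) ^+ 2)%:E)%E.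
Proof.
move=> mS law.
rewrite (@ge0_integral_gaussian_law S m s (fun x => (x - c) ^+ 2))//.
- case: eqP => [->|/eqP s0]; first by rewrite expr0n add0r.
  exact: normal_centered_second_moment.
- by apply: measurable_funX; exact: measurable_funB.
- by move=> x; rewrite sqr_ge0.
Qed.

End gaussian_law_integral.

Definition centered_gaussian_family d (T : measurableType d) (R : realType)
    (P : probability T R) n (X : 'I_n -> {mfun T >-> R}) (K : 'I_n -> 'I_n -> R) :=
  [/\ forall a : 'I_n -> R, exists m s : R, forall B : set R, measurable B ->
        P ((fun w => \sum_k a k * X k w) @^-1` B) = gaussian_law m s B,
      forall k, ('E_P[X k] = 0)%E &
      forall k l, covariance P (X k) (X l) = (K k l)%:E].

Section gaussian_family.
Context d (T : measurableType d) (R : realType) (P : probability T R) (n : nat).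
Variables (X : 'I_n -> {mfun T >-> R}) (K : 'I_n -> 'I_n -> R).
Hypothesis gX : centered_gaussian_family P X K.
Implicit Type a : 'I_n -> R.

Let S a w := \sum_k a k * X k w.
Let v a := \sum_k \sum_l a k * a l * K k l.

Lemma measurable_lincomb a : measurable_fun setT (S a).
Proof. by apply: measurable_sum => k; exact: measurable_funM. Qed.

(** Integrability is drawn from the law of the single coordinate [X k], obtained by taking an
    indicator as coefficient family. *)
Lemma gaussian_family_sqr_integrable k : P.-integrable setT (EFin \o (fun w => X k w ^+ 2)).
Proof.
have [law _ _] := gX.
have [m [s lawk]] := law (fun j => if j == k then 1 else 0).
have e : (fun w => \sum_j (if j == k then 1 else 0) * X j w) = X k.
  apply/funext => w; rewrite (eq_bigr (fun j => if j == k then X j w else 0)).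
    by rewrite -big_mkcond big_pred1_eq.
  by move=> j _; case: eqP; rewrite ?mul1r ?mul0r.
rewrite e in lawk.
apply/integrableP; split; first by apply/measurable_EFinP; exact: measurable_funX.
under eq_integral do rewrite /= ger0_norm ?sqr_ge0// -(subr0 (X k _)).
by rewrite (gaussian_law_second_moment 0 _ lawk)// ltry.
Qed.

Lemma gaussian_family_mul_integrable k l :
  P.-integrable setT (EFin \o (fun w => X k w * X l w)).
Proof.
have := integrableD measurableT (gaussian_family_sqr_integrable k) (gaussian_family_sqr_integrable l).
apply: le_integrable => //; first by apply/measurable_EFinP; exact: measurable_funM.
move=> w _ /=; rewrite lee_fin [leRHS]ger0_norm ?addr_ge0 ?sqr_ge0//.
rewrite normrM -(real_normK (num_real (X k w))) -(real_normK (num_real (X l w))).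
have := sqr_ge0 (`|X k w| - `|X l w|); have := mulr_ge0 (normr_ge0 (X k w)) (normr_ge0 (X l w)).
move: `|X k w| `|X l w| => x y; lra.
Qed.

Lemma gaussian_family_integrable k : P.-integrable setT (EFin \o X k).
Proof.
have := integrableD measurableT (finite_measure_integrable_cst P 1 measurableT) (gaussian_family_sqr_integrable k).
apply: le_integrable => //; first exact/measurable_EFinP.
move=> w _ /=; rewrite lee_fin [leRHS]ger0_norm ?addr_ge0 ?sqr_ge0//.
rewrite -(real_normK (num_real (X k w))).
have := sqr_ge0 (`|X k w| - 2^-1); move: `|X k w| => x; lra.
Qed.

Lemma gaussian_family_mean k : \int[P]_w X k w = 0.
Proof.
by have [_ /(_ k) + _] := gX; rewrite unlock /Rintegral => ->.
Qed.

Lemma gaussian_family_cov k l : \int[P]_w (X k w * X l w) = K k l.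
Proof.
have [_ E0 /(_ k l)] := gX; rewrite unlock !E0 /= unlock /Rintegral => e.
rewrite -[RHS]/(fine (K k l)%:E) -e; congr fine; apply: eq_integral => w _ /=.
by rewrite -[((_ \- _) * _) w]/((X k w - 0) * (X l w - 0)) !subr0.
Qed.

Lemma lincomb_centered_second_moment a c :
  P.-integrable setT (EFin \o (fun w => (S a w - c) ^+ 2)) /\
  \int[P]_w ((S a w - c) ^+ 2) = v a + c ^+ 2.
Proof.
have iXX k l := integrableMl_cst (a k * a l) (gaussian_family_mul_integrable k l).
have iX k := integrableMl_cst (a k) (gaussian_family_integrable k).
have iXX1 k := integrable_Rsum (index_enum 'I_n) (iXX k).
have iS1 := integrable_Rsum (index_enum 'I_n) iX.
have iS2 := integrable_Rsum (index_enum 'I_n) iXX1.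
have e w : (S a w - c) ^+ 2 = (\sum_k \sum_l a k * a l * (X k w * X l w)) +
    ((- (2 * c)) * (\sum_k a k * X k w) + c ^+ 2).
  rewrite sqrrB -addrA; congr (_ + _).
    rewrite expr2 /S mulr_suml; apply: eq_bigr => k _.
    by rewrite mulr_sumr; apply: eq_bigr => l _; ring.
  by rewrite -/(S a w); ring.
have i2 := integrableMl_cst (- (2 * c)) iS1.
have i3 : P.-integrable setT (EFin \o (fun=> c ^+ 2)) by exact: finite_measure_integrable_cst.
have i23 : P.-integrable setT (EFin \o (fun w => (- (2 * c)) * (\sum_k a k * X k w) + c ^+ 2)).
  by have := integrableD measurableT i2 i3; apply: eq_integrable => // w _ /=; rewrite EFinD.
split.
  have := integrableD measurableT iS2 i23.
  by apply: eq_integrable => // w _ /=; rewrite e EFinD.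
under eq_Rintegral do rewrite e.
rewrite RintegralD//.
rewrite RintegralD// (Rintegral_sum _ iXX1) (RintegralZl _ measurableT iS1).
rewrite (Rintegral_sum _ iX) Rintegral_cst//.
rewrite (_ : fine (P [set: T]) = 1); last by rewrite probability_setT.
rewrite mulr1 [X in - _ * X]big1 ?mulr0 ?add0r; last first.
  move=> k _; rewrite (RintegralZl _ measurableT (gaussian_family_integrable k)).
  by rewrite gaussian_family_mean mulr0.
congr (_ + _); apply: eq_bigr => k _.
rewrite (Rintegral_sum _ (iXX k)); apply: eq_bigr => l _.
rewrite (RintegralZl _ measurableT (gaussian_family_mul_integrable k l)).
by rewrite gaussian_family_cov.
Qed.

Lemma lincomb_law a : exists2 s : R, s ^+ 2 = v a & forall B : set R, measurable B ->
  P (S a @^-1` B) = gaussian_law 0 s B.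
Proof.
have [/(_ a) [m [s law]] _ _] := gX.
have mS := measurable_lincomb a.
have h c : s ^+ 2 + (m - c) ^+ 2 = v a + c ^+ 2.
  have [i <-] := lincomb_centered_second_moment a c.
  apply: EFin_inj; rewrite -(gaussian_law_second_moment c mS law).
  by rewrite /Rintegral fineK//; exact: integrable_fin_num.
(* The identity [h] at [c = 0] and at [c = m] gives [m ^+ 2 = - m ^+ 2]. *)
have m2 : m ^+ 2 = 0.
  by have := h 0; have := h m; rewrite subr0 subrr; lra.
have m0 : m = 0 by apply/eqP; rewrite -sqrf_eq0 m2.
exists s; first by have := h 0; rewrite m0 subr0 expr0n !addr0.
by rewrite m0 in law.
Qed.

Lemma lincomb_cos a th :
  \int[P]_w cos (S a w + th) = cos th * expR (- (v a / 2)).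
Proof.
have [s sv law] := lincomb_law a.
have mS := measurable_lincomb a.
have mc : measurable_fun setT (fun x : R => cos (x + th)).
  apply: (measurableT_comp (f := cos)); last exact: measurable_funD.
  by apply: continuous_measurable_fun; exact: continuous_cos.
have ic : P.-integrable setT (EFin \o (fun w => cos (S a w + th))).
  apply: (@bounded_integrable _ _ _ P _ 1).
    exact: (measurableT_comp mc mS).
  by move=> w; rewrite ler_norml cos_geN1 cos_le1.
(* Adding 1 makes the integrand nonnegative, as the transfer to the law of [S a] demands. *)
have : \int[P]_w (1 + cos (S a w + th)) = 1 + cos th * expR (- (v a / 2)).
  rewrite /Rintegral (@ge0_integral_gaussian_law _ _ _ P (S a) 0 s (fun x => 1 + cos (x + th)))//.
  - case: eqP => [s0|/eqP s0].
      by rewrite /= add0r -sv s0 expr0n mul0r oppr0 expR0 mulr1.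
    under eq_integral do rewrite -EFinM.
    rewrite -[LHS]/(Rintegral _ _ _).
    transitivity (\int[lebesgue_measure]_x (normal_pdf 0 s x + cos (1 * x + th) * normal_pdf 0 s x)).
      by apply: eq_Rintegral => x _; rewrite mulrDl !mul1r.
    rewrite RintegralD//; last 2 first.
    - exact: integrable_normal_pdf.
    - have ip := integrable_normal_pdf 0 s; apply: le_integrable ip => //.
        apply/measurable_EFinP; apply: measurable_funM; last exact: measurable_normal_pdf.
        by under eq_fun do rewrite mul1r.
      move=> x _ /=; rewrite lee_fin normrM ler_piMl// ler_norml cos_geN1 cos_le1//.
    by rewrite normal_fourier// /Rintegral integral_normal_pdf mulr1 sv.
  - exact: measurable_funD.
rewrite RintegralD//; last exact: finite_measure_integrable_cst.
rewrite Rintegral_cst// (_ : fine (P [set: T]) = 1); last by rewrite probability_setT.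
by rewrite mulr1 => /addrI.
Qed.

Lemma lincomb_normal a (t : R) : t != 0 -> v a = t ^+ 2 -> forall B : set R, measurable B ->
  P (S a @^-1` B) = normal_prob 0 t B.
Proof.
move=> t0 vt B mB; have [s sv law] := lincomb_law a.
have st : s ^+ 2 = t ^+ 2 by rewrite sv.
have s0 : s != 0 by rewrite -sqrf_eq0 st sqrf_eq0.
rewrite law// /gaussian_law (negbTE s0) /normal_prob; apply: eq_integral => x _.
by rewrite !normal_pdfE// /normal_peak /normal_fun st.
Qed.

Lemma lincomb_null a : v a = 0 -> P (S a @^-1` (~` [set 0])) = 0%E.
Proof.
move=> v0; have [s sv law] := lincomb_law a.
have s0 : s = 0 by apply/eqP; rewrite -sqrf_eq0 sv v0.
rewrite law; last by apply: measurableC; exact: measurable_set1.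
by rewrite /gaussian_law s0 eqxx diracE memNset//= => /(_ erefl).
Qed.

End gaussian_family.

(** * Product Gaussian measures *)

Section product_integral.
Context {R : realType}.
Notation mu := (@lebesgue_measure R).

Lemma measurable_prod_coord n (f : 'I_n -> R -> R) :
  (forall k, measurable_fun setT (f k)) ->
  measurable_fun setT (fun x : 'rV[R]_n => \prod_k f k (x 0 k)).
Proof.
move=> mf; apply: measurable_prod => k _.
by apply: (measurableT_comp (mf k)); exact: measurable_coord.
Qed.

(** [lebesgue_rV] is built by pushing forward a product measure along [rV_cons], so one use of
    Tonelli splits off the head coordinate. *)
Lemma integral_lebesgue_rV_prod n (f : 'I_n -> R -> R) (I : 'I_n -> R) :
  (forall k, measurable_fun setT (f k)) -> (forall k x, 0 <= f k x) ->
  (forall k, \int[mu]_x (f k x)%:E = (I k)%:E)%E ->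
  (\int[lebesgue_rV R n]_x (\prod_k f k (x 0 k))%:E = (\prod_k I k)%:E)%E.
Proof.
elim: n f I => [|n IH] f I mf f0 fI.
  rewrite big_ord0 /=; under eq_integral do rewrite big_ord0.
  by rewrite integral_cst// mul1e; exact: diracT.
rewrite /= /lebesgue_rV_cons.
pose F (x : 'rV[R]_n.+1) : \bar R := (\prod_k f k (x 0 k))%:E.
have mF : measurable_fun setT F.
  by apply/measurable_EFinP; exact: measurable_prod_coord.
have F0 : {in [set: 'rV[R]_n.+1], forall y, (0 <= F y)%E}.
  by move=> y _; rewrite lee_fin prodr_ge0.
have := ge0_integral_pushforward (@measurable_rV_cons R n) (mu \x lebesgue_rV R n)%E measurableT mF F0.
rewrite preimage_setT => E.
transitivity (\int[mu \x lebesgue_rV R n]_x (F \o rV_cons (n:=n)) x)%E.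
  exact: E.
rewrite {E} /comp /F.
have m1 : measurable_fun [set: measurableTypeR R * 'rV[R]_n]
    (fun z => (\prod_(k < n.+1) f k (rV_cons z 0 k))%:E).
  exact: (measurableT_comp mF (@measurable_rV_cons R n)).
rewrite (fubini_tonelli1 _ m1); last first.
  by move=> z; rewrite lee_fin prodr_ge0.
have c0 (x : R) (v : 'rV[R]_n) : rV_cons (x, v) 0 ord0 = x.
  rewrite (_ : ord0 = @lshift 1 n 0); last exact/val_inj.
  by rewrite /rV_cons (@row_mxEl _ 1 1 n) mxE eqxx mulr1n.
have cS (x : R) (v : 'rV[R]_n) k : rV_cons (x, v) 0 (lift ord0 k) = v 0 k.
  rewrite (_ : lift ord0 k = @rshift 1 n k); last exact/val_inj.
  by rewrite /rV_cons (@row_mxEr _ 1 1 n).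
pose J := \prod_(k < n) I (lift ord0 k).
have J0 k : 0 <= I k.
  by rewrite -lee_fin -fI; apply: integral_ge0 => x _; rewrite lee_fin.
transitivity (\int[mu]_x (J%:E * (f ord0 x)%:E))%E.
  apply: eq_integral => x _; rewrite /fubini_F.
  under eq_integral => v _.
    rewrite big_ord_recl c0.
    rewrite (eq_bigr (fun k => f (lift ord0 k) (v 0 k))); last by move=> k _; rewrite cS.
    rewrite EFinM; over.
  rewrite ge0_integralZl//.
  - by rewrite (IH (fun k => f (lift ord0 k)) (fun k => I (lift ord0 k)))// muleC.
  - by apply/measurable_EFinP; exact: (@measurable_prod_coord _ (fun k => f (lift ord0 k))).
  - by move=> v _; rewrite lee_fin prodr_ge0.
  - by rewrite lee_fin.
rewrite ge0_integralZl//.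
- by rewrite fI -EFinM big_ord_recl mulrC.
- by apply/measurable_EFinP; exact: mf.
- by move=> x _; rewrite lee_fin.
- by rewrite lee_fin prodr_ge0.
Qed.

End product_integral.

Section gauss_rV.
Context {R : realType} (n : nat) (sig : 'I_n -> R).

Definition gauss_pdf (x : 'rV[R]_n) : R := \prod_k normal_pdf 0 (sig k) (x 0 k).

Lemma measurable_gauss_pdf : measurable_fun setT gauss_pdf.
Proof. by apply: (@measurable_prod_coord _ _ (fun k => normal_pdf 0 (sig k))) => k; exact: measurable_normal_pdf. Qed.

Lemma gauss_pdf_ge0 x : 0 <= gauss_pdf x.
Proof. by apply: prodr_ge0 => k _; exact: normal_pdf_ge0. Qed.

Definition gauss_rV (A : set 'rV[R]_n) : \bar R :=
  (\int[lebesgue_rV R n]_(x in A) (gauss_pdf x)%:E)%E.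

Let gauss_rV0 : gauss_rV set0 = 0%E.
Proof. by rewrite /gauss_rV integral_set0. Qed.

Let gauss_rV_ge0 A : (0 <= gauss_rV A)%E.
Proof. by apply: integral_ge0 => x _; rewrite lee_fin gauss_pdf_ge0. Qed.

Let gauss_rV_sigma_additive : semi_sigma_additive gauss_rV.
Proof.
move=> F mF tF mUF; rewrite /gauss_rV ge0_integral_bigcup//.
- by apply: is_cvg_ereal_nneg_natsum_cond => k _ _; exact: gauss_rV_ge0.
- by apply: measurable_funTS; apply/measurable_EFinP; exact: measurable_gauss_pdf.
- by move=> x _; rewrite lee_fin gauss_pdf_ge0.
Qed.

HB.instance Definition _ := isMeasure.Build _ _ _ gauss_rV
  gauss_rV0 gauss_rV_ge0 gauss_rV_sigma_additive.

Lemma gauss_rV_box (B : 'I_n -> set R) : (forall k, measurable (B k)) ->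
  gauss_rV [set x | forall k, B k (x 0 k)] =
  (\prod_k fine (normal_prob 0 (sig k) (B k)))%:E.
Proof.
move=> mB; rewrite /gauss_rV integral_mkcond.
rewrite -(@integral_lebesgue_rV_prod _ _ (fun k x => normal_pdf 0 (sig k) x * \1_(B k) x)).
- apply: eq_integral => x _; rewrite /patch /gauss_pdf big_split/=.
  case: ifPn => [|xB].
    by rewrite inE /= => xB; rewrite [X in _ * X]big1 ?mulr1// => k _; rewrite indicE mem_set.
  move: xB => /negP; rewrite inE => /existsNP[k xk].
  by rewrite [X in _ * X](bigD1 k)//= indicE memNset// mul0r mulr0.
- move=> k; apply: measurable_funM; first exact: measurable_normal_pdf.
  exact: measurable_indic.
- by move=> k x; rewrite mulr_ge0 ?normal_pdf_ge0// indicE; case: (_ \in _).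
- move=> k; rewrite fineK; last exact: (fin_num_measure (normal_prob 0 (sig k)) _ (mB k)).
  rewrite /normal_prob [in RHS]integral_mkcond; apply: eq_integral => x _.
  by rewrite /patch indicE; case: (_ \in _); rewrite ?mulr1 ?mulr0.
Qed.

Lemma gauss_rV_setT : gauss_rV setT = 1%E.
Proof.
have := @gauss_rV_box (fun=> setT) (fun=> measurableT).
rewrite (_ : [set x | _] = setT)//; last by apply/seteqP; split => x.
by move=> ->; rewrite big1// => k _; rewrite probability_setT.
Qed.

End gauss_rV.

Definition rV_boxes (R : realType) n : set (set 'rV[R]_n) :=
  [set A | exists2 B : 'I_n -> set R, (forall k, measurable (B k)) &
     A = [set x : 'rV[R]_n | forall k, B k (x 0 k)]].

Lemma measurable_rV_boxes (R : realType) n :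
  (measurable : set (set 'rV[R]_n)) = <<s @rV_boxes R n >>.
Proof.
apply/seteqP; split.
  apply: smallest_sub; first exact: smallest_sigma_algebra.
  rewrite -bigcup_seq => _ [i _ [B mB <-]]; apply: sub_sigma_algebra => /=.
  exists (fun k => if k == i then B else setT).
    by move=> k; case: eqP.
  rewrite setTI; apply/seteqP; split => x /=.
    by move=> xB k; case: eqP => [->|].
  by move=> /(_ i); rewrite eqxx.
apply: smallest_sub; first exact: sigma_algebra_measurable.
move=> _ [B mB ->].
rewrite (_ : mkset _ = \bigcap_(k in [set: 'I_n])
    ((fun x : 'rV[R]_n => x 0 k) @^-1` B k)).
  apply: fin_bigcap_measurable => // k _.
  by rewrite -[X in measurable X]setTI; apply: measurable_coord.
by apply/seteqP; split => x /= h k; [move=> _|]; exact: h.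
Qed.

Section joint_law.
Context d (T : measurableType d) (R : realType) (P : probability T R) (n : nat).
Variables (Y : 'I_n -> T -> R) (sig : 'I_n -> R).
Hypotheses (mY : forall k, measurable_fun setT (Y k))
  (Ycos : forall (u : 'I_n -> R) th,
     \int[P]_w cos (\sum_k u k * Y k w + th) =
     cos th * expR (- (\sum_k (sig k * u k) ^+ 2 / 2)))
  (Ylaw : forall k A, measurable A -> P (Y k @^-1` A) = normal_prob 0 (sig k) A).

Definition row_of_fun (w : T) : 'rV[R]_n := \row_k Y k w.

Lemma measurable_row_of_fun : measurable_fun setT row_of_fun.
Proof.
by apply: measurable_rVP => k; under eq_fun do rewrite mxE; exact: mY.
Qed.

HB.instance Definition _ := isMeasurableFun.Build _ _ T 'rV[R]_n row_of_fun measurable_row_of_fun.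

(** The two measures agree on boxes, by independence on one side and Tonelli on the other; boxes are
    stable under intersection and generate the sigma-algebra. *)
Lemma joint_gaussian_law (A : set 'rV[R]_n) : measurable A ->
  P (row_of_fun @^-1` A) = gauss_rV sig A.
Proof.
move=> mA.
pose mu1 : {measure set 'rV[R]_n -> \bar R} := distribution P row_of_fun.
pose mu2 : {measure set 'rV[R]_n -> \bar R} := gauss_rV sig.
suff : mu1 A = mu2 A by [].
have := @measure_unique _ R 'rV[R]_n (@rV_boxes R n) (fun=> setT) (@measurable_rV_boxes R n).
move=> /(_ _ _ _ mu1 mu2 _ _ A mA); apply.
- move=> _ _ [B1 mB1 ->] [B2 mB2 ->].
  exists (fun k => B1 k `&` B2 k); first by move=> k; exact: measurableI.
  apply/seteqP; split => x /=.
    by move=> [x1 x2] k; split.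
  by move=> h; split => k; have [] := h k.
- by move=> _; exists (fun=> setT) => //; apply/seteqP; split.
- by apply/seteqP; split => // x _; exists 0%N.
- move=> _ [B mB ->].
  rewrite -[mu2 _]/(gauss_rV sig _) gauss_rV_box//.
  rewrite -(@gaussian_independent _ T R P n Y sig B mY Ycos Ylaw mB).
  rewrite -[mu1 _]/(P (row_of_fun @^-1` _)); congr (P _).
  apply/seteqP; split => w /=.
    by move=> h k _; have := h k; rewrite mxE.
  by move=> h k; rewrite mxE; exact: h.
- by move=> _; rewrite (le_lt_trans (probability_le1 _ _))// ltry.
Qed.

End joint_law.

(** * Likelihood ratios of product Gaussian densities *)

Section normal_pdf_comparison.
Context {R : realType}.
Implicit Types (s t x : R).

Lemma normal_pdf_expR s x : 0 < s ->
  normal_pdf 0 s x = normal_peak 1 * expR (- ln s - x ^+ 2 / (2 * s ^+ 2)).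
Proof.
move=> s0; have sn0 : s != 0 by rewrite gt_eqF.
rewrite normal_pdfE// /normal_fun subr0 expRD expRN lnK ?posrE// mulrA; congr (_ * expR _).
  rewrite /normal_peak expr1n mul1r -mulrnAr sqrtrM ?sqr_ge0// sqrtr_sqr gtr0_norm//.
  by rewrite invfM mulrC.
by rewrite mulNr mulr_natl.
Qed.

(* Here [q = s ^+ 2 / t ^+ 2 - 1] and [k = s / sqrt (1 - e q)] *)
Lemma normal_pdf_tilt s t (e x : R) : 0 < s -> 0 < t ->
  0 < 1 - e * (s ^+ 2 / t ^+ 2 - 1) ->
  let k := s / Num.sqrt (1 - e * (s ^+ 2 / t ^+ 2 - 1)) in
  normal_pdf 0 s x * expR (e * (ln (normal_pdf 0 s x) - ln (normal_pdf 0 t x))) =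
  expR (- (ln (1 - e * (s ^+ 2 / t ^+ 2 - 1)) + e * ln (s ^+ 2 / t ^+ 2)) / 2) * normal_pdf 0 k x.
Proof.
move=> s0 t0; set r := 1 - _ => r0 k.
have k0 : 0 < k by rewrite divr_gt0 ?sqrtr_gt0.
have n1 : 0 < normal_peak 1 :> R by apply: normal_peak_gt0; exact: oner_neq0.
have lnp a : 0 < a -> ln (normal_pdf 0 a x) = ln (normal_peak 1) + (- ln a - x ^+ 2 / (2 * a ^+ 2)).
  by move=> a0; rewrite normal_pdf_expR// lnM ?posrE ?expR_gt0// expRK.
rewrite !lnp// !normal_pdf_expR//.
rewrite -[LHS]mulrA -expRD [RHS]mulrCA -expRD; congr (_ * expR _).
have lk : ln k = ln s - ln r / 2.
  rewrite /k lnM ?posrE ?invr_gt0 ?sqrtr_gt0// lnV ?posrE ?sqrtr_gt0//.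
  by rewrite -[r in RHS]sqr_sqrtr ?ltW// lnXn ?sqrtr_gt0//; field.
have lq : ln (s ^+ 2 / t ^+ 2) = 2 * ln s - 2 * ln t.
  rewrite lnM ?posrE ?invr_gt0 ?exprn_gt0// lnV ?posrE ?exprn_gt0// !lnXn//; ring.
have k2 : k ^+ 2 = s ^+ 2 / r by rewrite exprMn exprVn sqr_sqrtr ?ltW.
rewrite lk lq k2.
have rE : r = 1 - e * (s ^+ 2 / t ^+ 2 - 1) by [].
clearbody r.
have -> : x ^+ 2 / (2 * (s ^+ 2 / r)) = x ^+ 2 / (2 * s ^+ 2) * (1 - e * (s ^+ 2 / t ^+ 2 - 1)).
  by rewrite -rE; field; rewrite !gt_eqF.
by field; rewrite !gt_eqF.
Qed.

(** [ln y <= y - 1] at [y = (1 + x)^-1] yields the lower bound [x - x ^+ 2 / (1 + x)], and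
    [c <= 1 + x] replaces the denominator. *)
Lemma ln_ge (x c : R) : 0 < c -> c <= 1 + x -> x - x ^+ 2 / c <= ln (1 + x).
Proof.
move=> c0 cx; have x0 : 0 < 1 + x by exact: lt_le_trans cx.
have h : - ln (1 + x) <= (1 + x)^-1 - 1.
  have := @le_ln1Dx R ((1 + x)^-1 - 1).
  rewrite addrCA subrr addr0 lnV ?posrE//; apply.
  by rewrite ltrBrDl subrr invr_gt0.
have h2 : x ^+ 2 / (1 + x) <= x ^+ 2 / c.
  by rewrite ler_wpM2l ?sqr_ge0// lef_pV2 ?posrE.
have h3 : x - x ^+ 2 / (1 + x) = 1 - (1 + x)^-1 by field; rewrite gt_eqF.
lra.
Qed.

(** With [s = q - 1], the linear parts [- e * s] and [e * s] of the two logarithms cancel, so the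
    logarithm of the normalizing constant is quadratic in [q - 1]. This is why a bound on the sum of
    squares controls an arbitrary number of factors. *)
Lemma tilt_constant_le (c q e : R) : 0 < c -> c <= q -> 0 <= e -> e <= 1 ->
  e * (q - 1) <= 2^-1 ->
  - (ln (1 - e * (q - 1)) + e * ln q) / 2 <= (1 + (2 * c)^-1) * (q - 1) ^+ 2.
Proof.
move=> c0 cq e0 e1 eq.
set s := q - 1.
have qs : q = 1 + s by rewrite /s addrC subrK.
have h1 : s - s ^+ 2 / c <= ln (1 + s) by apply: ln_ge => //; rewrite -qs.
have h2 : - (e * s) - (- (e * s)) ^+ 2 / 2^-1 <= ln (1 + - (e * s)).
  by apply: ln_ge => //; move: eq; rewrite -/s; lra.
have h3 : e * (s - s ^+ 2 / c) <= e * ln (1 + s) by rewrite ler_wpM2l.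
rewrite [in ln q]qs.
have h4 : e * (s ^+ 2 / c) <= s ^+ 2 / c by rewrite ler_piMl// divr_ge0 ?sqr_ge0// ltW.
have h5 : (e * s) ^+ 2 <= s ^+ 2 by rewrite exprMn ler_piMl ?sqr_ge0// expr_le1.
have -> : (1 + (2 * c)^-1) * s ^+ 2 = s ^+ 2 + s ^+ 2 / c / 2 by field; rewrite gt_eqF.
move: h2; rewrite sqrrN invrK => h2.
move: h3; rewrite mulrBr => h3.
rewrite -/(1 + - (e * s)).
lra.
Qed.

(** Where the log-likelihood ratio is at most [L], the first term already dominates. Elsewhere its
    exponential, raised to the power [e] and divided by [expR (e * L)], is at least 1, and
    multiplying by it produces the tilted density. *)
Lemma gauss_pdf_comparison n (s t : 'I_n -> R) (c Q S L : R) (x : 'rV[R]_n) :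
  let e := (2 * Q)^-1 in
  (forall k, 0 < s k) -> (forall k, 0 < t k) -> 0 < c -> 1 <= Q ->
  (forall k, c <= s k ^+ 2 / t k ^+ 2 <= Q) ->
  \sum_k (s k ^+ 2 / t k ^+ 2 - 1) ^+ 2 <= S ->
  gauss_pdf s x <= expR L * gauss_pdf t x +
    expR (- (e * L)) * expR ((1 + (2 * c)^-1) * S) *
    gauss_pdf (fun k => s k / Num.sqrt (1 - e * (s k ^+ 2 / t k ^+ 2 - 1))) x.
Proof.
move=> e s0 t0 c0 Q1 cQ sumS.
set kap := (fun k => s k / Num.sqrt (1 - e * (s k ^+ 2 / t k ^+ 2 - 1))).
have Q0 : 0 < Q by exact: lt_le_trans Q1.
have e0 : 0 < e by rewrite invr_gt0 mulr_gt0.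
have e1 : e <= 1 by rewrite invf_le1 ?mulr_gt0//; lra.
(* The choice [e = (2 * Q)^-1] is made for this bound: it keeps the tilted variances finite and is
   the last hypothesis of [tilt_constant_le]. *)
have es k : e * (s k ^+ 2 / t k ^+ 2 - 1) <= 2^-1.
  rewrite /e invfM -mulrA ler_piMr ?invr_ge0// mulrC ler_pdivrMr// mul1r.
  by have /andP[_] := cQ k; lra.
have r0 k : 0 < 1 - e * (s k ^+ 2 / t k ^+ 2 - 1).
  by have := es k; lra.
have pos (u : 'I_n -> R) : (forall k, 0 < u k) -> forall k, 0 < normal_pdf 0 (u k) (x 0 k).
  move=> u0 k; rewrite normal_pdf_expR// mulr_gt0 ?expR_gt0//.
  by apply: normal_peak_gt0; exact: oner_neq0.
have gpos (u : 'I_n -> R) : (forall k, 0 < u k) -> 0 < gauss_pdf u x.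
  by move=> u0; apply: prodr_gt0 => k _; exact: pos.
have kap0 k : 0 < kap k by rewrite divr_gt0// sqrtr_gt0.
have [le|gt] := leP (ln (gauss_pdf s x) - ln (gauss_pdf t x)) L.
  apply: (@le_trans _ _ (expR L * gauss_pdf t x)); last first.
    by rewrite lerDl !mulr_ge0 ?expR_ge0// ltW// gpos.
  rewrite -[X in X <= _]lnK ?posrE ?gpos// -[X in _ * X]lnK ?posrE ?gpos//.
  by rewrite -expRD ler_expR -lerBlDr.
apply: (@le_trans _ _ (expR (- (e * L)) * expR ((1 + (2 * c)^-1) * S) * gauss_pdf kap x)); last first.
  by rewrite lerDr mulr_ge0 ?expR_ge0// ltW// gpos.
apply: (@le_trans _ _ (expR (- (e * L)) * (gauss_pdf s x * expR (e * (ln (gauss_pdf s x) - ln (gauss_pdf t x)))))).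
  have h : 1 <= expR (- (e * L)) * expR (e * (ln (gauss_pdf s x) - ln (gauss_pdf t x))).
    rewrite -expRD -expR0 ler_expR addrC -mulrBr.
    by rewrite mulr_ge0 ?(ltW e0)// subr_ge0 ltW.
  by rewrite mulrCA ler_peMr// ltW// gpos.
rewrite -!mulrA ler_wpM2l ?expR_ge0//.
have lnprod (u : 'I_n -> R) : (forall k, 0 < u k) -> ln (gauss_pdf u x) = \sum_k ln (normal_pdf 0 (u k) (x 0 k)).
  move=> u0; rewrite -[RHS]expRK expR_sum; congr ln; apply: eq_bigr => k _.
  by rewrite lnK// posrE pos.
have -> : gauss_pdf s x * expR (e * (ln (gauss_pdf s x) - ln (gauss_pdf t x))) =
    \prod_k (normal_pdf 0 (s k) (x 0 k) *
      expR (e * (ln (normal_pdf 0 (s k) (x 0 k)) - ln (normal_pdf 0 (t k) (x 0 k))))).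
  rewrite big_split/= -expR_sum; congr (_ * expR _).
  by rewrite !lnprod// -sumrB mulr_sumr.
under eq_bigr do rewrite (normal_pdf_tilt _ (s0 _) (t0 _) (r0 _)).
rewrite big_split/= -expR_sum.
apply: ler_wpM2r; first exact/ltW/gpos.
rewrite ler_expR.
apply: le_trans (ler_wpM2l _ sumS); last first.
  by rewrite addr_ge0// invr_ge0 mulr_ge0// ltW.
rewrite mulr_sumr; apply: ler_sum => k _; apply: tilt_constant_le => //.
- by have /andP[] := cQ k.
- exact: ltW.
Qed.

Lemma gauss_rV_comparison n (s t : 'I_n -> R) (c Q S L : R) (A : set 'rV[R]_n) :
  (forall k, 0 < s k) -> (forall k, 0 < t k) -> 0 < c -> 1 <= Q ->
  (forall k, c <= s k ^+ 2 / t k ^+ 2 <= Q) ->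
  \sum_k (s k ^+ 2 / t k ^+ 2 - 1) ^+ 2 <= S -> measurable A ->
  (gauss_rV s A <= (expR L)%:E * gauss_rV t A +
    (expR (- (L / (2 * Q))) * expR ((1 + (2 * c)^-1) * S))%:E)%E.
Proof.
move=> s0 t0 c0 Q1 cQ sumS mA.
pose e := (2 * Q)^-1.
pose kap k := s k / Num.sqrt (1 - e * (s k ^+ 2 / t k ^+ 2 - 1)).
pose C := expR (- (e * L)) * expR ((1 + (2 * c)^-1) * S).
have C0 : 0 <= C by rewrite mulr_ge0 ?expR_ge0.
have mg (u : 'I_n -> R) : measurable_fun A (fun x : 'rV[R]_n => (gauss_pdf u x)%:E).
  by apply: measurable_funTS; apply/measurable_EFinP; exact: measurable_gauss_pdf.
have g0 (u : 'I_n -> R) : forall x : 'rV[R]_n, A x -> (0 <= (gauss_pdf u x)%:E)%E.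
  by move=> x _; rewrite lee_fin gauss_pdf_ge0.
apply: (@le_trans _ _ (\int[lebesgue_rV R n]_(x in A)
    ((expR L)%:E * (gauss_pdf t x)%:E + C%:E * (gauss_pdf kap x)%:E))%E).
  apply: ge0_le_integral => //.
  - exact: g0.
  - by apply: emeasurable_funD; apply: emeasurable_funM => //; exact: mg.
  - move=> x _; rewrite -!EFinM -EFinD lee_fin.
    exact: gauss_pdf_comparison sumS.
rewrite ge0_integralD//; last 4 first.
- by move=> x Ax; rewrite mule_ge0 ?lee_fin ?expR_ge0// gauss_pdf_ge0.
- by apply: emeasurable_funM => //; exact: mg.
- by move=> x Ax; rewrite mule_ge0 ?lee_fin// gauss_pdf_ge0.
- by apply: emeasurable_funM => //; exact: mg.
rewrite !ge0_integralZl//; try exact: mg; try exact: g0; try by rewrite lee_fin ?expR_ge0.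
apply: leeD => //.
rewrite -/(gauss_rV kap A) (_ : L / (2 * Q) = e * L); last by rewrite mulrC.
rewrite -[leRHS]mule1 lee_wpmul2l ?lee_fin// -(gauss_rV_setT kap).
by rewrite le_measure// inE.
Qed.

End normal_pdf_comparison.

(** * Simultaneous reduction of quadratic forms *)

Section quadratic_forms.
Context {R : realFieldType}.

Definition bform n (K : 'M[R]_n) (u v : 'rV[R]_n) : R := (u *m K *m v^T) 0 0.

Definition qform n (K : 'M[R]_n) (v : 'rV[R]_n) : R := bform K v v.

Lemma bformE n (K : 'M[R]_n) u v :
  bform K u v = \sum_i \sum_j u 0 i * v 0 j * K i j.
Proof.
rewrite /bform mxE exchange_big/=; apply: eq_bigr => j _.
rewrite mxE mulr_suml; apply: eq_bigr => i _; rewrite !mxE; ring.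
Qed.

Lemma bformC n (K : 'M[R]_n) u v : K^T = K -> bform K u v = bform K v u.
Proof.
move=> Ks; rewrite /bform.
have -> : (u *m K *m v^T) 0 0 = (u *m K *m v^T)^T 0 0 by rewrite [in RHS]mxE.
by rewrite !trmx_mul trmxK Ks mulmxA.
Qed.

Lemma bformDl n (K : 'M[R]_n) u v w : bform K (u + v) w = bform K u w + bform K v w.
Proof. by rewrite /bform !mulmxDl [LHS]mxE. Qed.

Lemma bformZl n (K : 'M[R]_n) a u w : bform K (a *: u) w = a * bform K u w.
Proof. by rewrite /bform -!scalemxAl [LHS]mxE. Qed.

Lemma bformDr n (K : 'M[R]_n) u v w : bform K w (u + v) = bform K w u + bform K w v.
Proof. by rewrite /bform linearD/= mulmxDr [LHS]mxE. Qed.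

Lemma bformZr n (K : 'M[R]_n) a u w : bform K w (a *: u) = a * bform K w u.
Proof. by rewrite /bform linearZ/= -scalemxAr [LHS]mxE. Qed.

Lemma bform_delta n (K : 'M[R]_n) v j : bform K v (delta_mx 0 j) = (v *m K) 0 j.
Proof.
rewrite /bform [LHS]mxE (bigD1 j)//= big1 ?addr0.
  by rewrite [X in _ * X]mxE [X in _ * X]mxE !eqxx mulr1.
by move=> k kj; rewrite [X in _ * X]mxE [X in _ * X]mxE (negbTE kj) mulr0.
Qed.

Lemma bform_mul m n (K : 'M[R]_n) (W : 'M[R]_(m, n)) u v :
  bform (W *m K *m W^T) u v = bform K (u *m W) (v *m W).
Proof. by rewrite /bform trmx_mul !mulmxA. Qed.

(** For a basis vector [e], [qform K (t *: v + e)] is affine in [t] with slope [2 * bform K v e];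
    since it is nonnegative for all [t], the slope is 0. *)
Lemma qform_null n (K : 'M[R]_n) (v : 'rV[R]_n) : K^T = K ->
  (forall u, 0 <= qform K u) -> qform K v = 0 -> v *m K = 0.
Proof.
move=> Ks K0 v0; apply/rowP => j; rewrite [RHS]mxE -bform_delta.
pose e : 'rV[R]_n := delta_mx 0 j; rewrite -/e.
set b := bform K v e.
have h t : 0 <= 2 * t * b + qform K e.
  have := K0 (t *: v + e); rewrite /qform !bformDl !bformZl !bformDr !bformZr.
  by rewrite -/(qform K v) -/(qform K e) v0 (bformC e v Ks) -/b; lra.
have [//|b0] := eqVneq b 0.
have := h (- (qform K e + 1) / (2 * b)).
have -> : 2 * (- (qform K e + 1) / (2 * b)) * b = - (qform K e + 1) by field.
lra.
Qed.

End quadratic_forms.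

(** * Simultaneous diagonalization of two symmetric forms *)

Section generalized_eigenvector.
Context {R : realType}.
Local Notation C := R[i].

Let ReD (x y : C) : complex.Re (x + y) = complex.Re x + complex.Re y.
Proof. by case: x y => [a b] [c d]. Qed.

Let ImD (x y : C) : complex.Im (x + y) = complex.Im x + complex.Im y.
Proof. by case: x y => [a b] [c d]. Qed.

Let Re_mulmx n (w : 'rV[C]_n) (K : 'M[R]_n) :
  map_mx (@complex.Re R) (w *m map_mx (real_complex R) K) = map_mx (@complex.Re R) w *m K.
Proof.
apply/rowP => i; rewrite !mxE (big_morph _ ReD erefl); apply: eq_bigr => j _.
by rewrite !mxE; case: (w 0 j) => a b /=; rewrite mulr0 subr0.
Qed.

Let Im_mulmx n (w : 'rV[C]_n) (K : 'M[R]_n) :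
  map_mx (@complex.Im R) (w *m map_mx (real_complex R) K) = map_mx (@complex.Im R) w *m K.
Proof.
apply/rowP => i; rewrite !mxE (big_morph _ ImD erefl); apply: eq_bigr => j _.
by rewrite !mxE; case: (w 0 j) => a b /=; rewrite mulr0 add0r mulrC.
Qed.

(** A complex eigenvector [x + iy] of [K1 *m invmx K0] exists, with eigenvalue [al + i be].
    Computing [bform K1 x y] in both orders gives [be * (qform K0 x + qform K0 y) = 0], so [be = 0]
    and either nonzero part serves. *)
Lemma generalized_eigenvector n (K0 K1 : 'M[R]_n.+1) : K0^T = K0 -> K1^T = K1 ->
  (forall v, v != 0 -> 0 < qform K0 v) ->
  exists a : R, exists2 v : 'rV[R]_n.+1, v *m K1 = a *: (v *m K0) & v != 0.
Proof.
move=> K0s K1s K0pos.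
have K0_ge0 v : 0 <= qform K0 v.
  have [->|/K0pos/ltW//] := eqVneq v 0.
  by rewrite /qform /bform !mul0mx mxE.
have K0u : K0 \in unitmx.
  rewrite -row_free_unit -kermx_eq0; apply/eqP/row_matrixP => i; rewrite row0.
  apply/eqP; apply: contraT => /K0pos.
  by rewrite /qform /bform -row_mul mulmx_ker row0 mul0mx mxE ltxx.
have [c /eigenvalueP[w wM w0]] := @eigenvalue_closed (R[i]) n.+1 (map_mx (real_complex R) (K1 *m invmx K0)) isT.
pose x := map_mx (@complex.Re R) w; pose y := map_mx (@complex.Im R) w.
pose al := complex.Re c; pose be := complex.Im c.
have ex : x *m (K1 *m invmx K0) = al *: x - be *: y.
  rewrite -Re_mulmx wM; apply/rowP => i; rewrite !mxE.
  by rewrite /al /be; case: c {wM al be} => a b; case: (w 0 i) => u v.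
have ey : y *m (K1 *m invmx K0) = be *: x + al *: y.
  rewrite -Im_mulmx wM; apply/rowP => i; rewrite !mxE.
  rewrite /al /be; case: c {wM al be ex} => a b; case: (w 0 i) => u v /=.
  by rewrite addrC.
have {}ex : x *m K1 = al *: (x *m K0) - be *: (y *m K0).
  by rewrite -(mulmxKV K0u K1) mulmxA ex mulmxDl mulNmx -!scalemxAl.
have {}ey : y *m K1 = be *: (x *m K0) + al *: (y *m K0).
  by rewrite -(mulmxKV K0u K1) mulmxA ey mulmxDl -!scalemxAl.
have be0 : be * (qform K0 x + qform K0 y) = 0.
  have bx z : bform K1 x z = al * bform K0 x z - be * bform K0 y z.
    by rewrite /bform ex mulmxBl -!scalemxAl !mxE.
  have by_ z : bform K1 y z = be * bform K0 x z + al * bform K0 y z.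
    by rewrite /bform ey mulmxDl -!scalemxAl !mxE.
  have := bformC x y K1s; rewrite bx by_ (bformC y x K0s) /qform; lra.
have xy0 : (x != 0) || (y != 0).
  rewrite -negb_and; apply: contra w0 => /andP[/eqP x0 /eqP y0].
  apply/eqP/rowP => i; rewrite [RHS]mxE.
  move/rowP/(_ i): x0; move/rowP/(_ i): y0; rewrite !mxE.
  by case: (w 0 i) => a b /= -> ->.
have pos : 0 < qform K0 x + qform K0 y.
  by case/orP: xy0 => /K0pos h; [apply: ltr_wpDr|apply: ltr_wpDl].
have be_0 : be = 0 by move/eqP: be0; rewrite mulf_eq0 (gt_eqF pos) orbF => /eqP.
exists al; case/orP: xy0 => n0; [exists x|exists y] => //.
- by rewrite ex be_0 scale0r subr0.
- by rewrite ey be_0 scale0r add0r.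
Qed.

(** Induction on the dimension: a generalized eigenvector is normalised for [K0], and both forms are
    restricted to its orthogonal complement. *)
Lemma simultaneous_diagonalization n (K0 K1 : 'M[R]_n) : K0^T = K0 -> K1^T = K1 ->
  (forall v, v != 0 -> 0 < qform K0 v) ->
  exists A : 'M[R]_n, A *m K0 *m A^T = 1%:M /\
    exists q : 'I_n -> R, A *m K1 *m A^T = diag_mx (\row_k q k).
Proof.
elim: n K0 K1 => [|n IH] K0 K1 K0s K1s K0pos.
  exists 0; split; first by apply/matrixP => -[].
  by exists (fun=> 0); apply/matrixP => -[].
have [a [v va v0]] := generalized_eigenvector K0s K1s K0pos.
pose s := (Num.sqrt (qform K0 v))^-1.
have qv := K0pos _ v0.
pose e : 'M[R]_(1, n.+1) := s *: v.
have ee : e *m K0 *m e^T = 1%:M.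
  apply/matrixP => i j; rewrite !ord1 [RHS]mxE eqxx -[LHS]/(bform K0 e e).
  rewrite /e bformZl bformZr -/(qform K0 v) /s mulrA -invfM -expr2 sqr_sqrtr ?ltW//.
  by rewrite mulVf// gt_eqF.
have ea : e *m K1 = a *: (e *m K0).
  by rewrite /e -!scalemxAl va scalerA mulrC -scalerA.
(* The kernel of [c] is the [K0]-orthogonal complement of [e]. It is also [K1]-orthogonal to [e],
   because [e *m K1] is a multiple of [e *m K0]. *)
pose c := K0 *m e^T.
have rk : (\rank (kermx c) = n)%N.
  rewrite mxrank_ker (_ : \rank c = 1%N) ?subn1//.
  apply/eqP; rewrite eqn_leq rank_leq_col lt0n mxrank_eq0.
  apply/eqP => c0; move: ee; rewrite -mulmxA -/c c0 mulmx0 => /matrixP/(_ 0 0).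
  by rewrite !mxE eqxx => /eqP; rewrite eq_sym oner_eq0.
have : exists2 W : 'M[R]_(\rank (kermx c), n.+1), W *m c = 0 & row_free W.
  exists (row_base (kermx c)); last exact: row_base_free.
  by apply/sub_kermxP; rewrite eq_row_base.
rewrite rk => -[W Wc Wfree].
have WK0pos (u : 'rV[R]_n) : u != 0 -> 0 < qform (W *m K0 *m W^T) u.
  move=> u0; rewrite /qform bform_mul; apply: K0pos.
  by apply: contra u0 => /eqP h; rewrite -(mulmx_free_eq0 _ Wfree) h.
have Ws (K : 'M[R]_n.+1) : K^T = K -> (W *m K *m W^T)^T = W *m K *m W^T.
  by move=> Ks; rewrite !trmx_mul trmxK Ks mulmxA.
have [A' [A'0 [q A'1]]] := IH _ _ (Ws _ K0s) (Ws _ K1s) WK0pos.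
pose A : 'M[R]_(1 + n, n.+1) := col_mx e (A' *m W).
have eW : e *m K0 *m W^T = 0.
  by apply: trmx_inj; rewrite !trmx_mul trmxK K0s -/c Wc trmx0.
have We : W *m K0 *m e^T = 0 by rewrite -mulmxA -/c.
have eW1 : e *m K1 *m W^T = 0 by rewrite ea -scalemxAl eW scaler0.
have We1 : W *m K1 *m e^T = 0.
  by apply: trmx_inj; rewrite !trmx_mul trmxK K1s mulmxA eW1 trmx0.
have blk (K : 'M[R]_n.+1) : A *m K *m A^T =
    block_mx (e *m K *m e^T) (e *m K *m W^T *m A'^T)
      (A' *m (W *m K *m e^T)) (A' *m (W *m K *m W^T) *m A'^T).
  by rewrite /A mul_col_mx tr_col_mx mul_col_row trmx_mul !mulmxA.
exists A; split.
  by rewrite blk ee eW We mul0mx mulmx0 A'0 -scalar_mx_block.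
exists (fun k : 'I_(1 + n) => match fintype.split k with inl _ => a | inr j => q j end).
rewrite blk eW1 We1 mul0mx mulmx0 A'1.
have -> : e *m K1 *m e^T = a%:M by rewrite ea -scalemxAl ee scalemx1.
rewrite (_ : \row_k _ = row_mx (\row_(k < 1) a) (\row_k q k)).
  apply: etrans (esym (@diag_mx_row _ n 1 (\row_(k < 1) a) (\row_k q k))).
  by congr block_mx; apply/matrixP => i j; rewrite !mxE !ord1 eqxx.
apply/rowP => k; rewrite !mxE; case: fintype.split => j; by rewrite mxE.
Qed.

(* For a centered vector [X] of covariance [K0], the last condition says that
   [X = C *m (A *m X)] almost surely. *)
Lemma gauss_reduction n (K0 K1 : 'M[R]_n) : K0^T = K0 -> K1^T = K1 ->
  (forall v, 0 <= qform K0 v) ->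
  exists r, exists A : 'M[R]_(r, n), exists C : 'M[R]_(n, r), exists q : 'I_r -> R,
  [/\ A *m K0 *m A^T = 1%:M, A *m K1 *m A^T = diag_mx (\row_k q k) &
      (1%:M - C *m A) *m K0 = 0].
Proof.
move=> K0s K1s K0_ge0.
pose r := \rank K0; pose f := maxrankfun K0.
pose E : 'M[R]_(r, n) := rowsub f 1%:M.
have EK : E *m K0 = rowsub f K0 by rewrite /E mul_rowsub_mx mul1mx.
pose Kf := E *m K0 *m E^T.
have Kfs : Kf^T = Kf by rewrite /Kf !trmx_mul trmxK K0s mulmxA.
have Ef : row_free (E *m K0) by rewrite EK; exact: maxrowsub_free.
have Kfpos (u : 'rV[R]_r) : u != 0 -> 0 < qform Kf u.
  move=> u0; have e : qform Kf u = qform K0 (u *m E) by rewrite /qform bform_mul.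
  rewrite e lt_neqAle K0_ge0 andbT eq_sym; apply: contra u0 => /eqP h.
  by rewrite -(mulmx_free_eq0 _ Ef) mulmxA (qform_null K0s K0_ge0 h).
have K1fs : (E *m K1 *m E^T)^T = E *m K1 *m E^T by rewrite !trmx_mul trmxK K1s mulmxA.
have [A' [A'0 [q A'1]]] := simultaneous_diagonalization Kfs K1fs Kfpos.
have /submxP[D KD] : (K0 <= E *m K0)%MS by rewrite EK eq_maxrowsub.
have A'u : A' \in unitmx.
  have : A' *m (Kf *m A'^T) = 1%:M by rewrite mulmxA.
  by move=> /mulmx1_unit[].
exists r, (A' *m E), (D *m invmx A'), q; split.
- by rewrite trmx_mul -A'0 /Kf !mulmxA.
- by rewrite trmx_mul -A'1 !mulmxA.
- by rewrite mulmxA -(mulmxA D) mulVmx// mulmx1 mulmxBl mul1mx -mulmxA -KD subrr.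
Qed.

End generalized_eigenvector.

(** * Hilbert-Schmidt bound *)

Section hilbert_schmidt_bound.
Context d (T : measurableType d) (R : realType) (mu : {sigma_finite_measure set T -> \bar R}).
Variables (w : T -> R) (r : nat) (J : finType) (xi : 'I_r -> J -> T -> R)
  (C B : R) (beta : T * T -> R) (h : 'I_r -> T * T -> R).
Hypotheses (mw : measurable_fun setT w) (w0 : forall x, 0 <= w x)
  (mxi : forall k j, measurable_fun setT (xi k j))
  (mbeta : measurable_fun setT beta) (beta0 : forall z, 0 <= beta z)
  (C0 : 0 < C)
  (frame : forall (c : 'I_r -> R) j,
     (\int[mu]_x (w x * (\sum_k c k * xi k j x) ^+ 2)%:E <= (C * \sum_k c k ^+ 2)%:E)%E)
  (betaB : (\int[mu \x mu]_z (w z.1 * w z.2 * beta z ^+ 2)%:E <= B%:E)%E)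
  (ih : forall k, (mu \x mu)%E.-integrable setT (EFin \o h k))
  (hxi : forall (c : 'I_r -> R) z, `|\sum_k c k * h k z| <=
     \sum_j \sum_j' w z.1 * w z.2 * beta z * `|\sum_k c k * xi k j z.1 * xi k j' z.2|).

Let mw1 : measurable_fun setT (fun z : T * T => w z.1).
Proof. exact: (measurableT_comp mw measurable_fst). Qed.

Let mw2 : measurable_fun setT (fun z : T * T => w z.2).
Proof. exact: (measurableT_comp mw measurable_snd). Qed.

Let V (c : 'I_r -> R) j j' (z : T * T) := \sum_k c k * xi k j z.1 * xi k j' z.2.

Let mV c j j' : measurable_fun setT (V c j j').
Proof.
apply: measurable_sum => k; apply: measurable_funM.
  by apply: measurable_funM => //; exact: (measurableT_comp (mxi k j) measurable_fst).
exact: (measurableT_comp (mxi k j') measurable_snd).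
Qed.

Let msum (c : 'I_r -> R) j : measurable_fun setT (fun x => \sum_k c k * xi k j x).
Proof. by apply: measurable_sum => k; exact: measurable_funM. Qed.

(** The tensor products of the features inherit a Bessel bound with constant [C ^+ 2]: [frame] is
    applied in [x] with coefficients [c k * xi k j' y], and then in [y] to each feature alone. *)
Let V_bound (c : 'I_r -> R) j j' :
  (\int[mu \x mu]_z (w z.1 * w z.2 * V c j j' z ^+ 2)%:E <= (C ^+ 2 * \sum_k c k ^+ 2)%:E)%E.
Proof.
pose f (z : T * T) := (w z.1 * w z.2 * V c j j' z ^+ 2)%:E.
have mf : measurable_fun setT f.
  by apply/measurable_EFinP; apply: measurable_funM; [exact: measurable_funM|exact: measurable_funX].
have f0 z : (0 <= f z)%E by rewrite lee_fin mulr_ge0 ?sqr_ge0// mulr_ge0.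
rewrite -[leLHS]/(\int[mu \x mu]_z f z)%E (fubini_tonelli2 _ mf f0) /fubini_G /f /=.
have in1 y : (\int[mu]_x (w x * w y * V c j j' (x, y) ^+ 2)%:E <=
   (C * \sum_k c k ^+ 2 * (w y * xi k j' y ^+ 2))%:E)%E.
  have -> : (\int[mu]_x (w x * w y * V c j j' (x, y) ^+ 2)%:E =
     \int[mu]_x ((w y)%:E * (w x * (\sum_k (c k * xi k j' y) * xi k j x) ^+ 2)%:E))%E.
    apply: eq_integral => x _; rewrite -EFinM; congr EFin; rewrite /V /=.
    rewrite (eq_bigr (fun k => c k * xi k j' y * xi k j x)); last by move=> k _; ring.
    by ring.
  rewrite ge0_integralZl//; last 3 first.
  - apply/measurable_EFinP; apply: measurable_funM => //; apply: measurable_funX; exact: msum.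
  - by move=> x _; rewrite lee_fin mulr_ge0 ?sqr_ge0.
  - by rewrite lee_fin.
  apply: (@le_trans _ _ ((w y)%:E * (C * \sum_k (c k * xi k j' y) ^+ 2)%:E)%E).
    by rewrite lee_wpmul2l ?lee_fin// frame.
  rewrite -EFinM lee_fin mulrCA ler_pM2l// mulr_sumr ler_sum// => k _.
  by rewrite exprMn mulrCA.
have mk k : measurable_fun setT (fun y => c k ^+ 2 * (w y * xi k j' y ^+ 2)).
  by apply: measurable_funM => //; apply: measurable_funM => //; exact: measurable_funX.
apply: (@le_trans _ _ (\int[mu]_y (C * \sum_k c k ^+ 2 * (w y * xi k j' y ^+ 2))%:E)%E).
  apply: ge0_le_integral => //.
  - by move=> y _; apply: integral_ge0 => x _; exact: f0 (x, y).
  - exact: (@measurable_fun_fubini_tonelli_G _ _ _ _ _ mu f mf f0).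
  - by apply/measurable_EFinP; apply: measurable_funM => //; exact: measurable_sum.
under eq_integral do rewrite EFinM.
rewrite ge0_integralZl//; last 3 first.
- by apply/measurable_EFinP; exact: measurable_sum.
- by move=> y _; rewrite lee_fin sumr_ge0// => k _; rewrite mulr_ge0 ?sqr_ge0// mulr_ge0 ?sqr_ge0.
- by rewrite lee_fin ltW.
under eq_integral do rewrite -sumEFin.
rewrite ge0_integral_sum//; last 2 first.
- by move=> k; apply/measurable_EFinP; exact: mk.
- by move=> k y _; rewrite lee_fin mulr_ge0 ?sqr_ge0// mulr_ge0 ?sqr_ge0.
rewrite expr2 -mulrA EFinM lee_wpmul2l ?lee_fin ?(ltW C0)// mulr_sumr -sumEFin.
apply: lee_sum => k _.
under eq_integral do rewrite EFinM.
rewrite ge0_integralZl//; last 3 first.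
- by apply/measurable_EFinP; apply: measurable_funM => //; exact: measurable_funX.
- by move=> y _; rewrite lee_fin mulr_ge0 ?sqr_ge0.
- by rewrite lee_fin sqr_ge0.
rewrite (_ : (C * c k ^+ 2)%:E = ((c k ^+ 2)%:E * C%:E)%E); last by rewrite -EFinM mulrC.
rewrite lee_wpmul2l ?lee_fin ?sqr_ge0//.
have := frame (fun k' => if k' == k then 1 else 0) j'.
have e1 : \sum_(k' < r) (if k' == k then 1 else 0 : R) ^+ 2 = 1.
  rewrite (bigD1 k)//= eqxx expr1n big1 ?addr0// => k' /negbTE ->.
  by rewrite expr0n.
rewrite e1 mulr1.
congr (_ <= _)%E; apply: eq_integral => y _; congr (_ * _ ^+ 2)%:E.
rewrite (bigD1 k)//= eqxx mul1r big1 ?addr0// => k' /negbTE ->.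
by rewrite mul0r.
Qed.

(* Test the functions [h k] against the coefficients [s k := \int h k] themselves
   and apply Cauchy-Schwarz, in the form of AM-GM with a free parameter [e]. *)
Lemma hilbert_schmidt_bound :
  \sum_k (\int[(mu \x mu)%E]_z h k z) ^+ 2 <= #|J|%:R ^+ 4 * C ^+ 2 * B.
Proof.
pose s k := \int[(mu \x mu)%E]_z h k z.
pose S := \sum_k s k ^+ 2.
rewrite -/S.
have B0 : 0 <= B.
  rewrite -lee_fin; apply: le_trans betaB; apply: integral_ge0 => z _.
  by rewrite lee_fin mulr_ge0 ?sqr_ge0// mulr_ge0.
have S0 : 0 <= S by apply: sumr_ge0 => k _; exact: sqr_ge0.
have mk c : measurable_fun setT (fun z => \sum_k c k * h k z).
  apply: measurable_sum => k; apply: measurable_funM => //.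
  by have /integrableP[/measurable_EFinP] := ih k.
(* Pointwise, [|V| * beta] is at most [e * V ^+ 2 + beta ^+ 2 / (4 * e)]. After integration
   [V_bound] returns [S] itself on the right, once for each of the [#|J| ^ 2] pairs. *)
have HS (e : R) : 0 < e -> S <= #|J|%:R ^+ 2 * (e * (C ^+ 2 * S) + (4 * e)^-1 * B).
  move=> e0.
  pose U j j' z := e * (w z.1 * w z.2 * V s j j' z ^+ 2) + (4 * e)^-1 * (w z.1 * w z.2 * beta z ^+ 2).
  have mq1 j j' : measurable_fun setT (fun z => w z.1 * w z.2 * V s j j' z ^+ 2).
    by apply: measurable_funM; [exact: measurable_funM|exact: measurable_funX].
  have mq2 : measurable_fun setT (fun z => w z.1 * w z.2 * beta z ^+ 2).
    by apply: measurable_funM; [exact: measurable_funM|exact: measurable_funX].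
  have q1 j j' z : 0 <= w z.1 * w z.2 * V s j j' z ^+ 2 by rewrite mulr_ge0 ?sqr_ge0// mulr_ge0.
  have q2 z : 0 <= w z.1 * w z.2 * beta z ^+ 2 by rewrite mulr_ge0 ?sqr_ge0// mulr_ge0.
  have e4 : 0 <= (4 * e)^-1 by rewrite invr_ge0 mulr_ge0// ltW.
  have mU j j' : measurable_fun setT (U j j').
    by apply: measurable_funD; exact: measurable_funM.
  have U0 j j' z : 0 <= U j j' z by rewrite addr_ge0// mulr_ge0// ltW.
  have UI j j' : (\int[mu \x mu]_z (U j j' z)%:E <= (e * (C ^+ 2 * S) + (4 * e)^-1 * B)%:E)%E.
    under eq_integral do rewrite EFinD !(EFinM e) !(EFinM (4 * e)^-1).
    rewrite ge0_integralD//; last 4 first.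
    - by move=> z _; rewrite -EFinM lee_fin mulr_ge0// ltW.
    - by under eq_fun do rewrite -EFinM; apply/measurable_EFinP; exact: measurable_funM.
    - by move=> z _; rewrite -EFinM lee_fin mulr_ge0.
    - by under eq_fun do rewrite -EFinM; apply/measurable_EFinP; exact: measurable_funM.
    rewrite ge0_integralZl//; last 3 first.
    - exact/measurable_EFinP.
    - by move=> z _; rewrite lee_fin.
    - by rewrite lee_fin ltW.
    rewrite ge0_integralZl//; last 2 first.
    - exact/measurable_EFinP.
    - by move=> z _; rewrite lee_fin.
    rewrite EFinD !(EFinM e) !(EFinM (4 * e)^-1) leeD// lee_wpmul2l ?lee_fin ?(ltW e0)//.
  have : (S%:E <= \int[mu \x mu]_z (\sum_j \sum_j' U j j' z)%:E)%E.
    have SE : S = \int[(mu \x mu)%E]_z (\sum_k s k * h k z).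
      rewrite Rintegral_sum; last by move=> k; exact: integrableMl_cst.
      by apply: eq_bigr => k _; rewrite RintegralZl.
    have iS : (mu \x mu)%E.-integrable setT (EFin \o (fun z => \sum_k s k * h k z)).
      by apply: integrable_Rsum => k; exact: integrableMl_cst.
    rewrite SE /Rintegral fineK; last exact: integrable_fin_num.
    apply: (le_trans (lee_abs _)).
    apply: (le_trans (le_abse_integral _ measurableT _)); first by apply/measurable_EFinP; exact: mk.
    apply: ge0_le_integral => //.
    - by apply/measurable_EFinP; apply: measurableT_comp => //; exact: mk.
    - by apply/measurable_EFinP; apply: measurable_sum => j; exact: measurable_sum.
    move=> z _ /=; rewrite lee_fin (le_trans (hxi s z))//.
    apply: ler_sum => j _; apply: ler_sum => j' _; rewrite -/(V s j j' z) /U.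
    have ww : 0 <= w z.1 * w z.2 by rewrite mulr_ge0.
    have -> : e * (w z.1 * w z.2 * V s j j' z ^+ 2) + (4 * e)^-1 * (w z.1 * w z.2 * beta z ^+ 2) =
       w z.1 * w z.2 * (e * V s j j' z ^+ 2 + (4 * e)^-1 * beta z ^+ 2) by ring.
    rewrite -mulrA ler_wpM2l// -(real_normK (num_real (V s j j' z))).
    rewrite -subr_ge0 (_ : _ - _ = e * (`|V s j j' z| - (2 * e)^-1 * beta z) ^+ 2).
      by rewrite mulr_ge0 ?sqr_ge0// ltW.
    by field; rewrite gt_eqF.
  move=> /le_trans; rewrite -lee_fin; apply.
  under eq_integral do rewrite -sumEFin.
  rewrite ge0_integral_sum//; last 2 first.
  - by move=> j; apply/measurable_EFinP; exact: measurable_sum.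
  - by move=> j z _; rewrite lee_fin sumr_ge0.
  apply: (@le_trans _ _ (\sum_(j : J) \sum_(j' : J) (e * (C ^+ 2 * S) + (4 * e)^-1 * B)%:E)%E).
    apply: lee_sum => j _.
    under eq_integral do rewrite -sumEFin.
    rewrite ge0_integral_sum//; last 2 first.
    - by move=> j'; apply/measurable_EFinP.
    - by move=> j' z _; rewrite lee_fin.
    by apply: lee_sum => j' _.
  under eq_bigr do rewrite sumEFin.
  rewrite sumEFin lee_fin.
  have cst (K : R) : \sum_(j : J) K = #|J|%:R * K by rewrite sumr_const mulr_natl.
  by rewrite !cst mulrA -expr2.
have [J0|J0] := posnP #|J|.
  have := HS 1 ltr01; rewrite J0 !expr0n !mul0r => SN.
  by [].
have J1 : 0 < #|J|%:R :> R by rewrite ltr0n.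
(* For this [e] the coefficient of [S] on the right is one half, so that [S] can be absorbed. *)
have e0 : 0 < (2 * #|J|%:R ^+ 2 * C ^+ 2)^-1.
  by rewrite invr_gt0 !mulr_gt0// exprn_gt0.
have := HS _ e0.
have -> : #|J|%:R ^+ 2 * ((2 * #|J|%:R ^+ 2 * C ^+ 2)^-1 * (C ^+ 2 * S) +
   (4 * (2 * #|J|%:R ^+ 2 * C ^+ 2)^-1)^-1 * B) = S / 2 + #|J|%:R ^+ 4 * C ^+ 2 * B / 2.
  by field; rewrite !gt_eqF.
lra.
Qed.

End hilbert_schmidt_bound.

(** * Spectral densities *)

Section hermitian_forms.
Context {R : realType}.
Local Notation C := R[i].
Local Open Scope complex_scope.
Local Open Scope sesquilinear_scope.

Lemma cReD (x y : C) : complex.Re (x + y) = complex.Re x + complex.Re y.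
Proof. by case: x y => [a b] [c d]. Qed.

Lemma cImD (x y : C) : complex.Im (x + y) = complex.Im x + complex.Im y.
Proof. by case: x y => [a b] [c d]. Qed.

Lemma cReM (x y : C) : complex.Re (x * y) =
  complex.Re x * complex.Re y - complex.Im x * complex.Im y.
Proof. by case: x y => [a b] [c d]. Qed.

Lemma cImM (x y : C) : complex.Im (x * y) =
  complex.Re x * complex.Im y + complex.Im x * complex.Re y.
Proof. by case: x y => [a b] [c d]. Qed.

Lemma cReJ (x : C) : complex.Re (Num.conj x) = complex.Re x.
Proof. by case: x. Qed.

Lemma cRe_sum (I : Type) (r : seq I) (P : pred I) (F : I -> C) :
  complex.Re (\sum_(i <- r | P i) F i) = \sum_(i <- r | P i) complex.Re (F i).
Proof. exact: (big_morph _ cReD erefl). Qed.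

Lemma cIm_sum (I : Type) (r : seq I) (P : pred I) (F : I -> C) :
  complex.Im (\sum_(i <- r | P i) F i) = \sum_(i <- r | P i) complex.Im (F i).
Proof. exact: (big_morph _ cImD erefl). Qed.

Lemma Re_le_cabs (x : C) : `|complex.Re x| <= cabs x.
Proof.
case: x => x y; rewrite /cabs /= -sqrtr_sqr ler_wsqrtr// lerDl.
exact: sqr_ge0.
Qed.

Lemma Im_le_cabs (x : C) : `|complex.Im x| <= cabs x.
Proof.
case: x => x y; rewrite /cabs /= -sqrtr_sqr ler_wsqrtr// lerDr.
exact: sqr_ge0.
Qed.

Lemma cabs_le (x : C) : cabs x <= `|complex.Re x| + `|complex.Im x|.
Proof.
case: x => x y; rewrite /cabs /= -(ger0_norm (addr_ge0 (normr_ge0 x) (normr_ge0 y))).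
rewrite -sqrtr_sqr ler_wsqrtr//.
rewrite -(real_normK (num_real x)) -(real_normK (num_real y)).
have := normr_ge0 x; have := normr_ge0 y; nra.
Qed.

Lemma cabs_ge0 (x : C) : 0 <= cabs x.
Proof. exact: le_trans (Re_le_cabs x). Qed.

Lemma cabsM (x y : C) : cabs (x * y) = cabs x * cabs y.
Proof. exact: ComplexField.Normc.normcM. Qed.

Lemma cabs_sum (I : Type) (r : seq I) (F : I -> C) :
  cabs (\sum_(i <- r) F i) <= \sum_(i <- r) cabs (F i).
Proof.
elim: r => [|i r IH]; first by rewrite !big_nil /cabs ComplexField.Normc.normc0.
rewrite !big_cons; apply: le_trans (lerD (lexx _) IH).
exact: le_normcD.
Qed.

Section forms.
Variable p : nat.
Implicit Types (F N M : 'M[C]_p) (u v : 'cV[C]_p).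

Definition hform F u v : C := (u^t* *m F *m v) 0 0.
Definition hquad F v : R := complex.Re (hform F v v).
Definition sqnorm v : R := \sum_i (complex.Re (v i 0) ^+ 2 + complex.Im (v i 0) ^+ 2).
Definition retrace F : R := \sum_i complex.Re (F i i).

Lemma hformE F u v : hform F u v = \sum_i \sum_j Num.conj (u i 0) * F i j * v j 0.
Proof.
rewrite /hform mxE exchange_big/=; apply: eq_bigr => j _.
by rewrite mxE mulr_suml; apply: eq_bigr => i _; rewrite !mxE.
Qed.

Lemma hquad_le N M v : loewner_le N M -> hquad N v <= hquad M v.
Proof. by move=> /(_ v); rewrite lecE => /andP[]. Qed.

Lemma hquad_scalar (a : R) v : hquad a%:C%:M v = a * sqnorm v.
Proof.
rewrite /hquad hformE cRe_sum /sqnorm mulr_sumr; apply: eq_bigr => i _.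
rewrite (bigD1 i)//= big1 ?addr0.
  rewrite mxE eqxx mulr1n; case: (v i 0) => x y /=.
  by ring.
by move=> j ji; rewrite mxE eq_sym (negbTE ji) mulr0n mulr0 mul0r.
Qed.

Lemma hquad0 v : hquad 0 v = 0.
Proof. by rewrite /hquad /hform mulmx0 mul0mx mxE. Qed.

Lemma hquad_delta2 F i j (s : C) :
  hquad F (delta_mx i 0 + s *: delta_mx j 0) =
  complex.Re (F i i) + complex.Re (Num.conj s * s * F j j) +
  (complex.Re (s * F i j) + complex.Re (Num.conj s * F j i)).
Proof.
have fDl u u' v : hform F (u + u') v = hform F u v + hform F u' v.
  by rewrite /hform linearD/= map_mxD !mulmxDl [LHS]mxE.
have fDr u v v' : hform F u (v + v') = hform F u v + hform F u v'.
  by rewrite /hform mulmxDr [LHS]mxE.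
have fZl a u v : hform F (a *: u) v = Num.conj a * hform F u v.
  by rewrite /hform linearZ/= map_mxZ -!scalemxAl [LHS]mxE.
have fZr a u v : hform F u (a *: v) = a * hform F u v.
  by rewrite /hform -scalemxAr [LHS]mxE.
have fd k l : hform F (delta_mx k 0) (delta_mx l 0) = F k l.
  rewrite hformE (bigD1 k)//= [X in _ + X]big1 ?addr0.
    rewrite (bigD1 l)//= [X in _ + X]big1 ?addr0.
      by rewrite !mxE !eqxx rmorph1 mul1r mulr1.
    by move=> m ml; rewrite !mxE (negbTE ml) mulr0.
  move=> m mk; rewrite big1// => m' _; rewrite !mxE (negbTE mk) rmorph0.
  by rewrite !mul0r.
rewrite /hquad fDl !fDr !fZl !fZr !fd mulrA !cReD; ring.
Qed.

Section bounds.
Variable F : 'M[C]_p.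
Hypotheses (Fherm : F \is hermsymmx) (F0 : loewner_le 0 F).

Lemma hermitian_conj i j : F j i = Num.conj (F i j).
Proof.
move: Fherm => /is_hermitianmxP/matrixP/(_ j i) ->.
by rewrite expr0 scale1r !mxE.
Qed.

Lemma hermitian_diag_ge0 i : 0 <= complex.Re (F i i).
Proof.
have := hquad_le (delta_mx i 0 + 0 *: delta_mx i 0) F0; rewrite hquad0 hquad_delta2.
by rewrite mulr0 !mul0r rmorph0 !mul0r/= !addr0.
Qed.

Lemma retrace_ge0 : 0 <= retrace F.
Proof. by apply: sumr_ge0 => i _; exact: hermitian_diag_ge0. Qed.

Lemma diag_le_retrace i : complex.Re (F i i) <= retrace F.
Proof.
rewrite /retrace (bigD1 i)//= ler_wpDr// sumr_ge0// => j _.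
exact: hermitian_diag_ge0.
Qed.

(** Positivity is tested on the sum of the [i]-th basis vector and [s] times the [j]-th. The values
    1, -1, i and -i of [s] then bound both parts of an entry by the trace. *)
Lemma hermitian_entry_bound i j (s : C) : Num.conj s * s = 1 ->
  - retrace F <= complex.Re (s * F i j).
Proof.
move=> s1; have := hquad_le (delta_mx i 0 + s *: delta_mx j 0) F0.
rewrite hquad0 hquad_delta2 s1 mul1r (hermitian_conj i j) -rmorphM cReJ.
by have := diag_le_retrace i; have := diag_le_retrace j; lra.
Qed.

Lemma hermitian_entry_le i j : `|complex.Re (F i j)| <= retrace F /\
  `|complex.Im (F i j)| <= retrace F.
Proof.
have h := @hermitian_entry_bound i j.
rewrite !ler_norml; split; apply/andP; split.
- by have := h 1; rewrite mul1r; apply; rewrite rmorph1 mulr1.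
- have : - retrace F <= complex.Re (-1 * F i j) by apply: h; rewrite rmorphN1 mulrNN mulr1.
  by rewrite mulN1r; case: (F i j) => x y /=; lra.
- have : - retrace F <= complex.Re ((0 -i* 1) * F i j) by apply: h; apply/eqP; rewrite eq_complex /=; apply/andP; split; apply/eqP; ring.
  by case: (F i j) => x y /=; lra.
- have : - retrace F <= complex.Re ((0 +i* 1) * F i j) by apply: h; apply/eqP; rewrite eq_complex /=; apply/andP; split; apply/eqP; ring.
  by case: (F i j) => x y /=; lra.
Qed.

Lemma hermitian_cabs_le i j : cabs (F i j) <= 2 * retrace F.
Proof.
have [hx hy] := hermitian_entry_le i j.
by apply: (le_trans (cabs_le _)); lra.
Qed.

End bounds.

Section scalar_bounds.
Variables (a : R) (F : 'M[C]_p).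

Lemma retrace_le_scalar : loewner_le F a%:C%:M -> retrace F <= p%:R * a.
Proof.
move=> aF; rewrite mulr_natl -[X in _ *+ X](card_ord p) -sumr_const.
apply: ler_sum => i _.
have := hquad_le (delta_mx i 0 + 0 *: delta_mx i 0) aF; rewrite !hquad_delta2.
by rewrite mulr0 !mul0r rmorph0 !mul0r/= !addr0 mxE eqxx.
Qed.

(** A supremum bounds its elements only when the set is bounded above. Squares of singular values
    are roots of one characteristic polynomial, and [s <= 1 + s ^+ 2]. *)
Lemma has_ubound_singular_value (N : 'M[C]_p) : has_ubound (singular_value N).
Proof.
have [rs rsE] := closed_field_poly_normal (char_poly (N^t* *m N)).
exists (1 + \sum_(z <- rs) `|complex.Re z|) => s [s0].
rewrite eigenvalue_root_char rsE rootZ; last by rewrite (monicP (char_poly_monic _)) oner_neq0.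
rewrite root_prod_XsubC => srs.
rewrite (@le_trans _ _ (1 + s ^+ 2))//; first by nra.
rewrite lerD2l (big_rem _ srs)/= ler_wpDr ?sumr_ge0//.
exact: ler_norm.
Qed.

(** Testing the inequality on an eigenvector shows that its eigenvalue is real and at least [a]; as
    [F] is Hermitian, this eigenvalue is also a singular value. *)
Lemma opnorm_ge_scalar : (0 < p)%N -> 0 <= a -> F \is hermsymmx ->
  loewner_le a%:C%:M F -> a <= opnorm F.
Proof.
move=> p0 a0 Fh aF.
have [c /eigenvalueP[v vF v0]] := eigenvalue_closed F p0.
pose u : 'cV[C]_p := v^t*.
have uv : u^t* = v by apply/rowP => k; rewrite !mxE; exact: conjCK.
have hu N : hform N u u = (v *m N *m u) 0 0 by rewrite /hform uv.
pose q := sqnorm u.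
have vu : (v *m u) 0 0 = q%:C.
  rewrite mxE /q /sqnorm raddf_sum; apply: eq_bigr => i _.
  rewrite !mxE; apply/eqP; rewrite eq_complex; case: (v 0 i) => x y /=.
  by apply/andP; split; apply/eqP; ring.
have q0 : 0 < q.
  rewrite lt_neqAle sumr_ge0; last by move=> i _; rewrite addr_ge0 ?sqr_ge0.
  rewrite andbT eq_sym; apply: contra v0.
  rewrite /q /sqnorm psumr_eq0; last by move=> i _; rewrite addr_ge0 ?sqr_ge0.
  move=> /allP h; apply/eqP/rowP => i; have := h i (mem_index_enum _).
  rewrite !mxE; case: (v 0 i) => x y /=; rewrite paddr_eq0 ?sqr_ge0//.
  by rewrite !sqrf_eq0 oppr_eq0 => /andP[/eqP -> /eqP ->].
have := aF u; rewrite -/(hform _ u u) -/(hform F u u).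
have -> : hform F u u = c * q%:C by rewrite hu vF -scalemxAl mxE vu.
have -> : hform a%:C%:M u u = (a * q)%:C.
  by rewrite hu mul_mx_scalar -scalemxAl mxE vu rmorphM.
case: c vF => b b' vF; rewrite lecE /= !mulr0 add0r subr0 => /andP[/eqP bq aq].
have b'0 : b' = 0 by apply/eqP; move/eqP: bq; rewrite mulf_eq0 (gt_eqF q0) orbF.
rewrite b'0 in vF.
have ab : a <= b by rewrite -(ler_pM2r q0).
apply: (le_trans ab); apply: ub_le_sup; first exact: has_ubound_singular_value.
split; first exact: le_trans ab.
apply/eigenvalueP; exists v => //.
have -> : F^t* = F.
  by apply/matrixP => i j; rewrite !mxE (hermitian_conj Fh i j) conjCK.
by rewrite mulmxA vF -scalemxAl vF scalerA expr2 rmorphM.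
Qed.

End scalar_bounds.
End forms.
End hermitian_forms.

Section complex_measurability.
Context d (T : measurableType d) (R : realType).
Implicit Types f g : T -> R[i].

Lemma cmeasurableM f g : cmeasurable f -> cmeasurable g -> cmeasurable (fun x => f x * g x).
Proof.
move=> [mf1 mf2] [mg1 mg2]; split.
  under eq_fun do rewrite cReM.
  by apply: measurable_funB; exact: measurable_funM.
under eq_fun do rewrite cImM.
by apply: measurable_funD; exact: measurable_funM.
Qed.

Lemma cmeasurable_sum (I : Type) (r : seq I) (f : I -> T -> R[i]) :
  (forall i, cmeasurable (f i)) -> cmeasurable (fun x => \sum_(i <- r) f i x).
Proof.
move=> mf; split.
  under eq_fun do rewrite cRe_sum.
  by apply: measurable_sum => i; case: (mf i).
under eq_fun do rewrite cIm_sum.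
by apply: measurable_sum => i; case: (mf i).
Qed.

Lemma cmeasurable_cis (g : T -> R) : measurable_fun setT g -> cmeasurable (fun x => cis (g x)).
Proof.
move=> mg; split; rewrite /cis /=; apply: measurableT_comp => //.
  exact: continuous_measurable_fun (@continuous_cos R).
exact: continuous_measurable_fun (@continuous_sin R).
Qed.

Lemma measurable_cabs f : cmeasurable f -> measurable_fun setT (fun x => cabs (f x)).
Proof.
move=> [mf1 mf2].
rewrite (_ : (fun x => _) = (fun x =>
  Num.sqrt (complex.Re (f x) ^+ 2 + complex.Im (f x) ^+ 2))); last first.
  by apply/funext => x; rewrite /cabs; case: (f x).
apply: measurableT_comp; first exact: continuous_measurable_fun (@sqrt_continuous R).
by apply: measurable_funD; exact: measurable_funX.
Qed.

Lemma cmeasurable_comp d' (T' : measurableType d') (u : T' -> T) f :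
  measurable_fun setT u -> cmeasurable f -> cmeasurable (fun x => f (u x)).
Proof.
move=> mu [mf1 mf2]; split.
  exact: (measurableT_comp mf1 mu).
exact: (measurableT_comp mf2 mu).
Qed.

Lemma cintegrable_cmeasurable (mu : {measure set T -> \bar R}) f :
  cintegrable mu f -> cmeasurable f.
Proof. by move=> [/integrableP[/measurable_EFinP ? _] /integrableP[/measurable_EFinP ? _]]. Qed.

End complex_measurability.

Section cis_lemmas.
Context {R : realType}.

Lemma cisD (x y : R) : cis (x + y) = cis x * cis y.
Proof.
apply/eqP; rewrite eq_complex cReM cImM /= sinD cosD !eqxx/=.
by apply/eqP; ring.
Qed.

Lemma cabs_cis (x : R) : cabs (cis x) = 1.
Proof. by rewrite /cabs /cis /= cos2Dsin2 sqrtr1. Qed.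

Lemma conj_cis (x : R) : Num.conj (cis x) = cis (- x).
Proof. by rewrite /cis cosN sinN. Qed.

Lemma dotvE d (x y : 'rV[R]_d) : dotv x y = \sum_k x 0 k * y 0 k.
Proof. by rewrite /dotv mxE; apply: eq_bigr => k _; rewrite mxE. Qed.

Lemma dotvC d (x y : 'rV[R]_d) : dotv x y = dotv y x.
Proof. by rewrite !dotvE; apply: eq_bigr => k _; rewrite mulrC. Qed.

Lemma dotvBl d (x y z : 'rV[R]_d) : dotv (x - y) z = dotv x z - dotv y z.
Proof. by rewrite /dotv mulmxBl mxE [X in _ + X]mxE. Qed.

Lemma measurable_dotv d (x : 'rV[R]_d) : measurable_fun setT (fun l : 'rV[R]_d => dotv x l).
Proof.
under eq_fun do rewrite dotvE.
by apply: measurable_sum => k; apply: measurable_funM => //; exact: measurable_coord.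
Qed.

End cis_lemmas.

(** * Variances of finite samples in the spectral domain *)

Section spectral_quadratic_form.
Context {R : realType} (d p : nat).
Local Open Scope complex_scope.
Local Notation mu := (lebesgue_rV R d).
Variables (n : nat) (t : 'I_n -> 'rV[R]_d) (i : 'I_n -> 'I_p).

Definition covariance_matrix (K : 'rV[R]_d -> 'M[R]_p) : 'M[R]_n :=
  \matrix_(m, m') K (t m - t m') (i m) (i m').

(** Spectral image of the linear combination with coefficients [a] of the observed values:
    components [i m] may repeat, so their phases are added within each coordinate [j]. *)
Definition phase_vector (a : 'rV[R]_n) (l : 'rV[R]_d) : 'cV[R[i]]_p :=
  \col_j \sum_(m | i m == j) (a 0 m)%:C * cis (- dotv (t m) l).

(** Real coordinates of the phases: [true] selects the cosine and [false] the sine. The sign of the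
    imaginary part is dropped, as only squares enter [sqnorm_phase_vector]. *)
Definition phase_feature (m : 'I_n) (j : 'I_p * bool) (l : 'rV[R]_d) : R :=
  if i m == j.1 then (if j.2 then cos (dotv (t m) l) else sin (dotv (t m) l)) else 0.

Lemma measurable_phase_feature m j : measurable_fun setT (phase_feature m j).
Proof.
rewrite /phase_feature; case: (i m == j.1) => //; case: j.2.
  apply: measurableT_comp; last exact: measurable_dotv.
  exact: continuous_measurable_fun (@continuous_cos R).
apply: measurableT_comp; last exact: measurable_dotv.
exact: continuous_measurable_fun (@continuous_sin R).
Qed.

Lemma sqnorm_phase_vector a l : sqnorm (phase_vector a l) =
  \sum_(j : 'I_p * bool) (\sum_m a 0 m * phase_feature m j l) ^+ 2.
Proof.
rewrite -(pair_bigA _ (fun j b => (\sum_m a 0 m * phase_feature m (j, b) l) ^+ 2))/=.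
apply: eq_bigr => j _; rewrite big_bool/= mxE; congr (_ + _).
  rewrite cRe_sum big_mkcond/=; congr (_ ^+ 2); apply: eq_bigr => m _.
  by rewrite /phase_feature/=; case: ifP => _; rewrite ?mulr0//= cosN mul0r subr0.
rewrite cIm_sum big_mkcond/= -sqrrN -sumrN; congr (_ ^+ 2); apply: eq_bigr => m _.
rewrite /phase_feature/=; case: ifP => _; rewrite ?mulr0 ?oppr0//= sinN mul0r addr0.
by rewrite mulrN opprK.
Qed.

Lemma hquad_phase_vector (F : 'M[R[i]]_p) a l : hquad F (phase_vector a l) =
  \sum_m \sum_m' a 0 m * a 0 m' * complex.Re (F (i m) (i m') * cis (dotv (t m - t m') l)).
Proof.
rewrite /hquad hformE.
have -> : \sum_j \sum_k Num.conj (phase_vector a l j 0) * F j k * phase_vector a l k 0 =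
   \sum_m \sum_m' (a 0 m)%:C * cis (dotv (t m) l) * F (i m) (i m') *
      ((a 0 m')%:C * cis (- dotv (t m') l)).
  transitivity (\sum_m (a 0 m)%:C * cis (dotv (t m) l) *
     \sum_k F (i m) k * phase_vector a l k 0).
    rewrite [RHS](partition_big i xpredT)//=; apply: eq_bigr => j _.
    under eq_bigr do rewrite -mulrA.
    rewrite -mulr_sumr mxE rmorph_sum/= mulr_suml; apply: eq_bigr => m /eqP <-.
    congr (_ * _); have := conj_cis (- dotv (t m) l); rewrite opprK => <-.
    by rewrite [LHS]rmorphM; congr (_ * _); exact: conjc_real.
  apply: eq_bigr => m _.
  under [RHS]eq_bigr do rewrite -mulrA.
  rewrite -mulr_sumr; congr (_ * _).
  rewrite [RHS](partition_big i xpredT)//=; apply: eq_bigr => k _.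
  by rewrite mxE mulr_sumr; apply: eq_bigr => m' /eqP <-.
rewrite cRe_sum; apply: eq_bigr => m _; rewrite cRe_sum; apply: eq_bigr => m' _.
rewrite dotvBl cisD !cReM !cImM/=; ring.
Qed.

Section density.
Variables (K : 'rV[R]_d -> 'M[R]_p) (F : 'rV[R]_d -> 'M[R[i]]_p).
Hypothesis spec : spectral_density K F.

Let iF j k : cintegrable mu (fun l => F l j k).
Proof. by case: spec. Qed.

Lemma integrable_Re_cis j k (h : 'rV[R]_d) :
  mu.-integrable setT (EFin \o (fun l => complex.Re (F l j k * cis (dotv h l)))).
Proof.
have [i1 i2] := iF j k.
have mc : cmeasurable (fun l => F l j k * cis (dotv h l)).
  apply: cmeasurableM; first exact: (cintegrable_cmeasurable (iF j k)).
  apply: cmeasurable_cis; exact: measurable_dotv.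
apply: (le_integrable measurableT (g := fun l =>
   (`|(complex.Re (F l j k))%:E| + `|(complex.Im (F l j k))%:E|)%E)).
- by apply/measurable_EFinP; case: mc.
- move=> l _ /=; rewrite lee_fin [leRHS]ger0_norm ?addr_ge0//.
  apply: (le_trans (Re_le_cabs _)); rewrite cabsM cabs_cis mulr1.
  exact: cabs_le.
- by apply: integrableD => //; exact: integrable_abse.
Qed.

Lemma integrable_hquad_phase a : mu.-integrable setT
  (EFin \o (fun l => hquad (F l) (phase_vector a l))).
Proof.
rewrite (_ : (fun l => _) = (fun l => \sum_m \sum_m' a 0 m * a 0 m' *
   complex.Re (F l (i m) (i m') * cis (dotv (t m - t m') l)))); last first.
  by apply/funext => l; rewrite hquad_phase_vector.
apply: integrable_Rsum => m; apply: integrable_Rsum => m'.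
by apply: integrableMl_cst; exact: integrable_Re_cis.
Qed.

(** Through this identity, pointwise inequalities between spectral densities become inequalities
    between covariance forms, for every sample at once. *)
Lemma qform_covariance_matrix a : qform (covariance_matrix K) a =
  \int[mu]_l hquad (F l) (phase_vector a l).
Proof.
rewrite /qform bformE.
under [RHS]eq_Rintegral do rewrite hquad_phase_vector.
have ii m m' : mu.-integrable setT (EFin \o (fun l => a 0 m * a 0 m' *
   complex.Re (F l (i m) (i m') * cis (dotv (t m - t m') l)))).
  by apply: integrableMl_cst; exact: integrable_Re_cis.
rewrite Rintegral_sum; last by move=> m; exact: integrable_Rsum.
apply: eq_bigr => m _; rewrite Rintegral_sum//; apply: eq_bigr => m' _.
rewrite RintegralZl//; last exact: integrable_Re_cis.
congr (_ * _); rewrite mxE; case: spec => _ _ _ _ /(_ (t m - t m') (i m) (i m')).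
by move=> /(congr1 (@complex.Re R)).
Qed.

Lemma measurable_retrace : measurable_fun setT (fun l => retrace (F l)).
Proof.
apply: measurable_sum => j.
by have [] := cintegrable_cmeasurable (iF j j).
Qed.

Lemma integrable_retrace : mu.-integrable setT (EFin \o (fun l => retrace (F l))).
Proof. by apply: integrable_Rsum => j; case: (iF j j). Qed.

End density.

Section comparison.
Variables (K K' : 'rV[R]_d -> 'M[R]_p) (F F' : 'rV[R]_d -> 'M[R[i]]_p).
Variables (c1 c2 : R) (g : 'rV[R]_d -> R).
Hypotheses (spec : spectral_density K F) (spec' : spectral_density K' F').
Hypotheses (c1_gt0 : 0 < c1) (c2_gt0 : 0 < c2).
Hypotheses (Fge : forall l, loewner_le (c1 * g l)%:C%:M (F l)).
Hypotheses (Fle : forall l, loewner_le (F l) (c2 * g l)%:C%:M).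
Hypotheses (F'le : forall l, loewner_le (F' l) (c2 * g l)%:C%:M).

Lemma qform_covariance_le a :
  qform (covariance_matrix K') a <= c2 / c1 * qform (covariance_matrix K) a.
Proof.
rewrite (qform_covariance_matrix spec) (qform_covariance_matrix spec').
rewrite -RintegralZl//; last exact: (integrable_hquad_phase spec).
apply: le_Rintegral => //.
- exact: (integrable_hquad_phase spec').
- by apply: integrableMl_cst; exact: (integrable_hquad_phase spec).
move=> l _; have := hquad_le (phase_vector a l) (Fge l).
have := hquad_le (phase_vector a l) (F'le l); rewrite !hquad_scalar.
move=> h1 h2; apply: (le_trans h1).
rewrite -(ler_pM2l c1_gt0) (_ : c1 * (c2 / c1 * _) = c2 * hquad (F l) (phase_vector a l)).
  by rewrite (_ : c1 * _ = c2 * (c1 * g l * sqnorm (phase_vector a l))) ?ler_pM2l//; ring.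
by field; rewrite gt_eqF.
Qed.

(** The trace is at most [p * c2 * g], one squared feature is at most the squared norm of the phase
    vector, and [c1 * g] times that norm is at most the density of the variance. For features
    orthonormal under [K] this is the Bessel inequality [frame]. *)
Lemma feature_frame_bound (a : 'rV[R]_n) j :
  (\int[mu]_l (retrace (F l) * (\sum_m a 0 m * phase_feature m j l) ^+ 2)%:E <=
   (p%:R * c2 / c1 * qform (covariance_matrix K) a)%:E)%E.
Proof.
rewrite (qform_covariance_matrix spec) -RintegralZl//; last exact: (integrable_hquad_phase spec).
have ih : mu.-integrable setT (EFin \o (fun l => p%:R * c2 / c1 * hquad (F l) (phase_vector a l))).
  by apply: integrableMl_cst; exact: (integrable_hquad_phase spec).
rewrite /Rintegral fineK; last exact: integrable_fin_num.
have F0 l : loewner_le 0 (F l) by case: spec.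
apply: ge0_le_integral => //.
- by move=> l _; rewrite lee_fin mulr_ge0 ?sqr_ge0// retrace_ge0.
- apply/measurable_EFinP; apply: measurable_funM; first exact: (measurable_retrace spec).
  apply: measurable_funX; apply: measurable_sum => m; apply: measurable_funM => //.
  exact: measurable_phase_feature.
- by case/integrableP: ih.
move=> l _; rewrite lee_fin.
have h1 := hquad_le (phase_vector a l) (Fge l); rewrite hquad_scalar in h1.
have h2 := retrace_le_scalar (Fle l).
have h3 : (\sum_m a 0 m * phase_feature m j l) ^+ 2 <= sqnorm (phase_vector a l).
  rewrite sqnorm_phase_vector (bigD1 j)//= ler_wpDr// sumr_ge0// => k _.
  exact: sqr_ge0.
apply: (@le_trans _ _ (p%:R * (c2 * g l) * sqnorm (phase_vector a l))).
  by apply: ler_pM => //; [exact: retrace_ge0|exact: sqr_ge0].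
rewrite -(ler_pM2l c1_gt0).
rewrite (_ : c1 * (p%:R * c2 / c1 * _) = p%:R * c2 * hquad (F l) (phase_vector a l)).
  rewrite (_ : c1 * _ = p%:R * c2 * (c1 * g l * sqnorm (phase_vector a l))); last by ring.
  by apply: ler_wpM2l => //; rewrite mulr_ge0// ltW.
by field; rewrite gt_eqF.
Qed.

End comparison.
End spectral_quadratic_form.

Section nonneg_integral.
Context d (T : measurableType d) (R : realType) (mu : {measure set T -> \bar R}).

(* Unlike [ge0_le_integral], this does not require [f2] to be measurable. *)
Lemma ge0_le_integral_nonmeasurable (f1 f2 : T -> \bar R) :
  (forall x, (0 <= f1 x)%E) -> (forall x, (f1 x <= f2 x)%E) ->
  (\int[mu]_x f1 x <= \int[mu]_x f2 x)%E.
Proof.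
move=> f10 f12.
have f20 x : (0 <= f2 x)%E by exact: le_trans (f12 x).
rewrite !ge0_integralTE//; apply: ereal_sup_le => _ [h hf <-].
exists h => // x.
exact: le_trans (f12 x).
Qed.

End nonneg_integral.

Lemma row_qform (R : realFieldType) r n (A : 'M[R]_(r, n)) (K : 'M[R]_n) k :
  qform K (row k A) = (A *m K *m A^T) k k.
Proof.
rewrite /qform /bform -row_mul !mxE; apply: eq_bigr => m _.
by rewrite !mxE.
Qed.

Section exchange4.
Context {R : comRingType}.

Lemma bilinear_exchange (I J : finType) (a : I -> R) (f f' : I -> J -> R) (s : J -> J -> R) :
  \sum_m \sum_m' a m * a m' * \sum_j \sum_j' f m j * f' m' j' * s j j' =
  \sum_j \sum_j' s j j' * (\sum_m a m * f m j) * (\sum_m a m * f' m j').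
Proof.
under eq_bigr do under eq_bigr do rewrite mulr_sumr.
under eq_bigr do rewrite exchange_big/=.
rewrite exchange_big/=; apply: eq_bigr => j _.
under eq_bigr do under eq_bigr do rewrite mulr_sumr.
under eq_bigr do rewrite exchange_big/=.
rewrite exchange_big/=; apply: eq_bigr => j' _.
rewrite -mulrA mulr_suml mulr_sumr; apply: eq_bigr => m _.
rewrite !mulr_sumr; apply: eq_bigr => m' _; ring.
Qed.

End exchange4.

(** * The Hilbert-Schmidt bound for the difference of the covariances *)

Section spectral_hilbert_schmidt.
Context {R : realType} (d p : nat).
Local Open Scope complex_scope.
Local Notation mu := (lebesgue_rV R d).
Local Notation T := ('rV[R]_d).
Variables (R0 R1 : 'rV[R]_d -> 'M[R]_p) (F : 'rV[R]_d -> 'M[R[i]]_p).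
Variables (c1 c2 : R) (g : 'rV[R]_d -> R).
Hypotheses (p_gt0 : (0 < p)%N) (spec : spectral_density R0 F).
Hypotheses (c1_gt0 : 0 < c1) (c2_gt0 : 0 < c2) (g0 : forall l, 0 <= g l).
Hypotheses (Fge : forall l, loewner_le (c1 * g l)%:C%:M (F l)).
Hypotheses (Fle : forall l, loewner_le (F l) (c2 * g l)%:C%:M).
Variable B : 'rV[R]_d -> 'rV[R]_d -> 'M[R[i]]_p.
Hypothesis Bmeas : forall i j, cmeasurable (fun z : T * T => B z.1 z.2 i j).
Hypothesis Bint : forall i j, (\int[mu \x mu]_z
  (cabs (B z.1 z.2 i j) ^+ 2 * opnorm (F z.1) * opnorm (F z.2))%:E < +oo)%E.

(* The weight [w] is comparable to [g], which may fail to be measurable, and to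
   [opnorm (F l)], whose measurability is not clear. *)
Let w l := retrace (F l).

Let Fh l : F l \is hermsymmx. Proof. by case: spec. Qed.
Let Fpsd l : loewner_le 0 (F l). Proof. by case: spec. Qed.
Let mF j k : cmeasurable (fun l => F l j k).
Proof. by apply: (@cintegrable_cmeasurable _ _ _ mu); case: spec. Qed.
Let w0 l : 0 <= w l. Proof. exact: retrace_ge0. Qed.
Let mw : measurable_fun setT w. Proof. exact: (measurable_retrace spec). Qed.

Let retrace_le_opnorm l : w l <= p%:R * c2 / c1 * opnorm (F l).
Proof.
apply: (le_trans (retrace_le_scalar (Fle l))).
have := opnorm_ge_scalar p_gt0 (mulr_ge0 (ltW c1_gt0) (g0 l)) (Fh l) (Fge l).
move=> h; rewrite (_ : p%:R * (c2 * g l) = p%:R * c2 / c1 * (c1 * g l)).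
  apply: ler_wpM2l h; apply: divr_ge0; last exact: ltW.
  by apply: mulr_ge0 => //; exact: ltW.
by field; rewrite gt_eqF.
Qed.

Let mw1 : measurable_fun setT (fun z : T * T => w z.1).
Proof. exact: (measurableT_comp mw measurable_fst). Qed.

Let mw2 : measurable_fun setT (fun z : T * T => w z.2).
Proof. exact: (measurableT_comp mw measurable_snd). Qed.

Let mB j k : measurable_fun setT (fun z : T * T => cabs (B z.1 z.2 j k) ^+ 2).
Proof. by apply: measurable_funX; apply: measurable_cabs. Qed.

(** Both weights [w] are at most [ka] times the operator norm. The measurable integrand, divided by
    [ka ^+ 2], is thus dominated by the one in [Bint]. *)
Let B_finite j k :
  (\int[mu \x mu]_z (w z.1 * w z.2 * cabs (B z.1 z.2 j k) ^+ 2)%:E < +oo)%E.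
Proof.
have [ka ka0 wka] : exists2 ka, 0 < ka & forall l, w l <= ka * opnorm (F l).
  exists (p%:R * c2 / c1); last exact: retrace_le_opnorm.
  by rewrite !mulr_gt0 ?invr_gt0 ?ltr0n.
have mf : measurable_fun setT (fun z : T * T => w z.1 * w z.2 * cabs (B z.1 z.2 j k) ^+ 2).
  by apply: measurable_funM => //; exact: measurable_funM.
pose f (z : T * T) := (ka ^- 2 * (w z.1 * w z.2 * cabs (B z.1 z.2 j k) ^+ 2))%:E.
have f0 z : (0 <= f z)%E.
  rewrite lee_fin; apply: mulr_ge0; first by rewrite invr_ge0 sqr_ge0.
  by rewrite mulr_ge0 ?sqr_ge0// mulr_ge0.
have : (\int[mu \x mu]_z f z < +oo)%E.
  apply: le_lt_trans (Bint j k); apply: ge0_le_integral_nonmeasurable => // z.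
  rewrite lee_fin -(ler_pM2l (exprn_gt0 2 ka0)) mulrA mulfV ?gt_eqF ?exprn_gt0// mul1r.
  have re (x u v y : R) : x ^+ 2 * (y * u * v) = (x * u) * (x * v) * y by ring.
  rewrite re.
  by apply: ler_wpM2r; rewrite ?sqr_ge0//; exact: ler_pM.
rewrite /f; under eq_integral do rewrite EFinM.
rewrite ge0_integralZl//; last 3 first.
- exact/measurable_EFinP.
- by move=> z _; rewrite lee_fin; apply: mulr_ge0; [exact: mulr_ge0|exact: sqr_ge0].
- by rewrite lee_fin invr_ge0 sqr_ge0.
move=> h; rewrite ltNge leye_eq; apply/negP => /eqP e; move: h.
by rewrite e gt0_muley ?ltxx// lte_fin invr_gt0 exprn_gt0.
Qed.

(** Hilbert-Schmidt norm of the matrix [B z.1 z.2]. In [beta], the factor 4 comes from bounding an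
    entry of each of the two densities by twice its trace, and [p ^ 2] counts the terms of an entry
    of the triple product. *)
Let hs (z : T * T) := Num.sqrt (\sum_j \sum_k cabs (B z.1 z.2 j k) ^+ 2).
Let beta (z : T * T) := 4 * p%:R ^+ 2 * hs z.

Let hs_ge0 z : 0 <= \sum_j \sum_k cabs (B z.1 z.2 j k) ^+ 2.
Proof. by apply: sumr_ge0 => j _; apply: sumr_ge0 => k _; exact: sqr_ge0. Qed.

Let beta0 z : 0 <= beta z.
Proof. by rewrite /beta !mulr_ge0 ?exprn_ge0// sqrtr_ge0. Qed.

Let mbeta : measurable_fun setT beta.
Proof.
apply: measurable_funM => //; apply: measurableT_comp.
  exact: continuous_measurable_fun (@sqrt_continuous R).
by apply: measurable_sum => j; exact: measurable_sum.
Qed.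

Let cabs_le_hs z j k : cabs (B z.1 z.2 j k) <= hs z.
Proof.
rewrite -(ger0_norm (cabs_ge0 _)) -sqrtr_sqr; apply: ler_wsqrtr.
rewrite (bigD1 j)//= (bigD1 k)//= -addrA lerDl addr_ge0//.
  by apply: sumr_ge0 => ? _; exact: sqr_ge0.
by apply: sumr_ge0 => ? _; apply: sumr_ge0 => ? _; exact: sqr_ge0.
Qed.

Let BB := (\int[mu \x mu]_z (w z.1 * w z.2 * beta z ^+ 2)%:E)%E.

Let ww0 (z : T * T) : 0 <= w z.1 * w z.2. Proof. exact: mulr_ge0. Qed.

Let mww : measurable_fun setT (fun z : T * T => w z.1 * w z.2).
Proof. exact: measurable_funM. Qed.

Let BB_finite : (BB < +oo)%E.
Proof.
have -> : BB = (\int[mu \x mu]_z ((16 * p%:R ^+ 4)%:E *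
   \sum_j \sum_k (w z.1 * w z.2 * cabs (B z.1 z.2 j k) ^+ 2)%:E))%E.
  apply: eq_integral => z _.
  under eq_bigr do rewrite sumEFin.
  rewrite sumEFin -EFinM; congr EFin.
  under eq_bigr do rewrite -mulr_sumr.
  rewrite -mulr_sumr /beta exprMn sqr_sqrtr//; ring.
rewrite ge0_integralZl//; last 2 first.
- apply: emeasurable_sum => j; apply: emeasurable_sum => k.
  by apply/measurable_EFinP; apply: measurable_funM.
- move=> z _; apply: sume_ge0 => j _; apply: sume_ge0 => k _.
  by rewrite lee_fin mulr_ge0// sqr_ge0.
apply: lte_mul_pinfty; rewrite ?lee_fin ?mulr_ge0 ?exprn_ge0//.
rewrite ge0_integral_sum//; last 2 first.
- move=> j; apply: emeasurable_sum => k.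
  by apply/measurable_EFinP; apply: measurable_funM.
- by move=> j z _; apply: sume_ge0 => k _; rewrite lee_fin mulr_ge0// sqr_ge0.
apply: lte_sum_pinfty => j _; rewrite ge0_integral_sum//; last 2 first.
- by move=> k; apply/measurable_EFinP; apply: measurable_funM.
- by move=> k z _; rewrite lee_fin mulr_ge0// sqr_ge0.
by apply: lte_sum_pinfty => k _; exact: B_finite.
Qed.

Let BB_fin : BB \is a fin_num.
Proof.
rewrite ge0_fin_numE// /BB; apply: integral_ge0 => z _.
by rewrite lee_fin mulr_ge0// sqr_ge0.
Qed.

Let iww : (mu \x mu)%E.-integrable setT (EFin \o (fun z => w z.1 * w z.2)).
Proof.
apply/integrableP; split; first exact/measurable_EFinP.
under eq_integral do rewrite /= ger0_norm//.
pose f (z : T * T) := (w z.1 * w z.2)%:E.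
have mf : measurable_fun setT f by exact/measurable_EFinP.
rewrite -[ltLHS]/(\int[mu \x mu]_z f z)%E (fubini_tonelli1 _ mf); last first.
  by move=> z; rewrite lee_fin.
rewrite /fubini_F /f /=.
have /integrableP[_] := integrable_retrace spec.
under eq_integral do rewrite /= ger0_norm ?w0//.
rewrite -/(\int[mu]_x (w x)%:E)%E; set I := (\int[mu]_x (w x)%:E)%E => Ioo.
have I0 : (0 <= I)%E by apply: integral_ge0 => x _; rewrite lee_fin.
have inner x : (\int[mu]_y (w x * w y)%:E = I * (w x)%:E)%E.
  under eq_integral do rewrite EFinM.
  rewrite ge0_integralZl ?lee_fin// 1?muleC//; first exact/measurable_EFinP.
  by move=> y _; rewrite lee_fin.
under eq_integral do rewrite inner.
rewrite ge0_integralZl//; first last.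
- by move=> y _; rewrite lee_fin.
- exact/measurable_EFinP.
by apply: lte_mul_pinfty => //; rewrite ge0_fin_numE.
Qed.

(** The weight [w z.1 * w z.2] has finite mass, so square integrability of [beta] gives
    integrability, by [beta <= 1 + beta ^+ 2]. The spectral double integral then converges
    absolutely. *)
Let iwb : (mu \x mu)%E.-integrable setT (EFin \o (fun z => w z.1 * w z.2 * beta z)).
Proof.
apply: (le_integrable measurableT (g := fun z : T * T =>
   ((w z.1 * w z.2)%:E + (w z.1 * w z.2 * beta z ^+ 2)%:E)%E)).
- by apply/measurable_EFinP; exact: measurable_funM.
- move=> z _ /=; rewrite lee_fin (ger0_norm (mulr_ge0 (ww0 z) (beta0 z))).
  rewrite (ger0_norm (addr_ge0 (ww0 z) (mulr_ge0 (ww0 z) (sqr_ge0 (beta z))))).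
  rewrite -[X in X + _]mulr1 -mulrDr; apply: ler_wpM2l => //.
  have := beta0 z; nra.
- apply: integrableD; [by []|exact: iww|apply/integrableP; split].
    apply/measurable_EFinP; apply: measurable_funM => //; exact: measurable_funX.
  apply: le_lt_trans BB_finite; rewrite le_eqVlt; apply/orP; left; apply/eqP.
  apply: eq_integral => z _.
  by rewrite gee0_abs// lee_fin; apply: mulr_ge0 => //; exact: sqr_ge0.
Qed.

Let G (z : T * T) := F z.1 *m B z.1 z.2 *m F z.2.

Let GE z j k : G z j k = \sum_b \sum_a F z.1 j a * B z.1 z.2 a b * F z.2 b k.
Proof. by rewrite /G mxE; apply: eq_bigr => b _; rewrite mxE mulr_suml. Qed.

Let cmeasurable_G j k : cmeasurable (fun z => G z j k).
Proof.
rewrite (_ : (fun z => _) = (fun z => \sum_b \sum_a F z.1 j a * B z.1 z.2 a b * F z.2 b k)).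
  apply: cmeasurable_sum => b; apply: cmeasurable_sum => a; apply: cmeasurableM.
    apply: cmeasurableM => //.
    exact: (cmeasurable_comp measurable_fst (mF j a)).
  exact: (cmeasurable_comp measurable_snd (mF b k)).
by apply/funext => z; exact: GE.
Qed.

Let G_bound z j k : cabs (G z j k) <= w z.1 * w z.2 * beta z.
Proof.
have cst (x : R) : \sum_(a < p) x = p%:R * x by rewrite sumr_const card_ord mulr_natl.
rewrite GE; apply: (le_trans (cabs_sum _ _)).
apply: (@le_trans _ _ (\sum_(b < p) p%:R * (4 * (w z.1 * w z.2 * hs z)))); last first.
  rewrite cst /beta le_eqVlt; apply/orP; left.
  by apply/eqP; ring.
apply: ler_sum => b _; apply: (le_trans (cabs_sum _ _)).
apply: (@le_trans _ _ (\sum_(a < p) (4 * (w z.1 * w z.2 * hs z)))); last first.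
  by rewrite cst.
apply: ler_sum => a _; rewrite !cabsM.
rewrite (_ : 4 * _ = 2 * w z.1 * hs z * (2 * w z.2)); last by ring.
apply: ler_pM; rewrite ?mulr_ge0 ?cabs_ge0//; last exact: hermitian_cabs_le.
by apply: ler_pM; rewrite ?cabs_ge0//; exact: hermitian_cabs_le.
Qed.

Section sample.
Variables (n : nat) (t : 'I_n -> 'rV[R]_d) (i : 'I_n -> 'I_p).
Hypothesis BR : forall m m',
  map_mx (real_complex R) (R1 (t m - t m') - R0 (t m - t m')) =
  mxintegral (mu \x mu)%E (fun z => cis (- dotv z.1 (t m) + dotv z.2 (t m')) *:
     (F z.1 *m B z.1 z.2 *m F z.2)).

Let e m m' (z : T * T) : R[i] := cis (- dotv z.1 (t m) + dotv z.2 (t m')).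
Let gg m m' z := complex.Re (e m m' z * G z (i m) (i m')).

Let cmeasurable_e m m' : cmeasurable (e m m').
Proof.
apply: cmeasurable_cis; apply: measurable_funD.
  apply: measurableT_comp => //; under eq_fun do rewrite dotvC.
  exact: (measurableT_comp (measurable_dotv (t m)) measurable_fst).
under eq_fun do rewrite dotvC.
exact: (measurableT_comp (measurable_dotv (t m')) measurable_snd).
Qed.

Let igg m m' : (mu \x mu)%E.-integrable setT (EFin \o gg m m').
Proof.
apply: (le_integrable measurableT _ _ iwb).
  apply/measurable_EFinP.
  by have [] := cmeasurableM (cmeasurable_e m m') (cmeasurable_G (i m) (i m')).
move=> z _ /=; rewrite lee_fin (ger0_norm (mulr_ge0 (ww0 z) (beta0 z))).
by apply: (le_trans (Re_le_cabs _)); rewrite cabsM cabs_cis mul1r G_bound.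
Qed.

Let int_gg m m' : \int[(mu \x mu)%E]_z gg m m' z =
  covariance_matrix t i R1 m m' - covariance_matrix t i R0 m m'.
Proof.
have := congr1 (fun M : 'M[R[i]]_p => complex.Re (M (i m) (i m'))) (BR m m').
rewrite !mxE /= => ->.
by apply: eq_Rintegral => z _; rewrite /gg [in RHS]mxE.
Qed.

(** Coefficients of the real bilinear form obtained by expanding the real part of phase times [G] in
    products of cosines and sines. *)
Let sG (j j' : 'I_p * bool) z : R :=
  if j.2 == j'.2 then complex.Re (G z j.1 j'.1)
  else if j.2 then - complex.Im (G z j.1 j'.1) else complex.Im (G z j.1 j'.1).

Let sG_bound j j' z : `|sG j j' z| <= w z.1 * w z.2 * beta z.
Proof.
apply: le_trans (G_bound z j.1 j'.1); rewrite /sG.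
case: ifP => _; first exact: Re_le_cabs.
by case: ifP => _; rewrite ?normrN; exact: Im_le_cabs.
Qed.

Let sum_feature m l (X : 'I_p * bool -> R) :
  \sum_j phase_feature t i m j l * X j =
  cos (dotv (t m) l) * X (i m, true) + sin (dotv (t m) l) * X (i m, false).
Proof.
transitivity (\sum_j \sum_b phase_feature t i m (j, b) l * X (j, b)).
  by rewrite pair_bigA; apply: eq_bigr => -[].
rewrite (bigD1 (i m))//= [X in _ + X]big1 ?addr0; last first.
  move=> j /negbTE jm; rewrite big_bool /phase_feature/= eq_sym jm.
  by rewrite !mul0r addr0.
by rewrite big_bool /phase_feature/= eqxx.
Qed.

Let ggE m m' z : gg m m' z = \sum_j \sum_j'
  phase_feature t i m j z.1 * phase_feature t i m' j' z.2 * sG j j' z.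
Proof.
under eq_bigr do under eq_bigr do rewrite -mulrA.
under eq_bigr do rewrite -mulr_sumr sum_feature.
rewrite sum_feature /sG /= /gg /e cisD !cReM !cImM /= cosN sinN.
by rewrite !(dotvC z.1) !(dotvC z.2); ring.
Qed.

(** [q k - 1] is the [k]-th diagonal entry of [A] applied to the difference of the covariances,
    hence the integral of a form in the transformed features. The right-hand side involves neither
    the sample nor [A]. *)
Lemma spectral_diagonal_bound r (A : 'M[R]_(r, n)) (q : 'I_r -> R) :
  A *m covariance_matrix t i R0 *m A^T = 1%:M ->
  A *m covariance_matrix t i R1 *m A^T = diag_mx (\row_k q k) ->
  \sum_k (q k - 1) ^+ 2 <=
  #|{: 'I_p * bool}|%:R ^+ 4 * (p%:R * c2 / c1) ^+ 2 * fine BB.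
Proof.
move=> A0 A1.
pose xi k j l := \sum_m A k m * phase_feature t i m j l.
pose h k z := \sum_m \sum_m' A k m * A k m' * gg m m' z.
have hE k : \int[(mu \x mu)%E]_z h k z = q k - 1.
  have iAg m m' : (mu \x mu)%E.-integrable setT (EFin \o (fun z => A k m * A k m' * gg m m' z)).
    exact: integrableMl_cst.
  rewrite /h Rintegral_sum; last by move=> m; exact: integrable_Rsum.
  have <- : qform (covariance_matrix t i R1) (row k A) = q k.
    by rewrite row_qform A1 !mxE eqxx.
  have <- : qform (covariance_matrix t i R0) (row k A) = 1.
    by rewrite row_qform A0 !mxE eqxx.
  rewrite /qform !bformE -sumrB; apply: eq_bigr => m _.
  rewrite Rintegral_sum// -sumrB; apply: eq_bigr => m' _.
  by rewrite RintegralZl// int_gg mulrBr 2![in RHS]mxE.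
rewrite -(eq_bigr _ (fun k _ => congr1 (fun x => x ^+ 2) (hE k))).
apply: (hilbert_schmidt_bound (w := w) (xi := xi) (beta := beta)) => //.
- move=> k j; apply: measurable_sum => m; apply: measurable_funM => //.
  exact: measurable_phase_feature.
- by rewrite !mulr_gt0 ?invr_gt0// ltr0n.
(* Orthonormality for [K0] identifies the sum of squares of [c] with the variance of the combination
   [a], which is what [feature_frame_bound] controls. *)
- move=> c j; pose a : 'rV[R]_n := (\row_k c k) *m A.
  have -> : \sum_k c k ^+ 2 = qform (covariance_matrix t i R0) a.
    rewrite /a /qform -bform_mul A0 /bform mulmx1 mxE; apply: eq_bigr => k _.
    by rewrite !mxE expr2.
  apply: le_trans (feature_frame_bound t i spec c1_gt0 c2_gt0 Fge Fle a j).
  rewrite le_eqVlt; apply/orP; left; apply/eqP; apply: eq_integral => l _.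
  congr (_ * _ ^+ 2)%:E; rewrite /xi.
  under eq_bigr do rewrite mulr_sumr.
  rewrite exchange_big/=; apply: eq_bigr => m _.
  by rewrite mxE mulr_suml; apply: eq_bigr => k _; rewrite mxE mulrA.
- by rewrite fineK.
- by move=> k; apply: integrable_Rsum => m; apply: integrable_Rsum => m'; exact: integrableMl_cst.
move=> c z.
have -> : \sum_k c k * h k z = \sum_j \sum_j' sG j j' z * \sum_k c k * xi k j z.1 * xi k j' z.2.
  under eq_bigr => k _.
    rewrite /h.
    under eq_bigr do under eq_bigr do rewrite ggE.
    rewrite (bilinear_exchange (A k) (fun m j => phase_feature t i m j z.1)
       (fun m j => phase_feature t i m j z.2) (fun j j' => sG j j' z)) mulr_sumr.
    over.
  rewrite exchange_big/=; apply: eq_bigr => j _.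
  under eq_bigr do rewrite mulr_sumr.
  rewrite exchange_big/=; apply: eq_bigr => j' _.
  by rewrite mulr_sumr; apply: eq_bigr => k _; rewrite /xi; ring.
apply: (le_trans (ler_norm_sum _ _ _)); apply: ler_sum => j _.
apply: (le_trans (ler_norm_sum _ _ _)); apply: ler_sum => j' _.
by rewrite normrM; apply: ler_wpM2r.
Qed.

End sample.
End spectral_hilbert_schmidt.

(** * Passage to the sigma-algebra of the field *)

Section comparison_of_measures.
Context d (T : measurableType d) (R : realType) (P Q : probability T R).

(* The inequality passes to monotone limits, hence from a ring of sets to the
   generated sigma-ring. *)
Lemma measure_comparison_sigma_ring (G : set (set T)) (a k : R) :
  setring G -> G `<=` measurable -> 0 < a ->
  (forall A, G A -> (Q A <= a%:E * P A + k%:E)%E) ->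
  forall A, <<sr G>> A -> measurable A /\ (Q A <= a%:E * P A + k%:E)%E.
Proof.
move=> rG mG a0 GQ; apply: monotone_setring_sub_g_sigma_ring => //; last first.
  by move=> A GA; split; [exact: mG|exact: GQ].
have fP A : measurable A -> P A \is a fin_num by exact: fin_num_measure.
split=> F mF GF.
  have mUF : measurable (\bigcup_i F i) by apply: bigcupT_measurable => i; case: (GF i).
  split => //.
  have := nondecreasing_cvg_mu (mu := Q) (fun i => (GF i).1) mUF mF.
  move=> cv; rewrite -(cvg_lim _ cv)//.
  apply: lime_le; first by apply/cvg_ex; eexists; exact: cv.
  apply: nearW => n /=; apply: (le_trans (GF n).2).
  rewrite leeD2r// lee_wpmul2l ?lee_fin ?(ltW a0)// le_measure ?inE//.
    by case: (GF n).
  exact: bigcup_sup.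
have mIF : measurable (\bigcap_i F i) by apply: bigcapT_measurable => i; case: (GF i).
split => //.
have := nonincreasing_cvg_mu (mu := P) _ (fun i => (GF i).1) mIF mF.
have /[swap]/[apply] cv : (P (F 0%N) < +oo)%E by rewrite ltey_eq fP//; case: (GF 0%N).
(* Solving the inequality for [P (F n)] leaves a constant on the left, since the intersection lies
   in every [F n]; only continuity of [P] from above is then used. *)
have h n : (((fine (Q (\bigcap_i F i)) - k) / a)%:E <= P (F n))%E.
  have mn : measurable (F n) by case: (GF n).
  have : (Q (\bigcap_i F i) <= a%:E * P (F n) + k%:E)%E.
    apply: le_trans (GF n).2; rewrite le_measure ?inE//.
    exact: bigcap_inf.
  rewrite -(fineK (fP _ mn)) -[leLHS](fineK (fin_num_measure Q _ mIF)).
  by rewrite -EFinM -EFinD !lee_fin ler_pdivrMr// (mulrC _ a) lerBlDr.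
have : (((fine (Q (\bigcap_i F i)) - k) / a)%:E <= P (\bigcap_i F i))%E.
  rewrite -(cvg_lim _ cv)//; apply: lime_ge; first by apply/cvg_ex; eexists; exact: cv.
  exact: nearW.
rewrite -(fineK (fP _ mIF)) -[X in (X <= a%:E * _ + _)%E](fineK (fin_num_measure Q _ mIF)).
by rewrite -EFinM -EFinD !lee_fin ler_pdivrMr// (mulrC _ a) lerBlDr.
Qed.

Lemma measure_comparison_one (K de : R) (A : set T) : 0 < de -> measurable A ->
  (forall L, (Q (~` A) <= (expR L)%:E * P (~` A) + (expR (- (L * de)) * K)%:E)%E) ->
  P A = 1%E -> Q A = 1%E.
Proof.
move=> de0 mA h PA; have mC : measurable (~` A) by exact: measurableC.
have PC : P (~` A) = 0%E by rewrite probability_setC// PA subee.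
have QC : Q (~` A) = 0%E.
  apply/eqP; rewrite eq_le measure_ge0 andbT.
  have {}h L : fine (Q (~` A)) <= expR (- (L * de)) * K.
    have := h L; rewrite PC mule0 add0e -[leLHS](fineK (fin_num_measure Q _ mC)).
    by rewrite lee_fin.
  rewrite -(fineK (fin_num_measure Q _ mC)) lee_fin leNgt; apply/negP.
  set x := fine _ in h * => x0.
  have K0 : 0 < K by have := h 0; rewrite mul0r oppr0 expR0 mul1r; exact: lt_le_trans.
  (* If [x > 0], this value of [L] gives [x * expR (K / x) <= K], against
     [expR (K / x) > 1 + K / x]. *)
  have := h (K / x / de); rewrite mulfVK ?gt_eqF// => h1.
  have := expR_gt1Dx (x := K / x); rewrite gt_eqF ?divr_gt0// => /(_ isT) h2.
  move: h1; rewrite expRN mulrC ler_pdivlMr ?expR_gt0// => h3.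
  have := ltr_pM2l x0 (1 + K / x) (expR (K / x)); rewrite h2 mulrDr mulr1 mulrCA mulfV ?gt_eqF// mulr1.
  by rewrite ltNge (le_trans h3)// lerDr ltW.
by rewrite -(setCK A) probability_setC// QC sube0.
Qed.

Lemma measure_eq_outside_null (N A B : set T) : measurable N -> measurable A ->
  measurable B -> P N = 0%E -> A `\` N = B `\` N -> P A = P B.
Proof.
move=> mN mA mB PN AB.
have H X Y : measurable X -> measurable Y -> X `\` N = Y `\` N -> (P X <= P Y)%E.
  move=> mX mY XY; apply: (@le_trans _ _ (P (Y `|` N))).
    rewrite le_measure ?inE//; first exact: measurableU.
    move=> x Xx; have [Nx|Nx] := pselect (N x); first by right.
    have : (X `\` N) x by [].
    by rewrite XY => -[]; left.
  by apply: (le_trans (measureU2 _ mY mN)); rewrite -[X in (_ <= X)%E]adde0 -PN.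
by apply/eqP; rewrite eq_le !H.
Qed.

End comparison_of_measures.

Lemma qform_rowE (R : realFieldType) n (K : 'M[R]_n) (a : 'I_n -> R) :
  \sum_k \sum_l a k * a l * K k l = qform K (\row_k a k).
Proof.
by rewrite /qform bformE; apply: eq_bigr => k _; apply: eq_bigr => l _; rewrite !mxE.
Qed.

Section common_reduction.
Context d (T : measurableType d) (R : realType) (n : nat).
Variables (X : 'I_n -> {mfun T >-> R}).

Let Xv := row_of_fun (fun k => X k : T -> R).

Let mXv S : measurable S -> measurable (Xv @^-1` S).
Proof.
move=> mS; rewrite -[X in measurable X]setTI; exact: measurable_row_of_fun.
Qed.

(** The set of reduced vectors [y] whose reconstruction by [C] lies in [S]. It does not depend on
    the probability measure, so both laws are evaluated on the same set. *)
Definition reduced_event r (C : 'M[R]_(n, r)) (S : set 'rV[R]_n) : set 'rV[R]_r :=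
  (fun y => y *m C^T) @^-1` S.

Lemma measurable_reduced_event r (C : 'M[R]_(n, r)) S : measurable S ->
  measurable (reduced_event C S).
Proof.
move=> mS; rewrite -[X in measurable X]setTI; apply: measurable_rVP => // m.
under eq_fun do rewrite mxE.
by apply: measurable_sum => k; apply: measurable_funM => //; exact: measurable_coord.
Qed.

(** The vector [Y = A X] has independent normal coordinates. Each coordinate of [X - C Y] has zero
    variance and vanishes almost surely, so the event for [X] and the reduced event for [Y] differ
    inside the null set [N]. *)
Lemma gaussian_reduced_law (P : probability T R) (K : 'M[R]_n) r (A : 'M[R]_(r, n))
    (C : 'M[R]_(n, r)) (sig : 'I_r -> R) (S : set 'rV[R]_n) :
  centered_gaussian_family P X (fun k l => K k l) ->
  (forall k, 0 < sig k) -> A *m K *m A^T = diag_mx (\row_k sig k ^+ 2) ->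
  (forall m, qform K (row m (1%:M - C *m A)) = 0) -> measurable S ->
  P (Xv @^-1` S) = gauss_rV sig (reduced_event C S).
Proof.
move=> gX sig0 AK AC mS.
pose Y k w := \sum_m A k m * X m w.
have mY k : measurable_fun setT (Y k) by exact: measurable_lincomb.
have YE w : row_of_fun Y w = Xv w *m A^T.
  by apply/rowP => k; rewrite !mxE; apply: eq_bigr => m _; rewrite !mxE mulrC.
have Ycos (u : 'I_r -> R) th : \int[P]_w cos (\sum_k u k * Y k w + th) =
    cos th * expR (- \sum_k (sig k * u k) ^+ 2 / 2).
  pose a m := \sum_k u k * A k m.
  have := lincomb_cos gX a th => /=; rewrite qform_rowE.
  have -> : \row_m a m = (\row_k u k) *m A.
    by apply/rowP => m; rewrite !mxE; apply: eq_bigr => k _; rewrite !mxE.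
  rewrite /qform -bform_mul AK.
  have -> : bform (diag_mx (\row_k sig k ^+ 2)) (\row_k u k) (\row_k u k) / 2 =
      \sum_k (sig k * u k) ^+ 2 / 2.
    rewrite bformE mulr_suml; apply: eq_bigr => k _.
    rewrite (bigD1 k)//= big1 ?addr0.
      by rewrite !mxE eqxx mulr1n; ring.
    by move=> l lk; rewrite !mxE eq_sym (negbTE lk) mulr0n mulr0.
  move=> <-; apply: eq_Rintegral => w _; congr (cos (_ + _)).
  under eq_bigr do rewrite mulr_sumr.
  rewrite exchange_big/=; apply: eq_bigr => m _.
  by rewrite mulr_suml; apply: eq_bigr => k _; rewrite mulrA.
have Ylaw k (B : set R) : measurable B -> P (Y k @^-1` B) = normal_prob 0 (sig k) B.
  move=> mB; apply: (lincomb_normal gX) => //; first by rewrite gt_eqF.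
  rewrite /= qform_rowE (_ : \row_m A k m = row k A); last by apply/rowP => m; rewrite !mxE.
  by rewrite row_qform AK !mxE eqxx.
have mCS := measurable_reduced_event C mS.
rewrite -(joint_gaussian_law mY Ycos Ylaw mCS).
pose N := \bigcup_(m in [set: 'I_n])
  ((fun w => \sum_l (1%:M - C *m A) m l * X l w) @^-1` (~` [set 0])).
have mN1 m : measurable ((fun w => \sum_l (1%:M - C *m A) m l * X l w) @^-1` (~` [set 0])).
  rewrite -[X in measurable X]setTI; apply: measurable_lincomb => //.
  by apply: measurableC; exact: measurable_set1.
have mN : measurable N by apply: fin_bigcup_measurable => // m _; exact: mN1.
have PN : P N = 0%E.
  rewrite /N bigcup_fset_set; last exact: finite_finset.
  set U := \big[setU/set0]_(_ <- _) _; suff [] : measurable U /\ P U = 0%E by [].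
  rewrite /U.
  apply: (big_ind (fun B => measurable B /\ P B = 0%E)).
  - by rewrite measure0.
  - move=> V W [mV V0] [mW W0]; split; first exact: measurableU.
    apply/eqP; rewrite eq_le measure_ge0 andbT.
    apply: (le_trans (measureU2 _ mV mW)); rewrite -[leLHS]/(P V + P W)%E.
    by rewrite V0 W0 adde0.
  - move=> m _; split; first exact: mN1.
    apply: (lincomb_null gX); rewrite /= qform_rowE.
    by rewrite (_ : \row_l _ = row m (1%:M - C *m A)) ?AC.
apply: (@measure_eq_outside_null _ _ _ _ N) => //; first exact: mXv.
  rewrite -[X in measurable X]setTI; exact: measurable_row_of_fun.
have XE w : ~ N w -> Xv w = row_of_fun Y w *m C^T.
  move=> Nw; apply/eqP; rewrite YE -mulmxA -trmx_mul -subr_eq0 -[X in X - _]mulmx1.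
  rewrite -mulmxBr; apply/eqP/rowP => m; rewrite [RHS]mxE.
  apply: contrapT => h; apply: Nw; exists m => //= e; apply: h; rewrite -[RHS]e.
  rewrite mxE; apply: eq_bigr => l _; rewrite mulrC !mxE [in RHS]eq_sym.
  by congr ((_ - _) * _); apply: eq_bigr => k _; rewrite !mxE mulrC.
apply/seteqP; split => w [/= Sw Nw]; split => //.
  by rewrite /reduced_event/= -XE.
by rewrite XE.
Qed.

Section cylinder_comparison.
Variables (P0 P1 : probability T R) (K0 K1 : 'M[R]_n) (c S0 : R).
Hypotheses (gX0 : centered_gaussian_family P0 X (fun k l => K0 k l))
  (gX1 : centered_gaussian_family P1 X (fun k l => K1 k l))
  (K0s : K0^T = K0) (K1s : K1^T = K1) (K0ge0 : forall a, 0 <= qform K0 a)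
  (c0 : 0 < c) (c1 : c <= 1)
  (K1ge : forall a, c * qform K0 a <= qform K1 a)
  (K1le : forall a, qform K1 a <= c^-1 * qform K0 a)
  (HS : forall r (A : 'M[R]_(r, n)) (q : 'I_r -> R), A *m K0 *m A^T = 1%:M ->
    A *m K1 *m A^T = diag_mx (\row_k q k) -> \sum_k (q k - 1) ^+ 2 <= S0).

Lemma gaussian_cylinder_comparison S L : measurable S ->
  let k := (expR (- (L / (2 * c^-1))) * expR ((1 + (2 * c)^-1) * (S0 / c ^+ 2)))%:E in
  (P1 (Xv @^-1` S) <= (expR L)%:E * P0 (Xv @^-1` S) + k)%E /\
  (P0 (Xv @^-1` S) <= (expR L)%:E * P1 (Xv @^-1` S) + k)%E.
Proof.
move=> mS k.
have [r [A [C [q [A0 A1 CA]]]]] := gauss_reduction K0s K1s K0ge0.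
have q0 j : qform K0 (row j A) = 1 by rewrite row_qform A0 mxE eqxx.
have q1 j : qform K1 (row j A) = q j by rewrite row_qform A1 !mxE eqxx.
have cq j : c <= q j by have := K1ge (row j A); rewrite q0 q1 mulr1.
have qc j : q j <= c^-1 by have := K1le (row j A); rewrite q0 q1 mulr1.
have qgt0 j : 0 < q j by exact: lt_le_trans (cq j).
have n0 m : qform K0 (row m (1%:M - C *m A)) = 0.
  by rewrite row_qform CA mul0mx mxE.
(* The same [C] reconstructs [X] under [P1], because [K1le] makes every null vector of [K0] a null
   vector of [K1]. *)
have n1 m : qform K1 (row m (1%:M - C *m A)) = 0.
  apply/eqP; rewrite eq_le; apply/andP; split.
    by apply: (le_trans (K1le _)); rewrite n0 mulr0.
  by apply: le_trans (K1ge _); rewrite n0 mulr0.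
pose s0 : 'I_r -> R := fun=> 1; pose s1 j := Num.sqrt (q j).
have s1E j : s1 j ^+ 2 = q j by rewrite sqr_sqrtr// ltW.
have s0pos j : 0 < s0 j by [].
have s1pos j : 0 < s1 j by rewrite sqrtr_gt0.
rewrite (@gaussian_reduced_law P0 K0 r A C s0 S gX0)//; last first.
  rewrite A0; apply/matrixP => i j; rewrite !mxE expr1n.
  by [].
rewrite (@gaussian_reduced_law P1 K1 r A C s1 S gX1)//; last first.
  by rewrite A1; congr diag_mx; apply/rowP => j; rewrite !mxE s1E.
have mC := measurable_reduced_event C mS.
have c2 : 0 < c ^+ 2 by rewrite exprn_gt0.
have c21 : c ^+ 2 <= 1 by rewrite expr_le1// ltW.
have Qge1 : 1 <= c^-1 by rewrite invf_ge1.
have hs := HS A0 A1.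
have S00 : 0 <= S0 by apply: le_trans hs; apply: sumr_ge0 => j _; exact: sqr_ge0.
split.
  apply: gauss_rV_comparison => //.
    by move=> j; rewrite s1E expr1n divr1 cq qc.
  apply: (@le_trans _ _ S0).
    by under eq_bigr do rewrite s1E expr1n divr1.
  by rewrite ler_pdivlMr// ler_piMr.
apply: gauss_rV_comparison => //.
  move=> j; rewrite s1E expr1n div1r; apply/andP; split.
    by rewrite -[leLHS]invrK lef_pV2 ?posrE// ?invr_gt0.
  by rewrite lef_pV2 ?posrE.
(* In this direction the variance ratios are the inverses of [q], and
   [(1 / q - 1) ^ 2 = (q - 1) ^ 2 / q ^ 2] with [q >= c]; hence the divisor [c ^+ 2] in the
   constant. *)
rewrite ler_pdivlMr//; apply: le_trans hs; rewrite mulr_suml; apply: ler_sum => j _.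
rewrite s1E expr1n div1r -exprMn.
have -> : (q j - 1) ^+ 2 = ((q j)^-1 - 1) ^+ 2 * q j ^+ 2 by field; rewrite gt_eqF.
rewrite exprMn; apply: ler_wpM2l; first exact: sqr_ge0.
by rewrite ler_sqr ?nnegrE ?(ltW c0)// ltW.
Qed.

End cylinder_comparison.
End common_reduction.

Section cylinders.
Context {R : realType} {d p : nat} {D : set 'rV[R]_d}.
Context {dO : measure_display} {Omega : measurableType dO}.
Variable Z : D -> 'I_p -> {mfun Omega >-> R}.

Definition field_row n (s : 'I_n -> D) (i : 'I_n -> 'I_p) : Omega -> 'rV[R]_n :=
  row_of_fun (fun k => Z (s k) (i k) : Omega -> R).

Definition cylinders : set (set Omega) :=
  [set A | exists n (s : 'I_n -> D) (i : 'I_n -> 'I_p) (S : set 'rV[R]_n),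
    measurable S /\ A = field_row s i @^-1` S].

Lemma cylinders_measurable : cylinders `<=` measurable.
Proof.
move=> _ [n [s [i [S [mS ->]]]]].
by rewrite -[X in measurable X]setTI; exact: measurable_row_of_fun.
Qed.

(** The two samples are concatenated and each base is pulled back along a projection, which makes
    set operations on cylinders operations on bases. *)
Lemma cylinders_common A A' : cylinders A -> cylinders A' ->
  exists n (s : 'I_n -> D) (i : 'I_n -> 'I_p) (S S' : set 'rV[R]_n),
    [/\ measurable S, measurable S', A = field_row s i @^-1` S &
        A' = field_row s i @^-1` S'].
Proof.
move=> [n [s [i [S [mS ->]]]]] [n' [s' [i' [S' [mS' ->]]]]].
exists (n + n')%N, (fun k : 'I_(n + n') => match fintype.split k with inl k => s k | inr k => s' k end),
  (fun k : 'I_(n + n') => match fintype.split k with inl k => i k | inr k => i' k end),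
  ((fun v : 'rV[R]_(n + n') => lsubmx v) @^-1` S),
  ((fun v : 'rV[R]_(n + n') => rsubmx v) @^-1` S').
split.
- rewrite -[X in measurable X]setTI; apply: measurable_rVP => // k.
  under eq_fun do rewrite mxE; exact: measurable_coord.
- rewrite -[X in measurable X]setTI; apply: measurable_rVP => // k.
  under eq_fun do rewrite mxE; exact: measurable_coord.
- rewrite -comp_preimage; congr (_ @^-1` S); apply/funext => w /=.
  by apply/rowP => k; rewrite !mxE (unsplitK (inl k : 'I_n + 'I_n')).
- rewrite -comp_preimage; congr (_ @^-1` S'); apply/funext => w /=.
  by apply/rowP => k; rewrite !mxE (unsplitK (inr k : 'I_n + 'I_n')).
Qed.

Lemma cylinders_setT : cylinders setT.
Proof.
have ord0_fun (X : Type) : 'I_0 -> X by case.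
exists 0%N, (ord0_fun _), (ord0_fun _), setT.
by split => //; rewrite preimage_setT.
Qed.

Lemma cylinders_setring : setring cylinders.
Proof.
split.
- case: cylinders_setT => n [s [i _]].
  by exists n, s, i, set0; split => //; rewrite preimage_set0.
- move=> A A' cA cA'; have [n [s [i [S [S' [mS mS' -> ->]]]]]] := cylinders_common cA cA'.
  by exists n, s, i, (S `|` S'); split; [exact: measurableU|rewrite preimage_setU].
- move=> A A' cA cA'; have [n [s [i [S [S' [mS mS' -> ->]]]]]] := cylinders_common cA cA'.
  by exists n, s, i, (S `\` S'); split; [exact: measurableD|].
Qed.

(** The whole space is a cylinder, so the generated sigma-ring is closed under complement and is a
    sigma-algebra. *)
Lemma field_sigma_algebra_cylinders : field_sigma_algebra Z `<=` <<sr cylinders>>.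
Proof.
have [sr0 srD srU] := smallest_sigma_ring cylinders.
apply: smallest_sub; first split => //.
- by move=> A srA; apply: srD => //; apply: sub_g_sigma_ring; exact: cylinders_setT.
move=> _ [t [i [B [mB ->]]]]; apply: sub_g_sigma_ring.
exists 1%N, (fun=> t), (fun=> i), ((fun v => v 0 0) @^-1` B); split.
  by rewrite -[X in measurable X]setTI; exact: measurable_coord.
by rewrite -comp_preimage; congr (_ @^-1` B); apply/funext => w /=; rewrite mxE.
Qed.

Lemma field_event_measurable A : field_sigma_algebra Z A -> measurable A.
Proof.
move=> /field_sigma_algebra_cylinders; apply: smallest_sub; last exact: cylinders_measurable.
split; [exact: measurable0|exact: measurableD|exact: bigcupT_measurable].
Qed.

Lemma field_sigma_algebraC A : field_sigma_algebra Z A -> field_sigma_algebra Z (~` A).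
Proof.
have [_ + _] := smallest_sigma_algebra setT
  [set A | exists t i (B : set R), measurable B /\ A = Z t i @^-1` B].
by move=> /(_ A); rewrite setTD.
Qed.

Lemma centered_gaussian_field_family (P : probability Omega R) (K : 'rV[R]_d -> 'M[R]_p)
    n (s : 'I_n -> D) (i : 'I_n -> 'I_p) : centered_gaussian_field P Z K ->
  centered_gaussian_family P (fun k => Z (s k) (i k))
    (fun k l => covariance_matrix (fun k => val (s k)) i K k l).
Proof.
move=> [gZ Z0 Zcov]; split => // k l.
by rewrite mxE; exact: Zcov.
Qed.

(** Symmetry is inherited from the symmetry of the covariance of two random variables. *)
Lemma covariance_matrix_sym (P : probability Omega R) (K : 'rV[R]_d -> 'M[R]_p)
    n (s : 'I_n -> D) (i : 'I_n -> 'I_p) : centered_gaussian_field P Z K ->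
  (covariance_matrix (fun k => val (s k)) i K)^T = covariance_matrix (fun k => val (s k)) i K.
Proof.
move=> gZ; have [_ _ cov] := centered_gaussian_field_family s i gZ.
by apply/matrixP => k l; apply: EFin_inj; rewrite mxE -!cov covarianceC.
Qed.

Lemma cylinder_comparison_equivalent (P0 P1 : probability Omega R) (K de : R) : 0 < de ->
  (forall A L, cylinders A ->
    (P1 A <= (expR L)%:E * P0 A + (expR (- (L * de)) * K)%:E)%E /\
    (P0 A <= (expR L)%:E * P1 A + (expR (- (L * de)) * K)%:E)%E) ->
  equivalent_on_paths P0 P1 Z.
Proof.
move=> de0 h A mA; have mAC := field_sigma_algebra_cylinders (field_sigma_algebraC mA).
split; apply: (measure_comparison_one (K := K) de0 (field_event_measurable mA)) => L.
  apply: (measure_comparison_sigma_ring cylinders_setring cylinders_measurable _ _ mAC).2.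
    exact: expR_gt0.
  by move=> E /(h E L)[].
apply: (measure_comparison_sigma_ring cylinders_setring cylinders_measurable _ _ mAC).2.
  exact: expR_gt0.
by move=> E /(h E L)[].
Qed.

End cylinders.

Local Open Scope complex_scope.
Local Open Scope sesquilinear_scope.

Theorem theorem1 (R : realType) (d p : nat) (hd : (0 < d)%N) (hp : (0 < p)%N)
  (D : set 'rV[R]_d) (Dbounded : bounded_set D) (Dinterior : D° !=set0)
  (R0 R1 : 'rV[R]_d -> 'M[R]_p) (F0 F1 : 'rV[R]_d -> 'M[R[i]]_p)
  (R0cov : covariance_function R0) (R1cov : covariance_function R1)
  (F0spec : spectral_density R0 F0) (F1spec : spectral_density R1 F1)
  (dO : measure_display) (Omega : measurableType dO)
  (Z : D -> 'I_p -> {mfun Omega >-> R})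
  (P0 P1 : probability Omega R)
  (P0gauss : centered_gaussian_field P0 Z R0)
  (P1gauss : centered_gaussian_field P1 Z R1)
  (c1 c2 b : R) (gamma : 'rV[R]_d -> R)
  (c1_gt0 : 0 < c1) (c1c2 : c1 < c2) (b_gt0 : 0 < b)
  (gammaW : bandlimited (cube b) (fun l => const_mx (gamma l)%:C : 'cV[R[i]]_p))
  (F0bounds : forall l,
     loewner_le (c1 * gamma l ^+ 2)%:C%:M (F0 l) /\
     loewner_le (F0 l) (c2 * gamma l ^+ 2)%:C%:M)
  (F1bounds : forall l,
     loewner_le (c1 * gamma l ^+ 2)%:C%:M (F1 l) /\
     loewner_le (F1 l) (c2 * gamma l ^+ 2)%:C%:M)
  (B : 'rV[R]_d -> 'rV[R]_d -> 'M[R[i]]_p)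
  (Bmeas : forall i j, cmeasurable
     (fun z : 'rV[R]_d * 'rV[R]_d => B z.1 z.2 i j))
  (Bherm : forall l m, B l m = (B m l)^t*)
  (Bint : forall i j,
     (\int[lebesgue_rV R d \x lebesgue_rV R d]_z
        (cabs (B z.1 z.2 i j) ^+ 2 * opnorm (F0 z.1) * opnorm (F0 z.2))%:E
      < +oo)%E)
  (BR : forall t s, D t -> D s ->
     map_mx (real_complex R) (R1 (t - s) - R0 (t - s)) =
     mxintegral (lebesgue_rV R d \x lebesgue_rV R d)%E
       (fun z => cis (- dotv z.1 t + dotv z.2 s) *:
                 (F0 z.1 *m B z.1 z.2 *m F0 z.2))) :
  equivalent_on_paths P0 P1 Z.

Proof.
have c2_gt0 : 0 < c2 by exact: lt_trans c1c2.
pose g l := gamma l ^+ 2.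
have g0 l : 0 <= g l by exact: sqr_ge0.
have Fge0 l : loewner_le (c1 * g l)%:C%:M (F0 l) by exact: (F0bounds l).1.
have Fle0 l : loewner_le (F0 l) (c2 * g l)%:C%:M by exact: (F0bounds l).2.
have Fge1 l : loewner_le (c1 * g l)%:C%:M (F1 l) by exact: (F1bounds l).1.
have Fle1 l : loewner_le (F1 l) (c2 * g l)%:C%:M by exact: (F1bounds l).2.
(* Both densities lie between the same multiples of [gamma ^ 2], so a single [c] gives the two-sided
   bounds [c] and [c^-1] on the variance ratios. *)
pose c := c1 / c2.
have c_gt0 : 0 < c by rewrite divr_gt0.
have c_le1 : c <= 1 by rewrite ler_pdivrMr// mul1r ltW.
have cV : c^-1 = c2 / c1 by rewrite invf_div.
have := @spectral_diagonal_bound R d p R0 R1 F0 c1 c2 g hp F0spec c1_gt0 c2_gt0 g0 Fge0 Fle0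
  B Bmeas Bint.
(* [S0] is fixed before any sample is introduced, which makes the cylinder comparison uniform. *)
set S0 := _ * _ * fine _ => HS.
apply: (@cylinder_comparison_equivalent _ _ _ _ _ _ Z P0 P1
  (expR ((1 + (2 * c)^-1) * (S0 / c ^+ 2))) (2 * c^-1)^-1).
  by rewrite invr_gt0 mulr_gt0// invr_gt0.
move=> _ L [n [s [i [S [mS ->]]]]].
pose t k := val (s k).
apply: (@gaussian_cylinder_comparison _ _ _ _ (fun k => Z (s k) (i k)) P0 P1
  (covariance_matrix t i R0) (covariance_matrix t i R1) c S0) => //.
- exact: centered_gaussian_field_family.
- exact: centered_gaussian_field_family.
- exact: covariance_matrix_sym P0gauss.
- exact: covariance_matrix_sym P1gauss.
- move=> a; rewrite (qform_covariance_matrix _ _ F0spec); apply: Rintegral_ge0 => l _.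
  by rewrite -(hquad0 (phase_vector t i a l)); apply: hquad_le; case: F0spec.
(* The lower bound is the upper comparison with the roles of the two densities exchanged. *)
- move=> a; rewrite -(ler_pM2l (_ : 0 < c^-1)) ?invr_gt0// mulrA mulVf ?gt_eqF// mul1r cV.
  exact: (qform_covariance_le t i F1spec F0spec c1_gt0 c2_gt0 Fge1 Fle0).
- move=> a; rewrite cV.
  exact: (qform_covariance_le t i F0spec F1spec c1_gt0 c2_gt0 Fge0 Fle1).
- move=> r A q A0 A1; apply: HS A0 A1 => m m'.
  by apply: BR; exact: set_valP.
Qed.
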